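(* Let $\mathcal K$ be an $\infty$-cosmos. Tight cosmological limits exist in the enhanced simplicial category $\mathbf{Rali}(\mathcal K)$ of rali-isofibrations of $\mathcal K$, and are preserved by the inclusion $$\mathbf{Rali}(\mathcal K)\hookrightarrow\mathcal K^{\mathrm{isof}}_{\mathrm{chordate}}.$$
   Context: Enhanced simplicial categories. An enhanced simplicial set is a simplicial set $S_\lambda$ together with a full simplicial subset $S_\tau$ spanned by a set of vertices, called tight; maps are simplicial maps preserving tight vertices. These form a Cartesian closed category $\mathscr F_\Delta$. An enhanced simplicial category $\mathbb K$ is a category enriched in $\mathscr F_\Delta$, i.e. a simplicially enriched category $\mathcal K_\lambda$ in which certain $0$-arrows (vertices of homs) are called tight, the identities being tight and tight $0$-arrows being closed under composition; arbitrary $0$-arrows are called loose. Its tight part $\mathcal K_\tau$ has the same objects and homs the full simplicial subsets on the tight $0$-arrows. For a simplicial category $\mathcal C$, $\mathcal C_{\mathrm{chordate}}$ is the enhanced simplicial category with loose part $\mathcal C$ in which every $0$-arrow is tight. $\infty$-cosmoi. An $\infty$-cosmos is a category enriched in quasi-categories with a class of $0$-arrows called isofibrations ($\twoheadrightarrow$), such that: it has a terminal object, small products, pullbacks of isofibrations, limits of countable chains of isofibrations, and powers by simplicial sets, all simplicially enriched (the cosmological limits); isofibrations contain isomorphisms and all $0$-arrows to the terminal object, are closed under composition, products, pullback, limits of countable chains, and Leibniz exponentials with monomorphisms of simplicial sets, and are sent by each $\mathcal K(X,-)$ to isofibrations of quasi-categories. The homotopy $2$-category $h\mathcal K$ has the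 same objects and hom-categories the homotopy categories of the quasi-categories $\mathcal K(A,B)$. Isofibrations. $\mathcal K^{\mathrm{isof}}$ is the $\infty$-cosmos with objects the isofibrations $p\colon E\twoheadrightarrow B$ of $\mathcal K$, with hom from $p_1$ to $p_2$ the pullback $\mathcal K(E_1,E_2)\times_{\mathcal K(E_1,B_2)}\mathcal K(B_1,B_2)$; its $0$-arrows are commutative squares $(e\colon E_1\to E_2,\,b\colon B_1\to B_2)$, $p_2e=bp_1$, called morphisms of isofibrations. Its isofibrations are the $(e,b)$ with $e$, $b$ and the induced $E_1\to B_1\times_{B_2}E_2$ isofibrations. Its cosmological limits are computed pointwise. Ralis. A rali-isofibration of $\mathcal K$ is an isofibration $p\colon E\twoheadrightarrow B$ which has a left adjoint $l$ in $h\mathcal K$ with invertible unit. A morphism of isofibrations $(e,b)\colon p_1\to p_2$ between rali-isofibrations is a morphism of ralis if its mate $l_2b\Rightarrow l_2bp_1l_1=l_2p_2el_1\Rightarrow el_1$ (unit of $l_1\dashv p_1$ followed by counit of $l_2\dashv p_2$) is invertible in $h\mathcal K$. $\mathbf{Rali}(\mathcal K)$ is the enhanced simplicial category whose loose part is the full simplicial subcategory of $\mathcal K^{\mathrm{isof}}$ on the rali-isofibrations, the tight $0$-arrows being the morphisms of ralis. Its tight part is an $\infty$-cosmos whose isofibrations and cosmological limits are created by the inclusion into $\mathcal K^{\mathrm{isof}}$. Tight cosmological limits. Let $\mathbb K$ have tight part $\mathcal K_\tau$ an $\infty$-cosmos. Tight cosmological limits exist in $\mathbb K$ if every cosmological limit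 in $\mathcal K_\tau$ is preserved, as a simplicially enriched limit, by the inclusion $\mathcal K_\tau\to\mathcal K_\lambda$, and its limit projections jointly reflect tightness: a loose $0$-arrow $X\leadsto L$ into the limit is tight if and only if all its composites with the limit projections are tight. *)

(* Defs.v *)
From mathcomp Require Import all_boot.
From mathcomp Require Import boolp.

Set Implicit Arguments.
Unset Strict Implicit.
Unset Printing Implicit Defensive.

(* The universe of small sets: simplicial sets take values in it, and products
   in an oo-cosmos are indexed by its members.  The objects of a simplicial
   category are allowed to live in a larger universe. *)
Definition small := Type.

Lemma sig_eq (T : Type) (P : T -> Prop) (u v : {x | P x}) :
  proj1_sig u = proj1_sig v -> u = v.
Proof.
case: u v => [x px] [y py] /= exy; subst y.
by rewrite (Prop_irrelevance px py).
Qed.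

(** * Simplicial sets *)

Record mono (m n : nat) := Mono {
  mono_fun :> 'I_m.+1 -> 'I_n.+1;
  mono_le : forall i j : 'I_m.+1, i <= j -> mono_fun i <= mono_fun j }.

Lemma mono_eq m n (f g : mono m n) : (forall i, f i = g i) -> f = g.
Proof.
case: f g => [f hf] [g hg] /= /funext efg; subst g.
by rewrite (Prop_irrelevance hf hg).
Qed.

Definition mono_id n : mono n n := @Mono n n id (fun _ _ h => h).

Definition mono_comp l m n (g : mono m n) (f : mono l m) : mono l n :=
  @Mono l n (fun i => g (f i)) (fun i j h => mono_le g (mono_le f h)).

Definition mono_const m n (k : 'I_n.+1) : mono m n :=
  @Mono m n (fun _ => k) (fun _ _ _ => leqnn k).

Lemma face_subproof n (k : 'I_n.+2) (i j : 'I_n.+1) :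
  i <= j -> lift k i <= lift k j.
Proof. by move=> h; rewrite /= leq_bump2. Qed.

Definition face n (k : 'I_n.+2) : mono n n.+1 :=
  Mono (@face_subproof n k).

Record sset := SSet {
  simplex :> nat -> small;
  act : forall m n, mono m n -> simplex n -> simplex m;
  act_id : forall n (x : simplex n), act (mono_id n) x = x;
  act_comp : forall l m n (g : mono m n) (f : mono l m) (x : simplex n),
    act (mono_comp g f) x = act f (act g x) }.
Arguments act {s m n} _ _.

Record smap (X Y : sset) := SMap {
  smap_fun :> forall n, X n -> Y n;
  smap_nat : forall m n (t : mono m n) (x : X n),
    smap_fun (act t x) = act t (smap_fun x) }.
Arguments smap_fun {X Y} _ n _.

Definition smono (X Y : sset) (F : smap X Y) : Prop :=
  forall n, injective (F n).

Definition vtx (X : sset) n (i : 'I_n.+1) (x : X n) : X 0 :=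
  act (mono_const 0 i) x.

(* The totally degenerate n-simplex on a vertex. *)
Definition cst (X : sset) n (x : X 0) : X n := act (mono_const n ord0) x.
Arguments cst {X} n x.

Definition spoint : sset :=
  @SSet (fun _ => unit) (fun _ _ _ x => x) (fun _ _ => erefl)
    (fun _ _ _ _ _ _ => erefl).

Definition sprod (X Y : sset) : sset.
Proof.
refine (@SSet (fun n => (X n * Y n)%type)
  (fun m n t xy => (act t xy.1, act t xy.2)) _ _).
- by move=> n [x y] /=; rewrite !act_id.
- by move=> l m n g f [x y] /=; rewrite !act_comp.
Defined.

Definition Delta (n : nat) : sset.
Proof.
refine (@SSet (fun m => mono m n) (fun l m t s => mono_comp s t) _ _).
- by move=> m s; apply: mono_eq.
- by move=> k l m g f s; apply: mono_eq.
Defined.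

(* The k-th horn of Delta n: the simplices missing some vertex i <> k. *)
Definition horn (n : nat) (k : 'I_n.+1) : sset.
Proof.
refine (@SSet
  (fun m => {s : mono m n | exists2 i : 'I_n.+1, i <> k & forall j, s j <> i})
  (fun l m t s => exist _ (mono_comp (proj1_sig s) t) _) _ _).
- by move=> m s; apply: sig_eq; apply: mono_eq.
- by move=> j l m g f s; apply: sig_eq; apply: mono_eq.
Unshelve.
by case: s => s [i nik hi] /=; exists i => // j; apply: hi.
Defined.

(** * Homotopy categories *)

Definition esrc (X : sset) (e : X 1) : X 0 := vtx ord0 e.
Definition etgt (X : sset) (e : X 1) : X 0 := vtx ord_max e.

(* Composable strings of edges, written in diagrammatic order. *)
Fixpoint chain (X : sset) (x : X 0) (w : seq (X 1)) (y : X 0) : Prop :=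
  if w is e :: w' then esrc e = x /\ chain (etgt e) w' y else x = y.

(* The homotopy category of X is the free category on the graph of vertices
   and edges, modulo the degenerate edges and the 2-simplices.  Its arrows from
   x to y are the strings w with [chain x w y], and [heq x y] is equality of
   arrows.  The edges of a 2-simplex s are [act (face k) s], opposite to the
   vertex k. *)
Inductive heq (X : sset) (x y : X 0) : seq (X 1) -> seq (X 1) -> Prop :=
| heq_refl w : chain x w y -> heq x y w w
| heq_sym w w' : heq x y w w' -> heq x y w' w
| heq_trans w w' w'' : heq x y w w' -> heq x y w' w'' -> heq x y w w''
| heq_unit w1 (z : X 0) w2 : chain x (w1 ++ cst 1 z :: w2) y ->
    heq x y (w1 ++ cst 1 z :: w2) (w1 ++ w2)
| heq_tri w1 (s : X 2) w2 :
    chain x (w1 ++ act (face (inord 1)) s :: w2) y ->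
    heq x y
      (w1 ++ act (face (inord 2)) s :: act (face (inord 0)) s :: w2)
      (w1 ++ act (face (inord 1)) s :: w2).

Definition hiso (X : sset) (x y : X 0) (w : seq (X 1)) : Prop :=
  chain x w y /\
  exists w', [/\ chain y w' x, heq x x (w ++ w') [::] & heq y y (w' ++ w) [::]].

Definition hmap (X Y : sset) (F : smap X Y) (w : seq (X 1)) : seq (Y 1) :=
  map (F 1) w.

(** * Quasi-categories *)

Definition quasicat (X : sset) : Prop :=
  forall n (k : 'I_n.+1), 0 < k < n -> forall h : smap (horn k) X,
  exists x : X n, forall m (t : horn k m), h m t = act (proj1_sig t) x.

Definition inner_fibration (X Y : sset) (F : smap X Y) : Prop :=
  forall n (k : 'I_n.+1), 0 < k < n ->
  forall (h : smap (horn k) X) (y : Y n),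
  (forall m (t : horn k m), F m (h m t) = act (proj1_sig t) y) ->
  exists x : X n, F n x = y /\
    forall m (t : horn k m), h m t = act (proj1_sig t) x.

(* For a map between quasi-categories: an inner fibration along which
   isomorphisms lift. *)
Definition qisofibration (X Y : sset) (F : smap X Y) : Prop :=
  inner_fibration F /\
  forall (x : X 0) (e : Y 1),
    esrc e = F 0 x -> hiso (esrc e) (etgt e) [:: e] ->
    exists e' : X 1,
      [/\ esrc e' = x, F 1 e' = e & hiso (esrc e') (etgt e') [:: e']].

(** * Simplicially enriched categories *)

Record scat := SCat {
  obj :> Type;
  hom : obj -> obj -> sset;
  comp : forall A B C n, hom B C n -> hom A B n -> hom A C n;
  idv : forall A, hom A A 0;
  comp_nat : forall A B C m n (t : mono m n) (g : hom B C n) (f : hom A B n),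
    act t (comp g f) = comp (act t g) (act t f);
  comp_assoc : forall A B C D n
      (h : hom C D n) (g : hom B C n) (f : hom A B n),
    comp h (comp g f) = comp (comp h g) f;
  comp_idl : forall A B n (f : hom A B n), comp (cst n (idv B)) f = f;
  comp_idr : forall A B n (f : hom A B n), comp f (cst n (idv A)) = f }.
Arguments hom {s} _ _.
Arguments comp {s A B C n} _ _.
Arguments idv {s} _.

(* 0-arrows. *)
Notation arr A B := (simplex (hom A B) 0).

Section SimplicialCategoryTheory.
Variable C : scat.
Implicit Types A B D : C.

Lemma cst0 (X : sset) (x : X 0) : cst 0 x = x.
Proof.
rewrite /cst -[RHS]act_id; congr (act _ _).
by apply: mono_eq => i /=; rewrite ord1.
Qed.

Lemma act_cst (X : sset) m n (t : mono m n) (x : X 0) :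
  act t (cst n x) = cst m x.
Proof. by rewrite /cst -act_comp; congr (act _ _); apply: mono_eq. Qed.

Lemma smap_cst (X Y : sset) (F : smap X Y) n (x : X 0) :
  F n (cst n x) = cst n (F 0 x).
Proof. exact: smap_nat. Qed.

Lemma cst_comp A B D n (g : arr B D) (f : arr A B) :
  cst n (comp g f) = comp (cst n g) (cst n f).
Proof. exact: comp_nat. Qed.

(* Composition with a 0-arrow, as a simplicial map between homs; on homotopy
   categories this is whiskering in the homotopy 2-category. *)
Definition post A B D (g : arr B D) : smap (hom A B) (hom A D).
Proof.
refine (@SMap (hom A B) (hom A D) (fun n f => comp (cst n g) f) _).
by move=> m n t f; rewrite comp_nat act_cst.
Defined.

Definition pre A B D (f : arr A B) : smap (hom B D) (hom A D).
Proof.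
refine (@SMap (hom B D) (hom A D) (fun n g => comp g (cst n f)) _).
by move=> m n t g; rewrite comp_nat act_cst.
Defined.

Definition is_iso A B (f : arr A B) : Prop :=
  exists g : arr B A, comp g f = idv A /\ comp f g = idv B.

End SimplicialCategoryTheory.
Arguments post {C} A {B D} g.
Arguments pre {C A B} D f.

Record sfunctor (C D : scat) := SFunctor {
  fobj :> C -> D;
  fhom : forall A B, smap (hom A B) (hom (fobj A) (fobj B));
  fhom_id : forall A, fhom A A 0 (idv A) = idv (fobj A);
  fhom_comp : forall A B E n (g : hom B E n) (f : hom A B n),
    fhom A E n (comp g f) = comp (fhom B E n g) (fhom A B n f) }.
Arguments fhom {C D} _ {A B}.

(** * Weighted limits *)

(* The shapes of all cosmological limits are free categories, so a diagram is
   given by a directed graph of objects and 0-arrows. *)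
Record graph := Graph {
  node : small;
  link : small;
  dom : link -> node;
  cod : link -> node }.

Definition discrete (I : small) : graph :=
  @Graph I void (fun a => match a with end) (fun a => match a with end).

(* Some true --> None <-- Some false *)
Definition cospan : graph := @Graph (option bool) bool some (fun _ => None).

(* ... --> 2 --> 1 --> 0 *)
Definition tower : graph := @Graph nat nat S id.

Record diagram (Q : graph) (C : scat) := Diagram {
  dob : node Q -> C;
  darr : forall a : link Q, arr (dob (dom a)) (dob (cod a)) }.
Arguments darr {Q C} _ _.

Definition family (C : scat) (I : small) (A : I -> C) :
    diagram (discrete I) C :=
  @Diagram (discrete I) C A (fun a : void => match a with end).

Definition cospan_diagram (C : scat) (X Y Z : C) (g : arr X Z) (h : arr Y Z) :
    diagram cospan C :=
  @Diagram cospan C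
    (fun o : option bool => match o with
       | Some true => X | Some false => Y | None => Z end)
    (fun a : bool => match a with true => g | false => h end).

(* Cones over D weighted by the functor constant at the simplicial set U: the
   case U = spoint is that of ordinary (conical) limits, and the case of a
   single object A is that of the power A^U. *)
Record cone (U : sset) (Q : graph) (C : scat) (D : diagram Q C) := Cone {
  apex : C;
  leg : forall j, smap U (hom apex (dob D j));
  leg_nat : forall (a : link Q) n (u : U n),
    comp (cst n (darr D a)) (leg (dom a) n u) = leg (cod a) n u }.
Arguments apex {U Q C D} _.
Arguments leg {U Q C D} _ _.

Definition proj (U : sset) (Q : graph) (C : scat) (D : diagram Q C)
    (c : cone U D) (j : node Q) (u : U 0) : arr (apex c) (dob D j) :=
  leg c j 0 u.

(* The universal property of an enriched limit: the simplicial map from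
   hom X (apex c) to the simplicial set of weighted cones with vertex X, whose
   n-simplices are the compatible families of maps
   U x Delta n -> hom X (D j), is bijective. *)
Definition is_limit (U : sset) (Q : graph) (C : scat) (D : diagram Q C)
    (c : cone U D) : Prop :=
  forall (X : C) (n : nat)
    (phi : forall j, smap (sprod U (Delta n)) (hom X (dob D j))),
    (forall (a : link Q) m (v : sprod U (Delta n) m),
       comp (cst m (darr D a)) (phi (dom a) m v) = phi (cod a) m v) ->
    exists! f : hom X (apex c) n,
      forall j m (u : U m) (t : mono m n),
        comp (leg c j m u) (act t f) = phi j m (u, t).

Definition map_diagram (C C' : scat) (F : sfunctor C C') (Q : graph)
    (D : diagram Q C) : diagram Q C' :=
  @Diagram Q C' (fun j => F (dob D j)) (fun a => fhom F 0 (darr D a)).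

Definition map_cone (C C' : scat) (F : sfunctor C C') (U : sset) (Q : graph)
    (D : diagram Q C) (c : cone U D) : cone U (map_diagram F D).
Proof.
refine (@Cone U Q C' (map_diagram F D) (F (apex c))
  (fun j => @SMap U (hom (F (apex c)) (F (dob D j)))
     (fun n u => fhom F n (leg c j n u)) _) _).
- by move=> a n u /=; rewrite -smap_cst -fhom_comp leg_nat.
Unshelve.
by move=> m n t u; rewrite !smap_nat.
Defined.

(** * oo-cosmoi *)

Definition arrow_class (C : scat) := forall A B : C, arr A B -> Prop.

(* The diagrams, with their weights, whose limits are the cosmological ones.
   The terminal object is the product indexed by the empty type. *)
Inductive cosmological (C : scat) (isof : arrow_class C) :
    forall (U : sset) (Q : graph), diagram Q C -> Prop :=
| cosm_product (I : small) (D : diagram (discrete I) C) :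
    cosmological isof spoint D
| cosm_pullback (D : diagram cospan C) :
    isof _ _ (darr D true) -> cosmological isof spoint D
| cosm_tower (D : diagram tower C) :
    (forall n : nat, isof _ _ (darr D n)) -> cosmological isof spoint D
| cosm_power (U : sset) (A : C) :
    cosmological isof U (family (fun _ : unit => A)).
Arguments cosmological {C} isof U {Q} D.

Record is_cosmos (C : scat) (isof : arrow_class C) : Prop := IsCosmos {
  cosmos_hom : forall A B : C, quasicat (hom A B);
  cosmos_lim : forall (U : sset) (Q : graph) (D : diagram Q C),
    cosmological isof U D -> exists c : cone U D, is_limit c;
  isof_iso : forall (A B : C) (f : arr A B), is_iso f -> isof _ _ f;
  isof_terminal : forall (D : diagram (discrete void) C) (c : cone spoint D),
    is_limit c -> forall (A : C) (f : arr A (apex c)), isof _ _ f;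
  isof_comp : forall (A B E : C) (g : arr B E) (f : arr A B),
    isof _ _ g -> isof _ _ f -> isof _ _ (comp g f);
  isof_product : forall (I : small) (A B : I -> C)
      (a : cone spoint (family A)) (b : cone spoint (family B))
      (f : forall i, arr (A i) (B i)) (g : arr (apex a) (apex b)),
    is_limit a -> is_limit b -> (forall i, isof _ _ (f i)) ->
    (forall i, comp (proj b i tt) g = comp (f i) (proj a i tt)) ->
    isof _ _ g;
  isof_pullback : forall (D : diagram cospan C) (c : cone spoint D),
    isof _ _ (darr D true) -> is_limit c -> isof _ _ (proj c (Some false) tt);
  isof_tower : forall (D : diagram tower C) (c : cone spoint D),
    (forall n : nat, isof _ _ (darr D n)) -> is_limit c ->
    isof _ _ (proj c 0 tt);
  (* For a monomorphism i : U -> V and an isofibration f : A -> B, the arrow g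
     is the comparison A^V -> A^U x_(B^U) B^V. *)
  isof_leibniz : forall (U V : sset) (i : smap U V) (A B : C) (f : arr A B)
      (aU : cone U (family (fun _ : unit => A)))
      (aV : cone V (family (fun _ : unit => A)))
      (bU : cone U (family (fun _ : unit => B)))
      (bV : cone V (family (fun _ : unit => B)))
      (fU : arr (apex aU) (apex bU)) (Bi : arr (apex bV) (apex bU))
      (P : cone spoint (cospan_diagram fU Bi)) (g : arr (apex aV) (apex P)),
    smono i -> isof _ _ f ->
    is_limit aU -> is_limit aV -> is_limit bU -> is_limit bV -> is_limit P ->
    (forall n (u : U n),
       comp (leg bU tt n u) (cst n fU) = comp (cst n f) (leg aU tt n u)) ->
    (forall n (u : U n), comp (leg bU tt n u) (cst n Bi) = leg bV tt n (i n u)) ->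
    (forall n (u : U n),
       comp (leg aU tt n u) (cst n (comp (proj P (Some true) tt) g)) =
       leg aV tt n (i n u)) ->
    (forall n (v : V n),
       comp (leg bV tt n v) (cst n (comp (proj P (Some false) tt) g)) =
       comp (cst n f) (leg aV tt n v)) ->
    isof _ _ g;
  isof_hom : forall (X A B : C) (f : arr A B),
    isof _ _ f -> qisofibration (post X f) }.

Record cosmos := Cosmos {
  cosmos_scat :> scat;
  isofib : arrow_class cosmos_scat;
  cosmosP : is_cosmos isofib }.
Arguments isofib {c A B} _.

(** * Enhanced simplicial categories *)

Record escat := ESCat {
  loose : scat;
  tight : arrow_class loose;
  tight_id : forall A : loose, tight (idv A);
  tight_comp : forall (A B C : loose) (g : arr B C) (f : arr A B),
    tight g -> tight f -> tight (comp g f) }.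
Arguments tight {e A B} _.

Lemma vtx_cst (X : sset) n (i : 'I_n.+1) (x : X 0) : vtx i (cst n x) = x.
Proof. by rewrite /vtx act_cst cst0. Qed.

Lemma vtx_act (X : sset) m n (t : mono m n) (i : 'I_m.+1) (x : X n) :
  vtx i (act t x) = vtx (t i) x.
Proof. by rewrite /vtx -act_comp; congr (act _ _); apply: mono_eq. Qed.

Definition full_ssub (X : sset) (P : X 0 -> Prop) : sset.
Proof.
refine (@SSet (fun n => {x : X n | forall i, P (vtx i x)})
  (fun m n t x => exist _ (act t (proj1_sig x)) _) _ _).
- by move=> n x; apply: sig_eq; apply: act_id.
- by move=> l m n g f x; apply: sig_eq; apply: act_comp.
Unshelve.
by case: x => x px i /=; rewrite vtx_act; apply: px.
Defined.

Definition tight_part (K : escat) : scat.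
Proof.
refine (@SCat (loose K)
  (fun A B => @full_ssub (hom A B) (@tight K A B))
  (fun A B C n g f => exist _ (comp (proj1_sig g) (proj1_sig f)) _)
  (fun A => exist _ (idv A) _) _ _ _ _).
- by move=> A B C m n t g f; apply: sig_eq; apply: comp_nat.
- by move=> A B C D n h g f; apply: sig_eq; apply: comp_assoc.
- by move=> A B n f; apply: sig_eq; apply: comp_idl.
- by move=> A B n f; apply: sig_eq; apply: comp_idr.
Unshelve.
- case: g f => [g hg] [f hf] i /=; rewrite /vtx comp_nat.
  by apply: tight_comp; [apply: hg | apply: hf].
- by move=> i; rewrite -[idv A]cst0 vtx_cst; apply: tight_id.
Defined.

Definition tight_incl (K : escat) : sfunctor (tight_part K) (loose K) :=
  @SFunctor (tight_part K) (loose K) id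
    (fun A B : loose K => @SMap (@full_ssub (hom A B) (@tight K A B)) (hom A B)
       (fun n x => proj1_sig x) (fun _ _ _ _ => erefl))
    (fun _ => erefl) (fun _ _ _ _ _ _ => erefl).

Record efunctor (K L : escat) := EFunctor {
  efun :> sfunctor (loose K) (loose L);
  efun_tight : forall (A B : loose K) (f : arr A B),
    tight f -> tight (fhom efun 0 f) }.

Definition tight_functor (K L : escat) (F : efunctor K L) :
  sfunctor (tight_part K) (tight_part L).
Proof.
refine (@SFunctor (tight_part K) (tight_part L) (fun A : loose K => F A)
  (fun A B : loose K => @SMap (@full_ssub (hom A B) (@tight K A B))
     (@full_ssub (hom (F A) (F B)) (@tight L (F A) (F B)))
     (fun n x => exist _ (fhom F n (proj1_sig x)) _) _) _ _).
- by move=> A; apply: sig_eq; apply: fhom_id.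
- by move=> A B E n g f; apply: sig_eq; apply: fhom_comp.
Unshelve.
- by case: x => x hx i /=; rewrite /vtx -smap_nat; apply: efun_tight; apply: hx.
- by move=> m n t x; apply: sig_eq; apply: smap_nat.
Defined.

Definition chordate (C : scat) : escat :=
  @ESCat C (fun _ _ _ => True) (fun _ => I) (fun _ _ _ _ _ _ _ => I).

(* A limit cone in the tight part which is also a limit cone in the loose part
   and whose projections jointly reflect tightness. *)
Definition is_tight_limit (K : escat) (U : sset) (Q : graph)
    (D : diagram Q (tight_part K)) (c : cone U D) : Prop :=
  [/\ is_limit c,
      is_limit (map_cone (tight_incl K) c) &
      forall (X : loose K) (f : arr X (apex (map_cone (tight_incl K) c))),
        tight f <->
        forall j (u : U 0),
          tight (comp (proj (map_cone (tight_incl K) c) j u) f)].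

(* Here isof is the class of isofibrations of the tight part.  The existence
   clause is automatic when the tight part is known to be an oo-cosmos. *)
Definition tight_cosmological_limits_exist (K : escat)
    (isof : arrow_class (tight_part K)) : Prop :=
  forall (U : sset) (Q : graph) (D : diagram Q (tight_part K)),
    cosmological isof U D ->
    (exists c : cone U D, is_limit c) /\
    (forall c : cone U D, is_limit c -> is_tight_limit c).

Definition preserves_tight_cosmological_limits (K L : escat)
    (isof : arrow_class (tight_part K)) (F : efunctor K L) : Prop :=
  forall (U : sset) (Q : graph) (D : diagram Q (tight_part K)) (c : cone U D),
    cosmological isof U D -> is_tight_limit c ->
    is_tight_limit (map_cone (tight_functor F) c).

(** * The simplicial category of isofibrations *)

Record isof_obj (K : cosmos) := IsofObj {
  tot : K;
  base : K;
  isof_arr : arr tot base;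
  isof_arrP : isofib isof_arr }.
Arguments tot {K} _.
Arguments base {K} _.
Arguments isof_arr {K} _.

Definition isof_hom_sset (K : cosmos) (p q : isof_obj K) : sset.
Proof.
refine (@SSet
  (fun n => {x : hom (tot p) (tot q) n * hom (base p) (base q) n |
     comp (cst n (isof_arr q)) x.1 = comp x.2 (cst n (isof_arr p))})
  (fun m n t x =>
     exist _ (act t (proj1_sig x).1, act t (proj1_sig x).2) _) _ _).
- by move=> n [[x y] h]; apply: sig_eq => /=; rewrite !act_id.
- by move=> l m n g f [[x y] h]; apply: sig_eq => /=; rewrite !act_comp.
Unshelve.
case: x => -[x y] /= h.
by rewrite -(act_cst t (isof_arr q)) -(act_cst t (isof_arr p)) -!comp_nat h.
Defined.

Definition isof_scat (K : cosmos) : scat.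
Proof.
refine (@SCat (isof_obj K) (@isof_hom_sset K)
  (fun p q r n g f => exist _
     (comp (proj1_sig g).1 (proj1_sig f).1,
      comp (proj1_sig g).2 (proj1_sig f).2) _)
  (fun p => exist _ (idv (tot p), idv (base p)) _) _ _ _ _).
- by move=> p q r m n t [[g1 g2] hg] [[f1 f2] hf]; apply: sig_eq;
    rewrite /= !comp_nat.
- by move=> p q r s n [[h1 h2] hh] [[g1 g2] hg] [[f1 f2] hf]; apply: sig_eq;
    rewrite /= !comp_assoc.
- by move=> p q n [[f1 f2] hf]; apply: sig_eq; rewrite /= !comp_idl.
- by move=> p q n [[f1 f2] hf]; apply: sig_eq; rewrite /= !comp_idr.
Unshelve.
- case: g f => [[g1 g2] /= hg] [[f1 f2] /= hf].
  by rewrite comp_assoc hg -comp_assoc hf comp_assoc.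
- by rewrite /= !cst0 -[idv (tot p)]cst0 comp_idr -[idv (base p)]cst0 comp_idl.
Defined.

Definition mor_tot (K : cosmos) (p q : isof_scat K) (f : arr p q) :
  arr (tot p) (tot q) := (proj1_sig f).1.
Definition mor_base (K : cosmos) (p q : isof_scat K) (f : arr p q) :
  arr (base p) (base q) := (proj1_sig f).2.

Lemma mor_sq (K : cosmos) (p q : isof_scat K) (f : arr p q) :
  comp (isof_arr q) (mor_tot f) = comp (mor_base f) (isof_arr p).
Proof.
case: f => -[x y] h; rewrite /mor_tot /mor_base /=.
by move: (h); rewrite /= !cst0.
Qed.

Definition isof_isofib (K : cosmos) : arrow_class (isof_scat K) :=
  fun p q f =>
    [/\ isofib (mor_tot f), isofib (mor_base f) &
        forall (P : cone spoint (cospan_diagram (isof_arr q) (mor_base f)))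
               (g : arr (tot p) (apex P)),
          is_limit P ->
          comp (proj P (Some true) tt) g = mor_tot f ->
          comp (proj P (Some false) tt) g = isof_arr p ->
          isofib g].

(** * Ralis *)

(* An adjunction l -| p in the homotopy 2-category, with unit
   eta : id_B => p l and counit eps : l p => id_E. *)
Record hadjunction (K : scat) (E B : K) (p : arr E B) (l : arr B E)
    (eta : seq (hom B B 1)) (eps : seq (hom E E 1)) : Prop := HAdjunction {
  unit_chain : chain (idv B) eta (comp p l);
  counit_chain : chain (comp l p) eps (idv E);
  triangle_l : heq l l (hmap (post B l) eta ++ hmap (pre E l) eps) [::];
  triangle_r : heq p p (hmap (pre B p) eta ++ hmap (post E p) eps) [::] }.

Definition is_rali (K : scat) (E B : K) (p : arr E B) : Prop :=
  exists l eta eps,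
    hadjunction p l eta eps /\ hiso (idv B) (comp p l) eta.

(* The mate of a commutative square p2 e = b p1, as a 2-cell
   l2 b => l2 b p1 l1 = l2 p2 e l1 => e l1. *)
Definition mate (K : scat) (E1 B1 E2 B2 : K) (p2 : arr E2 B2)
    (e : arr E1 E2) (b : arr B1 B2) (l1 : arr B1 E1) (l2 : arr B2 E2)
    (eta1 : seq (hom B1 B1 1)) (eps2 : seq (hom E2 E2 1)) :
    seq (hom B1 E2 1) :=
  hmap (post B1 (comp l2 b)) eta1 ++ hmap (pre E2 (comp e l1)) eps2.

Section HomotopyTheory.
Variable X : sset.
Implicit Types (x y z : X 0) (w v : seq (X 1)).

Lemma chain_cat x y w v :
  chain x (w ++ v) y <-> exists z, chain x w z /\ chain z v y.
Proof.
elim: w x => [|e w IH] x /=.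
  by split=> [h|[z [<- h]]] //; exists x.
split=> [[ex /IH [z [h1 h2]]]|[z [[ex h1] h2]]].
  by exists z.
by split=> //; apply/IH; exists z.
Qed.

Lemma esrc_cst x : esrc (cst 1 x) = x.
Proof. exact: vtx_cst. Qed.

Lemma etgt_cst x : etgt (cst 1 x) = x.
Proof. exact: vtx_cst. Qed.

Lemma vtx_face n (k : 'I_n.+2) (i : 'I_n.+1) (s : X n.+1) :
  vtx i (act (face k) s) = vtx (lift k i) s.
Proof. exact: vtx_act. Qed.

Lemma tri_vertices (s : X 2) :
  [/\ esrc (act (face (inord 2)) s) = esrc (act (face (inord 1)) s),
      etgt (act (face (inord 2)) s) = esrc (act (face (inord 0)) s) &
      etgt (act (face (inord 0)) s) = etgt (act (face (inord 1)) s)].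
Proof.
by rewrite /esrc /etgt !vtx_face; split; congr (vtx _ s); apply: val_inj;
  rewrite /= !inordK.
Qed.

Lemma heq_chain x y w v : heq x y w v -> chain x w y /\ chain x v y.
Proof.
elim=> {w v} [w h|w v _ [h1 h2]|w v u _ [h1 _] _ [_ h2]|w z v h|w s v h] //.
- split=> //; move/chain_cat: h => [t [h1 /= []]].
  rewrite esrc_cst etgt_cst => ezt h2.
  by apply/chain_cat; exists t; rewrite -{2}ezt.
- split=> //; move/chain_cat: h => [t [h1 /= [et h2]]].
  apply/chain_cat; exists t; split=> //=.
  by have [-> -> ->] := tri_vertices s.
Qed.

Lemma heq_cat x y z w w' v v' :
  heq x y w w' -> heq y z v v' -> heq x z (w ++ v) (w' ++ v').
Proof.
move=> hw hv; apply: (@heq_trans _ _ _ _ (w ++ v')).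
  have [hwc _] := heq_chain hw.
  elim: hv {hw} => {v v'} [v h|v v' _ h|v u t _ h1 _ h2|v1 t v2 h|v1 s v2 h].
  - by apply: heq_refl; apply/chain_cat; exists y.
  - exact: heq_sym.
  - exact: heq_trans h1 h2.
  - by rewrite !catA; apply: heq_unit; rewrite -catA; apply/chain_cat; exists y.
  - by rewrite !catA; apply: heq_tri; rewrite -catA; apply/chain_cat; exists y.
have [_ hvc] := heq_chain hv.
elim: hw {hv} => {w w'} [w h|w w' _ h|w u t _ h1 _ h2|w1 t w2 h|w1 s w2 h].
- by apply: heq_refl; apply/chain_cat; exists y.
- exact: heq_sym.
- exact: heq_trans h1 h2.
- rewrite -!catA; apply: heq_unit.
  by rewrite -cat_cons catA; apply/chain_cat; exists y.
- rewrite -!catA !cat_cons; apply: heq_tri.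
  by rewrite -cat_cons catA; apply/chain_cat; exists y.
Qed.

Lemma heq_mid w1 w2 x y z t v v' : chain x w1 y -> chain z w2 t ->
  heq y z v v' -> heq x t (w1 ++ v ++ w2) (w1 ++ v' ++ w2).
Proof.
move=> h1 h2 h; apply: (heq_cat (heq_refl h1)).
exact: heq_cat h (heq_refl h2).
Qed.

Lemma hiso_cat x y z w v : hiso x y w -> hiso y z v -> hiso x z (w ++ v).
Proof.
move=> [cw [w' [cw' h1 h2]]] [cv [v' [cv' h3 h4]]].
split; first by apply/chain_cat; exists y.
exists (v' ++ w'); split; first by apply/chain_cat; exists y.
  apply: heq_trans h1; rewrite -catA.
  by have := heq_mid cw cw' h3; rewrite /= -!catA.
apply: heq_trans h4; rewrite -catA.
by have := heq_mid cv' cv h2; rewrite /= -!catA.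
Qed.

Lemma hiso_heq x y w v : heq x y w v -> hiso x y w -> hiso x y v.
Proof.
move=> h [cw [w' [cw' h1 h2]]]; have [_ cv] := heq_chain h.
split=> //; exists w'; split=> //.
  exact: heq_trans (heq_cat (heq_sym h) (heq_refl cw')) h1.
exact: heq_trans (heq_cat (heq_refl cw') (heq_sym h)) h2.
Qed.

End HomotopyTheory.

Section HomotopyMap.
Variables (X Y : sset) (F : smap X Y).

Lemma hmap_cat w v : hmap F (w ++ v) = hmap F w ++ hmap F v.
Proof. exact: map_cat. Qed.

Lemma chain_map x y w : chain x w y -> chain (F 0 x) (hmap F w) (F 0 y).
Proof.
elim: w x => [|e w IH] x /=; first by move->.
move=> [<- /IH h]; split; first by rewrite /esrc /vtx smap_nat.
by move: h; rewrite /etgt /vtx smap_nat.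
Qed.

Lemma heq_map x y w v :
  heq x y w v -> heq (F 0 x) (F 0 y) (hmap F w) (hmap F v).
Proof.
elim=> {w v} [w h|w v _ h|w u t _ h1 _ h2|w1 t w2 h|w1 s w2 h].
- by apply: heq_refl; apply: chain_map.
- exact: heq_sym.
- exact: heq_trans h1 h2.
- have := chain_map h; rewrite !hmap_cat /= smap_cst; exact: heq_unit.
- have := chain_map h; rewrite !hmap_cat /= !smap_nat; exact: heq_tri.
Qed.

End HomotopyMap.

Section Whiskering.
Variable C : scat.

Lemma comp_id0l (A B : C) (f : arr A B) : comp (idv B) f = f.
Proof. by rewrite -[idv B]cst0 comp_idl. Qed.

Lemma comp_id0r (A B : C) (f : arr A B) : comp f (idv A) = f.
Proof. by rewrite -[idv A]cst0 comp_idr. Qed.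

Lemma hmap_post_comp (A B D E : C) (g : arr D E) (f : arr B D)
    (w : seq (hom A B 1)) :
  hmap (post A g) (hmap (post A f) w) = hmap (post A (comp g f)) w.
Proof.
by rewrite /hmap -map_comp; apply: eq_map => e /=; rewrite cst_comp comp_assoc.
Qed.

Lemma hmap_pre_comp (A B D E : C) (g : arr B D) (f : arr A B)
    (w : seq (hom D E 1)) :
  hmap (pre E f) (hmap (pre E g) w) = hmap (pre E (comp g f)) w.
Proof.
by rewrite /hmap -map_comp; apply: eq_map => e /=; rewrite cst_comp comp_assoc.
Qed.

Lemma hmap_pre_post (A B D E : C) (g : arr D E) (f : arr A B)
    (w : seq (hom B D 1)) :
  hmap (pre E f) (hmap (post B g) w) = hmap (post A g) (hmap (pre D f) w).
Proof.
by rewrite /hmap -!map_comp; apply: eq_map => e /=; rewrite comp_assoc.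
Qed.

Lemma hmap_post_id (A B : C) (w : seq (hom A B 1)) :
  hmap (post A (idv B)) w = w.
Proof.
rewrite /hmap -[RHS]map_id; apply: eq_map => e /=; exact: comp_idl.
Qed.

Lemma hmap_pre_id (A B : C) (w : seq (hom A B 1)) :
  hmap (pre B (idv A)) w = w.
Proof.
rewrite /hmap -[RHS]map_id; apply: eq_map => e /=; exact: comp_idr.
Qed.

Lemma post0 (A B D : C) (g : arr B D) (f : arr A B) :
  post A g 0 f = comp g f.
Proof. by rewrite /= cst0. Qed.

Lemma pre0 (A B D : C) (g : arr B D) (f : arr A B) :
  pre D f 0 g = comp g f.
Proof. by rewrite /= cst0. Qed.

Lemma degen2_subproof (k i j : 'I_3) :
  i <= j -> (inord (k <= i) : 'I_2) <= (inord (k <= j) : 'I_2).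
Proof.
move=> h; rewrite !inordK ?ltnS ?leq_b1 //.
by case: (leqP k i) => // hk; rewrite (leq_trans hk h).
Qed.

(* The degeneracy Delta 2 -> Delta 1 sending i to 1 exactly when k <= i. *)
Definition degen2 (k : 'I_3) : mono 2 1 := Mono (@degen2_subproof k).

Lemma act_degen2_face (X : sset) (k j : 'I_3) (x : X 1) :
  act (face j) (act (degen2 k) x) =
  if (k <= lift j ord_max) then
    if (k <= lift j ord0) then cst 1 (etgt x) else x
  else cst 1 (esrc x).
Proof.
rewrite -act_comp; case: leqP => h1; first case: leqP => h0.
- rewrite /cst /etgt /vtx -act_comp; congr (act _ _); apply: mono_eq => i /=.
  apply: val_inj; rewrite /= inordK ?ltnS ?leq_b1 //.
  have -> // : k <= bump j i by apply: leq_trans h0 _; rewrite leq_bump2.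
- rewrite -[RHS]act_id; congr (act _ _); apply: mono_eq => i /=.
  apply: val_inj; rewrite /= inordK ?ltnS ?leq_b1 //.
  case: i => -[|[|i]] //= hi; last by rewrite /= in h1; rewrite h1.
  by rewrite /= in h0; rewrite leqNgt h0.
- rewrite /cst /esrc /vtx -act_comp; congr (act _ _); apply: mono_eq => i /=.
  apply: val_inj; rewrite /= inordK ?ltnS ?leq_b1 //.
  rewrite leqNgt (leq_ltn_trans _ h1) //= leq_bump2.
  by rewrite -ltnS.
Qed.

Lemma interchange_edge (A B D : C) (e : hom A B 1) (d : hom B D 1) :
  heq (comp (esrc d) (esrc e)) (comp (etgt d) (etgt e))
    [:: post A (esrc d) 1 e; pre D (etgt e) 1 d]
    [:: pre D (esrc e) 1 d; post A (etgt d) 1 e].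
Proof.
have cde : chain (comp (esrc d) (esrc e)) [:: comp d e]
    (comp (etgt d) (etgt e)).
  by split; rewrite /esrc /etgt /vtx comp_nat.
have h1 := @heq_tri _ (comp (esrc d) (esrc e)) (comp (etgt d) (etgt e)) [::]
  (comp (act (degen2 (inord 2)) d) (act (degen2 (inord 1)) e)) [::].
have h2 := @heq_tri _ (comp (esrc d) (esrc e)) (comp (etgt d) (etgt e)) [::]
  (comp (act (degen2 (inord 1)) d) (act (degen2 (inord 2)) e)) [::].
move: h1 h2; rewrite /= !comp_nat !act_degen2_face /= !inordK //=.
move=> h1 h2.
by apply: heq_trans (heq_sym _); [apply: h1 | apply: h2].
Qed.

Lemma interchange (A B D : C) (f f' : arr A B) (g g' : arr B D)
    (w : seq (hom A B 1)) (v : seq (hom B D 1)) :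
  chain f w f' -> chain g v g' ->
  heq (comp g f) (comp g' f')
    (hmap (post A g) w ++ hmap (pre D f') v)
    (hmap (pre D f) v ++ hmap (post A g') w).
Proof.
move=> cw cv; elim: w f cw => [|e w IHw] f /=.
  move=> <-; rewrite cats0; apply: heq_refl.
  by have := chain_map (pre D f) cv; rewrite !pre0.
move=> [<- cw].
have h1 : heq (comp g (esrc e)) (comp g' (etgt e))
    (post A g 1 e :: hmap (pre D (etgt e)) v)
    (hmap (pre D (esrc e)) v ++ [:: post A g' 1 e]).
  elim: v g cv {IHw} => [|d v IHv] g /=.
    move=> <-; apply: heq_refl => /=.
    by rewrite /esrc /etgt /vtx !comp_nat !act_cst !cst0.
  move=> [<- cv].
  have h := interchange_edge e d.
  have hv := IHv _ cv.
  have cv1 : chain (comp (etgt d) (etgt e)) (hmap (pre D (etgt e)) v)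
     (comp g' (etgt e)).
    by have := chain_map (pre D (etgt e)) cv; rewrite !pre0.
  have /= k1 := heq_cat h (heq_refl cv1).
  apply: (heq_trans k1).
  have cd : chain (comp (esrc d) (esrc e)) [:: pre D (esrc e) 1 d]
     (comp (etgt d) (esrc e)).
    by rewrite /= /esrc /etgt /vtx !comp_nat !act_cst !cst0.
  by have /= := heq_cat (heq_refl cd) hv.
have cw' : chain (comp g' (etgt e)) (hmap (post A g') w) (comp g' f').
  by have := chain_map (post A g') cw; rewrite !post0.
have ce : chain (comp g (esrc e)) [:: post A g 1 e] (comp g (etgt e)).
  by rewrite /= /esrc /etgt /vtx !comp_nat !act_cst !cst0.
have /= k1 := heq_cat (heq_refl ce) (IHw _ cw).
apply: (heq_trans k1).
have /= k2 := heq_cat h1 (heq_refl cw').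
by apply: (heq_trans k2); rewrite -catA; apply: heq_refl;
  have [] := heq_chain k2; rewrite -catA.
Qed.

End Whiskering.

Section Mates.
Variable C : scat.

Lemma mate_chain (E1 B1 E2 B2 : C) (p1 : arr E1 B1) (p2 : arr E2 B2)
    (e : arr E1 E2) (b : arr B1 B2) l1 l2 eta1 eps1 eta2 eps2 :
  comp p2 e = comp b p1 ->
  hadjunction p1 l1 eta1 eps1 -> hadjunction p2 l2 eta2 eps2 ->
  chain (comp l2 b) (mate p2 e b l1 l2 eta1 eps2) (comp e l1).
Proof.
move=> sq [u1 _ _ _] [_ c2 _ _]; apply/chain_cat.
exists (comp (comp l2 p2) (comp e l1)); split.
  have := chain_map (post B1 (comp l2 b)) u1; rewrite !post0 comp_id0r.
  by rewrite !comp_assoc -(comp_assoc l2 b p1) -sq !comp_assoc.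
by have := chain_map (pre E2 (comp e l1)) c2; rewrite !pre0 comp_id0l.
Qed.

Lemma mate_unit (E1 B1 E2 B2 : C) (p1 : arr E1 B1) (p2 : arr E2 B2)
    (e : arr E1 E2) (b : arr B1 B2) l1 l2 eta1 eps1 eta2 eps2 :
  comp p2 e = comp b p1 ->
  hadjunction p1 l1 eta1 eps1 -> hadjunction p2 l2 eta2 eps2 ->
  heq b (comp p2 (comp e l1))
    (hmap (pre B2 b) eta2 ++ hmap (post B1 p2) (mate p2 e b l1 l2 eta1 eps2))
    (hmap (post B1 b) eta1).
Proof.
move=> sq [u1 _ _ _] [u2 c2 _ t2].
have el : comp b (comp p1 l1) = comp p2 (comp e l1) by rewrite !comp_assoc sq.
have cb : chain b (hmap (post B1 b) eta1) (comp p2 (comp e l1)).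
  by have := chain_map (post B1 b) u1; rewrite !post0 comp_id0r el.
have em : hmap (post B1 p2) (hmap (post B1 (comp l2 b)) eta1) =
    hmap (post B1 (comp p2 l2)) (hmap (post B1 b) eta1).
  by rewrite !hmap_post_comp comp_assoc.
rewrite /mate hmap_cat em.
have i1 := interchange cb u2; rewrite comp_id0l hmap_post_id in i1.
have t := heq_map (pre B2 (comp e l1)) t2; rewrite pre0 in t.
rewrite hmap_cat hmap_pre_comp hmap_pre_post in t.
have c3 : chain (comp (comp p2 l2) (comp p2 (comp e l1)))
    (hmap (post B1 p2) (hmap (pre E2 (comp e l1)) eps2))
    (comp p2 (comp e l1)).
  have := chain_map (post B1 p2) (chain_map (pre E2 (comp e l1)) c2).
  by rewrite !post0 !pre0 comp_id0l -!comp_assoc.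
have k1 := heq_cat (heq_sym i1) (heq_refl c3).
have k2 := heq_cat (heq_refl cb) t.
rewrite catA; apply: (heq_trans k1); rewrite -catA.
by apply: (heq_trans k2); rewrite cats0; apply: heq_refl.
Qed.

(* Mates paste. *)
Lemma mate_comp (E1 B1 E2 B2 E3 B3 : C)
    (p1 : arr E1 B1) (p2 : arr E2 B2) (p3 : arr E3 B3)
    (e : arr E1 E2) (b : arr B1 B2) (e' : arr E2 E3) (b' : arr B2 B3)
    l1 l2 l3 eta1 eps1 eta2 eps2 eta3 eps3 :
  comp p2 e = comp b p1 -> comp p3 e' = comp b' p2 ->
  hadjunction p1 l1 eta1 eps1 -> hadjunction p2 l2 eta2 eps2 ->
  hadjunction p3 l3 eta3 eps3 ->
  heq (comp l3 (comp b' b)) (comp (comp e' e) l1)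
    (hmap (pre E3 b) (mate p3 e' b' l2 l3 eta2 eps3) ++
     hmap (post B1 e') (mate p2 e b l1 l2 eta1 eps2))
    (mate p3 (comp e' e) (comp b' b) l1 l3 eta1 eps3).
Proof.
move=> sq sq' a1 a2 a3.
have cm := mate_chain sq a1 a2.
have mu := mate_unit sq a1 a2.
have [_ c3 _ _] := a3.
set M := mate p2 _ _ _ _ _ _ in cm mu *.
have i1 := interchange (chain_map (post B1 e') cm) c3.
rewrite !post0 hmap_post_id comp_id0l hmap_post_comp in i1.
have cP := chain_map (post B1 (comp l3 b'))
  (chain_map (pre B2 b) (unit_chain a2)).
rewrite !post0 !pre0 comp_id0l in cP.
have cT := chain_map (pre E3 (comp e' (comp e l1))) c3.
rewrite !pre0 comp_id0l in cT.
have k1 := heq_map (post B1 (comp l3 b')) mu.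
rewrite hmap_cat !post0 !hmap_post_comp in k1.
have ew : comp (comp l3 p3) e' = comp (comp l3 b') p2.
  by rewrite -!comp_assoc sq'.
have ee : comp (comp l3 p3) (comp e' (comp l2 b)) =
    comp (comp l3 b') (comp (comp p2 l2) b).
  by rewrite comp_assoc ew !comp_assoc.
have ee2 : comp (comp l3 p3) (comp e' (comp e l1)) =
    comp (comp l3 b') (comp p2 (comp e l1)).
  by rewrite comp_assoc ew !comp_assoc.
rewrite ew ee in i1; rewrite ee2 in cT.
have k2 := heq_cat (heq_refl cP) (heq_sym i1).
have k3 := heq_cat k1 (heq_refl cT).
rewrite -catA in k3.
have h := heq_trans k2 k3; rewrite -/M in h.
rewrite {1}/mate hmap_cat hmap_pre_post hmap_pre_comp -catA.
rewrite [mate p3 _ _ _ _ _ _]/mate.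
move: h; rewrite -!comp_assoc; exact.
Qed.

Lemma mate_id (E B : C) (p : arr E B) l eta eps :
  hadjunction p l eta eps ->
  heq l l (mate p (idv E) (idv B) l l eta eps) [::].
Proof. by case=> _ _ t _; rewrite /mate comp_id0l comp_id0r. Qed.

Lemma mate_id_iso (E B : C) (p : arr E B) l l' eta eta' eps eps' :
  hadjunction p l eta eps -> hadjunction p l' eta' eps' ->
  hiso (comp l' (idv B)) (comp (idv E) l)
    (mate p (idv E) (idv B) l l' eta eps').
Proof.
move=> a a'.
have sq : comp p (idv E) = comp (idv B) p by rewrite comp_id0l comp_id0r.
split; first exact: mate_chain sq a a'.
exists (mate p (idv E) (idv B) l' l eta' eps).
have k1 := mate_comp sq sq a a' a.
have k2 := mate_comp sq sq a' a a'.
have c1 := mate_chain sq a' a.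
rewrite !comp_id0l !comp_id0r in c1 k1 k2 *.
rewrite !hmap_post_id !hmap_pre_id in k1 k2.
split=> //.
  exact: heq_trans k2 (mate_id a').
exact: heq_trans k1 (mate_id a).
Qed.

Lemma hiso_map (X Y : sset) (F : smap X Y) x y w :
  hiso x y w -> hiso (F 0 x) (F 0 y) (hmap F w).
Proof.
move=> [cw [w' [cw' h1 h2]]]; split; first exact: chain_map.
exists (hmap F w'); split; first exact: chain_map.
  by rewrite -hmap_cat; apply: heq_map h1.
by rewrite -hmap_cat; apply: heq_map h2.
Qed.

Lemma mate_comp_iso (E1 B1 E2 B2 E3 B3 : C)
    (p1 : arr E1 B1) (p2 : arr E2 B2) (p3 : arr E3 B3)
    (e : arr E1 E2) (b : arr B1 B2) (e' : arr E2 E3) (b' : arr B2 B3)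
    l1 l2 l3 eta1 eps1 eta2 eps2 eta3 eps3 :
  comp p2 e = comp b p1 -> comp p3 e' = comp b' p2 ->
  hadjunction p1 l1 eta1 eps1 -> hadjunction p2 l2 eta2 eps2 ->
  hadjunction p3 l3 eta3 eps3 ->
  hiso (comp l2 b) (comp e l1) (mate p2 e b l1 l2 eta1 eps2) ->
  hiso (comp l3 b') (comp e' l2) (mate p3 e' b' l2 l3 eta2 eps3) ->
  hiso (comp l3 (comp b' b)) (comp (comp e' e) l1)
    (mate p3 (comp e' e) (comp b' b) l1 l3 eta1 eps3).
Proof.
move=> sq sq' a1 a2 a3 h h'; apply: hiso_heq (mate_comp sq sq' a1 a2 a3) _.
have := hiso_map (post B1 e') h; have := hiso_map (pre E3 b) h'.
rewrite !post0 !pre0 -!comp_assoc => k' k.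
exact: hiso_cat k' k.
Qed.

End Mates.

Section Rali.
Variable K : cosmos.

Definition is_rali_mor (p q : isof_scat K) (f : arr p q) : Prop :=
  forall l1 eta1 eps1 l2 eta2 eps2,
    hadjunction (isof_arr p) l1 eta1 eps1 ->
    hadjunction (isof_arr q) l2 eta2 eps2 ->
    hiso (comp l2 (mor_base f)) (comp (mor_tot f) l1)
      (mate (isof_arr q) (mor_tot f) (mor_base f) l1 l2 eta1 eps2).

Record rali_obj := RaliObj {
  rali_isof :> isof_obj K;
  rali_isofP : is_rali (isof_arr rali_isof) }.

Definition rali_scat : scat :=
  @SCat rali_obj (fun p q => @hom (isof_scat K) p q)
    (fun p q r n g f => @comp (isof_scat K) p q r n g f)
    (fun p => @idv (isof_scat K) p)
    (fun p q r => @comp_nat (isof_scat K) p q r)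
    (fun p q r s => @comp_assoc (isof_scat K) p q r s)
    (fun p q => @comp_idl (isof_scat K) p q)
    (fun p q => @comp_idr (isof_scat K) p q).

Lemma is_rali_mor_id (p : isof_scat K) : is_rali_mor (idv p).
Proof. by move=> l1 eta1 eps1 l2 eta2 eps2 a1 a2; apply: mate_id_iso a1 a2. Qed.

Lemma is_rali_mor_comp (p q r : rali_obj)
    (g : @hom (isof_scat K) q r 0) (f : @hom (isof_scat K) p q 0) :
  is_rali_mor g -> is_rali_mor f -> is_rali_mor (comp g f).
Proof.
move=> hg hf l1 eta1 eps1 l3 eta3 eps3 a1 a3.
have [l2 [eta2 [eps2 [a2 _]]]] := rali_isofP q.
exact: mate_comp_iso (mor_sq f) (mor_sq g) a1 a2 a3
  (hf _ _ _ _ _ _ a1 a2) (hg _ _ _ _ _ _ a2 a3).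
Qed.

Definition Rali : escat :=
  @ESCat rali_scat (fun p q f => @is_rali_mor p q f)
    (fun p => @is_rali_mor_id (rali_isof p)) is_rali_mor_comp.

Definition Rali_isofib : arrow_class (tight_part Rali) :=
  fun p q f => @isof_isofib K (rali_isof p) (rali_isof q) (proj1_sig f).

Definition Rali_incl : efunctor Rali (chordate (isof_scat K)) :=
  @EFunctor Rali (chordate (isof_scat K))
    (@SFunctor rali_scat (isof_scat K) rali_isof
       (fun p q => @SMap (@hom (isof_scat K) p q) (@hom (isof_scat K) p q)
          (fun n f => f) (fun _ _ _ _ => erefl))
       (fun _ => erefl) (fun _ _ _ _ _ _ => erefl))
    (fun _ _ _ _ => I).

End Rali.

(* Main.v *)
(* A rali-isofibration p can be strictified: p l = id, with a counit eps lying
   over the identity on the nose.  A 0-arrow x with eps x invertible is then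
   initial in its fibre, and a square (e, b) is a morphism of ralis exactly when
   e l is initial in this sense.  Initial 0-arrows, and edges out of them, lift
   along the isofibrations of K^isof which are morphisms of ralis; this
   constructs l and eps on a pointwise limit of strict ralis.  That eps l is
   invertible there, and that tightness is reflected by the projections, both
   follow from one fact: an edge of hom X L, for a cosmological limit L, is
   invertible as soon as its components are.  For pullbacks and towers this is
   special outer horn filling along isofibrations.  For powers it is the
   pointwise detection of invertible natural transformations, proved cell by
   cell, where closure under Leibniz exponentials takes the place of Joyal's
   pushout-product theorem. *)

(* The obstacle is that homotopy categories do not commute with limits: 2-cells, equations between
   them and inverses, given on each object of a diagram, are compatible only up to homotopy and need
   not glue. Hence whatever is to be glued is expressed by simplices. A right inverse of an edge is
   a 2-simplex with two prescribed faces, so it can be lifted along isofibrations and assembled in a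
   limit; two-sided inverses are recovered by taking a right inverse of a right inverse. For the
   same reason the sections chosen on the objects of a pullback or tower diagram cannot simply be
   combined: morphisms of ralis preserve them only up to isomorphism. They are replaced by other
   initial 0-arrows that match strictly. Here the third clause of [isof_isofib] enters, as it allows
   lifting over the total object and over the base at the same time. Initiality makes the
   replacement harmless: an edge between two initial 0-arrows of a fibre is invertible, whichever
   ones were chosen. *)
From mathcomp Require Import all_boot boolp classical_sets zify.
Require Import Defs.

Set Implicit Arguments.
Unset Strict Implicit.
Unset Printing Implicit Defensive.

(** * Faces, degeneracies and horns *)

(* The indices of faces and degeneracies are natural numbers; out of range
   ([n.+1 < i] for [df i], [n < i] for [sg i]) the values are junk. *)
Definition df (X : sset) n (i : nat) (x : X n.+1) : X n :=
  act (face (inord i)) x.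

Lemma collapse_subproof n (i : nat) (j k : 'I_n.+2) : j <= k ->
  (inord (minn n (unbump i j)) : 'I_n.+1) <= (inord (minn n (unbump i k)) : 'I_n.+1).
Proof. by move=> h; rewrite !inordK /unbump; lia. Qed.

Definition collapse n (i : nat) : mono n.+1 n := Mono (@collapse_subproof n i).

Definition sg (X : sset) n (i : nat) (x : X n) : X n.+1 := act (collapse n i) x.

Lemma faceE n i j : i <= n.+1 -> @face n (inord i) j = bump i j :> nat.
Proof. by move=> h /=; rewrite inordK. Qed.

Lemma collapseE n i j : collapse n i j = minn n (unbump i j) :> nat.
Proof. by rewrite /= inordK //; lia. Qed.

Lemma mono_eqn m n (f g : mono m n) : (forall i, f i = g i :> nat) -> f = g.
Proof. by move=> h; apply: mono_eq => i; apply: val_inj; apply: h. Qed.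

Section Identities.
Variable X : sset.

Lemma df_df n i j (x : X n.+2) : i <= j <= n.+1 ->
  df i (df j.+1 x) = df j (df i x).
Proof.
move=> h; rewrite /df -!act_comp; congr (act _ _); apply: mono_eqn => k.
have := ltn_ord k; by rewrite /= !inordK /bump; lia.
Qed.

Lemma df_sg n i (x : X n) : i <= n -> df i (sg i x) = x.
Proof.
move=> h; rewrite /df /sg -!act_comp -[RHS]act_id; congr (act _ _).
apply: mono_eqn => k; rewrite collapseE faceE /bump /unbump /=; last lia.
by have := ltn_ord k; lia.
Qed.

Lemma df_sgS n i (x : X n) : i <= n -> df i.+1 (sg i x) = x.
Proof.
move=> h; rewrite /df /sg -!act_comp -[RHS]act_id; congr (act _ _).
apply: mono_eqn => k; rewrite collapseE faceE /bump /unbump /=; last lia.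
by have := ltn_ord k; lia.
Qed.

Lemma df_sg_lt n i j (x : X n.+1) : i <= j <= n ->
  df i (sg j.+1 x) = sg j (df i x).
Proof.
move=> h; rewrite /df /sg -!act_comp; congr (act _ _).
apply: mono_eqn => k; have := ltn_ord k.
by rewrite [mono_comp]lock -lock /= ?inordK /bump /unbump; lia.
Qed.

Lemma df_sg_gt n i j (x : X n.+1) : j < i <= n.+1 ->
  df i.+1 (sg j x) = sg j (df i x).
Proof.
move=> h; rewrite /df /sg -!act_comp; congr (act _ _).
apply: mono_eqn => k; have := ltn_ord k.
by rewrite /= ?inordK /bump /unbump; lia.
Qed.

Lemma cst1E (x : X 0) : cst 1 x = sg 0 x.
Proof. by congr (act _ _); apply: mono_eq => k; rewrite !ord1. Qed.

Lemma sg_cst n i (x : X 0) : sg i (cst n x) = cst n.+1 x.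
Proof. exact: act_cst. Qed.

Lemma df_cst n i (x : X 0) : df i (cst n.+1 x) = cst n x.
Proof. exact: act_cst. Qed.

Lemma esrcE (e : X 1) : esrc e = df 1 e.
Proof.
by congr (act _ _); apply: mono_eqn => k; rewrite /= inordK // ord1.
Qed.

Lemma etgtE (e : X 1) : etgt e = df 0 e.
Proof.
by congr (act _ _); apply: mono_eqn => k; rewrite /= inordK // ord1.
Qed.

End Identities.

Lemma smap_df (X Y : sset) (F : smap X Y) n i (x : X n.+1) :
  F n (df i x) = df i (F n.+1 x).
Proof. exact: smap_nat. Qed.

Lemma smap_sg (X Y : sset) (F : smap X Y) n i (x : X n) :
  F n.+1 (sg i x) = sg i (F n x).
Proof. exact: smap_nat. Qed.

Section Horns.
Variables (X : sset) (n : nat) (k : 'I_n.+3) (x : nat -> X n.+1).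
Hypothesis compat : forall i j, i < j <= n.+2 -> i != k -> j != k ->
  df i (x j) = df j.-1 (x i).

(** [act s (sg i (x i))] evaluates the face [x i] at the factorization of [s] through it. If [s]
    misses both [i] and [j], it factors through their common codimension-two face in two ways, and
    [compat] equates the two readings. *)
Lemma horn_face_indep m (s : mono m n.+2) (i j : 'I_n.+3) :
  i <> k -> j <> k -> (forall a, s a <> i) -> (forall a, s a <> j) ->
  act s (sg i (x i)) = act s (sg j (x j)).
Proof.
wlog: i j / i < j.
  move=> H ik jk hi hj; case: (ltngtP i j) => ij.
  - exact: H.
  - by rewrite (H j i).
  - by move/val_inj: ij => ->.
move=> ij ik jk hi hj.
pose c := mono_comp (collapse n j.-1) (mono_comp (collapse n.+1 i) s).
have e1 : s = mono_comp (face (inord i)) (mono_comp (face (inord j.-1)) c).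
  apply: mono_eqn => a; have := hi a; have := hj a.
  move/eqP; rewrite -val_eqE /= => h1 /eqP; rewrite -val_eqE /= => h2.
  have h3 := ltn_ord (s a); have h4 := ltn_ord j.
  by rewrite /= !inordK /bump /unbump; lia.
have e2 : s = mono_comp (face (inord j)) (mono_comp (face (inord i)) c).
  apply: mono_eqn => a; have := hi a; have := hj a.
  move/eqP; rewrite -val_eqE /= => h1 /eqP; rewrite -val_eqE /= => h2.
  have h3 := ltn_ord (s a); have h4 := ltn_ord j.
  by rewrite /= !inordK /bump /unbump; lia.
have h4 := ltn_ord j.
rewrite {1}e1 e2 !act_comp.
congr (act _ _); rewrite -!/(df _ _).
rewrite [df i (sg i _)]df_sg; last by lia.
have -> : df j (sg j (x j)) = x j.
  (* For [j = n.+2] the truncation in [collapse] turns [sg j] into the last degeneracy, so the last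
     face still undoes it. *)
  case: (leqP j n.+1) => hj'; first by rewrite df_sg.
  have -> : j = n.+2 :> nat by lia.
  rewrite /df /sg -act_comp -[RHS]act_id; congr (act _ _).
  by apply: mono_eqn => a; have := ltn_ord a;
    rewrite /= !inordK /bump /unbump; lia.
rewrite (compat (i := i) (j := j)) //; first by apply/andP; split=> //; exact: leq_ord j.
  exact/eqP/(contra_not _ ik)/val_inj.
exact/eqP/(contra_not _ jk)/val_inj.
Qed.

Lemma horn_of_faces : exists h : smap (horn k) X,
  forall m (t : horn k m) i, i <> k -> (forall a, proj1_sig t a <> i) ->
  h m t = act (proj1_sig t) (sg i (x i)).
Proof.
pose miss m (t : horn k m) := cid2 (proj2_sig t).
have hP m (t : horn k m) : let: exist2 i _ _ := miss m t in
    forall i', i' <> k -> (forall a, proj1_sig t a <> i') ->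
    act (proj1_sig t) (sg i (x i)) = act (proj1_sig t) (sg i' (x i')).
  by case: (miss m t) => i ik hi i' ik' hi'; apply: horn_face_indep.
pose h m (t : horn k m) := act (proj1_sig t) (sg (s2val (miss m t)) (x (s2val (miss m t)))).
have hE m (t : horn k m) i : i <> k -> (forall a, proj1_sig t a <> i) ->
    h m t = act (proj1_sig t) (sg i (x i)).
  by move=> ik hi; have := hP m t; rewrite /h; case: (miss m t) => j ? ? /=; apply.
suff hnat m l (t : mono m l) (u : horn k l) : h m (act t u) = act t (h l u).
  by exists (SMap hnat).
have [i ik hi] := proj2_sig u.
rewrite (hE l u i ik hi) (hE m (act t u) i ik) /= ?act_comp //.
Qed.

End Horns.

(** * Inner horn fillers with prescribed faces *)

Section Fillers.
Variables (X Y : sset) (F : smap X Y).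
Hypothesis hF : inner_fibration F.

(** [x k] stands for the missing face and may be any simplex, so that families of faces can be
    written by cases with a default branch. *)
Lemma fill_horn n (k : nat) (x : nat -> X n.+1) (y : Y n.+2) :
  0 < k < n.+2 ->
  (forall i j, i < j <= n.+2 -> i != k -> j != k ->
     df i (x j) = df j.-1 (x i)) ->
  (forall i, i <= n.+2 -> i != k -> F _ (x i) = df i y) ->
  exists z : X n.+2, F _ z = y /\
    forall i, i <= n.+2 -> i != k -> df i z = x i.
Proof.
move=> hk hx hy.
have kE : (inord k : 'I_n.+3) = k :> nat by rewrite inordK; lia.
have [|h hh] := @horn_of_faces X n (inord k) x.
  by rewrite kE.
have [||z [Fz hz]] := hF (k := inord k) _ (h := h) (y := y); first by rewrite kE.
- move=> m t; have [i ik hi] := proj2_sig t.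
  rewrite (hh _ _ _ ik hi) smap_nat smap_sg hy; last first.
  + by move/eqP: ik; rewrite -val_eqE /= kE.
  + by have := ltn_ord i; lia.
  rewrite /df /sg -!act_comp; congr (act _ _).
  apply: mono_eqn => a; have := hi a; move/eqP; rewrite -val_eqE /= => h1.
  have h2 := ltn_ord (proj1_sig t a); have h3 := ltn_ord i.
  by rewrite /= !inordK /bump /unbump; lia.
exists z; split=> // i hi ik.
have ik' : (inord i : 'I_n.+3) <> inord k.
  by move/(congr1 val); rewrite /= !inordK //; move: hk ik; lia.
have mi a : @face n.+1 (inord i) a <> inord i.
  by move/eqP; rewrite /= eq_sym (negbTE (neq_lift _ _)).
pose t : horn (inord k) n.+1 :=
  exist (fun s : mono n.+1 n.+2 => exists2 i : 'I_n.+3, i <> inord k & forall j, s j <> i)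
  (face (inord i)) (ex_intro2 _ _ (inord i) ik' mi).
have := hz _ t; rewrite (hh _ t _ ik' mi) /= /df => <-.
rewrite /sg -act_comp -[RHS]act_id inordK //.
congr (act _ _); apply: mono_eqn => a; have := ltn_ord a.
by rewrite /= !inordK /bump /unbump; lia.
Qed.

Lemma fill21 (a b : X 1) (y : Y 2) :
  df 0 a = df 1 b -> F _ a = df 2 y -> F _ b = df 0 y ->
  exists z : X 2, [/\ F _ z = y, df 2 z = a & df 0 z = b].
Proof.
move=> h ha hb.
have [|||z [Fz hz]] := @fill_horn 0 1 (fun i => if i is 0 then b else a) y _ => //.
- by move=> [|[|[|i]]] [|[|[|j]]] /andP[].
- by move=> [|[|[|i]]].
by exists z; split=> //; [rewrite (hz 2) | rewrite (hz 0)].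
Qed.

Lemma fill31 (x0 x2 x3 : X 2) (y : Y 3) :
  df 0 x2 = df 1 x0 -> df 0 x3 = df 2 x0 -> df 2 x3 = df 2 x2 ->
  F _ x0 = df 0 y -> F _ x2 = df 2 y -> F _ x3 = df 3 y ->
  exists z : X 3, [/\ F _ z = y, df 0 z = x0, df 2 z = x2 & df 3 z = x3].
Proof.
move=> h1 h2 h3 y0 y2 y3.
have [|||z [Fz hz]] := @fill_horn 1 1
   (fun i => match i with 0 => x0 | 2 => x2 | _ => x3 end) y _ => //.
- by move=> [|[|[|[|i]]]] [|[|[|[|j]]]] /andP[].
- by move=> [|[|[|[|i]]]].
by exists z; split=> //; [rewrite (hz 0) | rewrite (hz 2) | rewrite (hz 3)].
Qed.

Lemma fill32 (x0 x1 x3 : X 2) (y : Y 3) :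
  df 0 x1 = df 0 x0 -> df 0 x3 = df 2 x0 -> df 1 x3 = df 2 x1 ->
  F _ x0 = df 0 y -> F _ x1 = df 1 y -> F _ x3 = df 3 y ->
  exists z : X 3, [/\ F _ z = y, df 0 z = x0, df 1 z = x1 & df 3 z = x3].
Proof.
move=> h1 h2 h3 y0 y2 y3.
have [|||z [Fz hz]] := @fill_horn 1 2
   (fun i => match i with 0 => x0 | 1 => x1 | _ => x3 end) y _ => //.
- by move=> [|[|[|[|i]]]] [|[|[|[|j]]]] /andP[].
- by move=> [|[|[|[|i]]]].
by exists z; split=> //; [rewrite (hz 0) | rewrite (hz 1) | rewrite (hz 3)].
Qed.

Lemma fill42 (x0 x1 x3 x4 : X 3) (y : Y 4) :
  df 0 x1 = df 0 x0 -> df 0 x3 = df 2 x0 -> df 0 x4 = df 3 x0 ->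
  df 1 x3 = df 2 x1 -> df 1 x4 = df 3 x1 -> df 3 x4 = df 3 x3 ->
  F _ x0 = df 0 y -> F _ x1 = df 1 y -> F _ x3 = df 3 y -> F _ x4 = df 4 y ->
  exists z : X 4, [/\ F _ z = y, df 0 z = x0, df 1 z = x1, df 3 z = x3 & df 4 z = x4].
Proof.
move=> h1 h2 h3 h4 h5 h6 y0 y1 y3 y4.
have [|||z [Fz hz]] := @fill_horn 2 2
   (fun i => match i with 0 => x0 | 1 => x1 | 3 => x3 | _ => x4 end) y _ => //.
- by move=> [|[|[|[|[|i]]]]] [|[|[|[|[|j]]]]] /andP[].
- by move=> [|[|[|[|[|i]]]]].
by exists z; split=> //; [rewrite (hz 0) | rewrite (hz 1) | rewrite (hz 3) | rewrite (hz 4)].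
Qed.

End Fillers.

Definition sbang (X : sset) : smap X spoint :=
  @SMap X spoint (fun _ _ => tt) (fun _ _ _ _ => erefl).

Lemma quasicat_bang (X : sset) : quasicat X <-> inner_fibration (sbang X).
Proof.
split=> hX n k hk h; last first.
  by have [|x [_ hx]] := hX n k hk h tt => //; exists x.
by move=> y _; have [x hx] := hX n k hk h; exists x; split=> //; case: y.
Qed.

Lemma quasicat_total (X Y : sset) (F : smap X Y) :
  inner_fibration F -> quasicat Y -> quasicat X.
Proof.
move=> hF hY n k hk h.
have hFh m l (t : mono m l) (u : horn k l) :
    F m (h m (act t u)) = act t (F l (h l u)) by rewrite !smap_nat.
have [y hy] := hY n k hk (SMap hFh).
by have [x [_ hx]] := hF n k hk h y hy; exists x.
Qed.

Section QuasiFillers.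
Variable X : sset.
Hypothesis hX : quasicat X.
Let hX' := proj1 (quasicat_bang X) hX.

Lemma qfill21 (a b : X 1) : df 0 a = df 1 b ->
  exists z : X 2, df 2 z = a /\ df 0 z = b.
Proof.
by move=> h; have [||z [_ ? ?]] := fill21 hX' (y := tt) h => //; exists z.
Qed.

Lemma qfill31 (x0 x2 x3 : X 2) :
  df 0 x2 = df 1 x0 -> df 0 x3 = df 2 x0 -> df 2 x3 = df 2 x2 ->
  exists z : X 3, [/\ df 0 z = x0, df 2 z = x2 & df 3 z = x3].
Proof.
move=> h1 h2 h3.
by have [|||z [_ ? ? ?]] := fill31 hX' (y := tt) h1 h2 h3 => //; exists z.
Qed.

Lemma qfill32 (x0 x1 x3 : X 2) :
  df 0 x1 = df 0 x0 -> df 0 x3 = df 2 x0 -> df 1 x3 = df 2 x1 ->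
  exists z : X 3, [/\ df 0 z = x0, df 1 z = x1 & df 3 z = x3].
Proof.
move=> h1 h2 h3.
by have [|||z [_ ? ? ?]] := fill32 hX' (y := tt) h1 h2 h3 => //; exists z.
Qed.

Lemma qfill42 (x0 x1 x3 x4 : X 3) :
  df 0 x1 = df 0 x0 -> df 0 x3 = df 2 x0 -> df 0 x4 = df 3 x0 ->
  df 1 x3 = df 2 x1 -> df 1 x4 = df 3 x1 -> df 3 x4 = df 3 x3 ->
  exists z : X 4, [/\ df 0 z = x0, df 1 z = x1, df 3 z = x3 & df 4 z = x4].
Proof.
move=> h1 h2 h3 h4 h5 h6.
by have [||||z [_ ? ? ? ?]] := fill42 hX' (y := tt) h1 h2 h3 h4 h5 h6 => //; exists z.
Qed.

End QuasiFillers.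

(** * The homotopy category of a quasi-category *)

Definition tri (X : sset) (a b c : X 1) : Prop :=
  exists s : X 2, [/\ df 2 s = a, df 0 s = b & df 1 s = c].

Definition inverse_edge (X : sset) (e g : X 1) : Prop :=
  tri e g (cst 1 (esrc e)) /\ tri g e (cst 1 (esrc g)).

(** Phrased by 2-simplices rather than by strings modulo [heq], so that inverses can be lifted and
    glued; [iso_edgeP] identifies it with [hiso] in a quasi-category. *)
Definition iso_edge (X : sset) (e : X 1) : Prop := exists g, inverse_edge e g.

Lemma tri_ends (X : sset) (a b c : X 1) : tri a b c ->
  [/\ etgt a = esrc b, esrc c = esrc a & etgt c = etgt b].
Proof.
case=> s [<- <- <-]; rewrite !esrcE !etgtE.
by split; rewrite -?(@df_df _ 0 0 1) ?(@df_df _ 0 1 1) ?(@df_df _ 0 0 0).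
Qed.

Lemma tri_map (X Y : sset) (F : smap X Y) a b c :
  tri a b c -> tri (F 1 a) (F 1 b) (F 1 c).
Proof. by case=> s [<- <- <-]; exists (F 2 s); rewrite !smap_df. Qed.

Lemma smap_esrc (X Y : sset) (F : smap X Y) e : esrc (F 1 e) = F 0 (esrc e).
Proof. by rewrite /esrc /vtx smap_nat. Qed.

Lemma smap_etgt (X Y : sset) (F : smap X Y) e : etgt (F 1 e) = F 0 (etgt e).
Proof. by rewrite /etgt /vtx smap_nat. Qed.

Lemma inverse_edge_map (X Y : sset) (F : smap X Y) e g :
  inverse_edge e g -> inverse_edge (F 1 e) (F 1 g).
Proof.
by case=> h h'; split; rewrite smap_esrc -smap_cst; apply: tri_map.
Qed.

Lemma iso_edge_map (X Y : sset) (F : smap X Y) e :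
  iso_edge e -> iso_edge (F 1 e).
Proof. by case=> g h; exists (F 1 g); apply: inverse_edge_map. Qed.

Lemma tri_cstl (X : sset) (a : X 1) : tri (cst 1 (esrc a)) a a.
Proof.
exists (sg 0 a); rewrite df_sg // df_sgS // (@df_sg_gt _ 0 1 0) //.
by rewrite esrcE cst1E.
Qed.

Lemma tri_cstr (X : sset) (a : X 1) : tri a (cst 1 (etgt a)) a.
Proof.
exists (sg 1 a); rewrite df_sg // df_sgS // (@df_sg_lt _ 0 0 0) //.
by rewrite etgtE cst1E.
Qed.

Lemma inverse_edge_sym (X : sset) (e g : X 1) :
  inverse_edge e g -> inverse_edge g e.
Proof. by case. Qed.

Lemma iso_edge_cst (X : sset) (x : X 0) : iso_edge (cst 1 x).
Proof.
exists (cst 1 x); have := tri_cstl (cst 1 x).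
by rewrite /inverse_edge !esrc_cst.
Qed.

Section Quasi.
Variable X : sset.
Hypothesis hX : quasicat X.
Implicit Types a b c u v : X 1.

Lemma tri_ex a b : etgt a = esrc b -> exists c, tri a b c.
Proof.
rewrite etgtE esrcE => /(qfill21 hX) [s [h2 h0]].
by exists (df 1 s), s.
Qed.

Lemma tri_assocl a b c u v (w : X 1) : tri a b u -> tri b c v -> tri a v w -> tri u c w.
Proof.
case=> s3 [h1 h2 h3] [s0 [h4 h5 h6]] [s2 [h7 h8 h9]].
have [|||z [z0 z2 z3]] := @qfill31 _ hX s0 s2 s3; rewrite ?h8 ?h6 ?h2 ?h4 ?h1 //.
exists (df 1 z); split.
- by rewrite -(@df_df _ 1 1 2) // z3.
- by rewrite (@df_df _ 1 0 0) // z0.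
- by rewrite -(@df_df _ 1 1 1) // z2.
Qed.

Lemma tri_assocr a b c u v (w : X 1) : tri a b u -> tri b c v -> tri u c w -> tri a v w.
Proof.
case=> s3 [h1 h2 h3] [s0 [h4 h5 h6]] [s1 [h7 h8 h9]].
have [|||z [z0 z1 z3]] := @qfill32 _ hX s0 s1 s3; rewrite ?h8 ?h5 ?h2 ?h4 ?h3 //.
exists (df 2 z); split.
- by rewrite -(@df_df _ 1 2 2) // z3.
- by rewrite (@df_df _ 1 0 1) // z0.
- by rewrite (@df_df _ 1 1 1) // z1.
Qed.

Definition sim a b := tri a (cst 1 (etgt a)) b.

Lemma sim_ends a b : sim a b -> esrc a = esrc b /\ etgt a = etgt b.
Proof. by case/tri_ends=> _ -> ->; rewrite etgt_cst. Qed.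

Lemma sim_refl a : sim a a.
Proof. exact: tri_cstr. Qed.

Lemma tri_cst x : tri (cst 1 x) (cst 1 x) (cst 1 x : X 1).
Proof. by have := tri_cstl (cst 1 x : X 1); rewrite esrc_cst. Qed.

Lemma sim_sym a b : sim a b -> sim b a.
Proof.
move=> h; have [_ e] := sim_ends h; rewrite /sim -e.
exact: tri_assocl h (tri_cst _) (tri_cstr a).
Qed.

Lemma sim_trans b a c : sim a b -> sim b c -> sim a c.
Proof.
move=> h; have [_ e] := sim_ends h; rewrite /sim -e => h'.
exact: tri_assocr h (tri_cst _) h'.
Qed.

Lemma sim_left a b : sim a b <-> tri (cst 1 (esrc a)) a b.
Proof.
split=> h; last exact: tri_assocl (tri_cstl a) (tri_cstr a) h.
exact: tri_assocr (tri_cstl a) (tri_cstr a) h.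
Qed.

Lemma tri_sim a a' b b' c c' :
  sim a a' -> sim b b' -> sim c c' -> tri a b c -> tri a' b' c'.
Proof.
move=> ha hb hc h; have [e1 e2 e3] := tri_ends h.
have h1 : tri a b c'.
  apply: tri_assocr h _ hc; rewrite e3; exact: tri_cstr.
have h2 : tri a b' c'.
  apply: tri_assocr (tri_cstr a) _ h1; rewrite e1; exact/sim_left.
apply: tri_assocl ha _ h2; rewrite e1; have [-> _] := sim_ends hb.
exact: tri_cstl.
Qed.

(* The composite of a string from x, as a class of edges up to [sim].  It is
   invariant under [heq], so that [heq] between edges yields a 2-simplex. *)
Fixpoint ev (x : X 0) (w : seq (X 1)) (c : X 1) : Prop :=
  if w is e :: w' then exists2 c', ev (etgt e) w' c' & tri e c' c
  else sim (cst 1 x) c.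

Lemma ev_ends x w y c : chain x w y -> ev x w c -> esrc c = x /\ etgt c = y.
Proof.
elim: w x c => [|e w IH] x c /=.
  by move=> <- /sim_ends [<- <-]; rewrite esrc_cst etgt_cst.
move=> [<- h] [c' /(IH _ _ h) [_ <-] /tri_ends [_ -> ->]]; by [].
Qed.

Lemma ev_ex x w y : chain x w y -> exists c, ev x w c.
Proof.
elim: w x => [|e w IH] x /=; first by move=> _; exists (cst 1 x); apply: sim_refl.
move=> [_ h]; have [c hc] := IH _ h; have [h1 _] := ev_ends h hc.
by have [|c' hc'] := @tri_ex e c; [rewrite h1 | exists c', c].
Qed.

Lemma ev_sim x w c c' : sim c c' -> ev x w c -> ev x w c'.
Proof.
case: w => [|e w] /= h; first by move=> h'; apply: sim_trans h' h.
case=> u hu ht; exists u => //.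
exact: tri_sim (sim_refl _) (sim_refl _) h ht.
Qed.

Lemma ev_cat x w1 z w2 y c : chain x w1 z -> chain z w2 y ->
  ev x (w1 ++ w2) c <->
  exists c1 c2, [/\ ev x w1 c1, ev z w2 c2 & tri c1 c2 c].
Proof.
move=> h1 h2; elim: w1 x c h1 => [|e w IH] x c /=.
  move=> ->; split=> [h|[c1 [c2 [k1 k2 k3]]]].
    exists (cst 1 z), c; split=> //; first exact: sim_refl.
    by have [<- _] := ev_ends h2 h; apply: tri_cstl.
  have [e2 _] := ev_ends h2 k2.
  apply: ev_sim k2; apply/sim_left; rewrite e2.
  exact: tri_sim (sim_sym k1) (sim_refl _) (sim_refl _) k3.
move=> [ex h1]; split.
  case=> u /(IH _ _ h1) [c1 [c2 [k1 k2 k3]]] k4.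
  have [e1 _] := ev_ends h1 k1.
  have [|d hd] := @tri_ex e c1; first by rewrite e1.
  exists d, c2; split=> //; first by exists c1.
  exact: tri_assocl hd k3 k4.
case=> d [c2 [[c1 k1 hd] k2 k3]].
have [_ e1] := ev_ends h1 k1; have [e2 _] := ev_ends h2 k2.
have [|u hu] := @tri_ex c1 c2; first by rewrite e1.
exists u; first by apply/(IH _ _ h1); exists c1, c2.
exact: tri_assocr hd hu k3.
Qed.

Lemma ev_edge x e c : esrc e = x -> ev x [:: e] c <-> sim e c.
Proof.
move=> _ /=; split=> [[u hu ht]|h].
  exact: tri_sim (sim_refl _) (sim_sym hu) (sim_refl _) ht.
by exists (cst 1 (etgt e)); first exact: sim_refl.
Qed.

Lemma ev_heq x y w w' c : heq x y w w' -> ev x w c -> ev x w' c.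
Proof.
move=> h; suff H : forall c, ev x w c <-> ev x w' c by move/H.
elim: h => {w w' c} [w _|w w' _ h|w v w' _ h _ h'|w1 z w2 h|w1 s w2 h] c //.
- by rewrite h.
- by rewrite h h'.
- have [t [h1 [h2 h3]]] := (chain_cat x y w1 (cst 1 z :: w2)).1 h.
  move: h2 h3; rewrite esrc_cst etgt_cst => ezt h3; subst t.
  have h4 : chain z (cst 1 z :: w2) y by rewrite /= esrc_cst etgt_cst.
  rewrite (ev_cat c h1 h3) (ev_cat c h1 h4).
  split=> -[c1 [c2 [k1 k2 k3]]]; exists c1, c2; split=> //.
    case: k2 => u; rewrite etgt_cst => hu ht.
    have [e1 _] := ev_ends h3 hu.
    by apply: ev_sim hu; apply/sim_left; rewrite e1.
  exists c2; rewrite ?etgt_cst //.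
  by have [<- _] := ev_ends h3 k2; apply: tri_cstl.
- have [t [h1 [h2 h3]]] := (chain_cat x y w1 (act (face (inord 1)) s :: w2)).1 h.
  have [t1 t2 t3] := tri_vertices s.
  have h4 : chain t (act (face (inord 2)) s :: act (face (inord 0)) s :: w2) y.
    by rewrite /= t1 t3.
  have h5 : chain t (act (face (inord 1)) s :: w2) y by [].
  rewrite (ev_cat c h1 h4) (ev_cat c h1 h5).
  have ht : tri (act (face (inord 2)) s) (act (face (inord 0)) s)
    (act (face (inord 1)) s) by exists s.
  split=> -[c1 [c2 [k1 k2 k3]]]; exists c1, c2; split=> //.
    case: k2 => u [v hv ht1] ht2.
    exists v; first by rewrite -t3.
    exact: tri_assocl ht ht1 ht2.
  case: k2 => u hu ht1.
  have [e1 _] := ev_ends h3 hu.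
  have [|v hv] := @tri_ex (act (face (inord 0)) s) u; first by rewrite e1.
  exists v; first by exists u => //; rewrite t3.
  exact: tri_assocr ht hv ht1.
Qed.

Lemma heq_sim x y a b : heq x y [:: a] [:: b] <-> [/\ esrc a = x, etgt a = y & sim a b].
Proof.
split.
  move=> h; have [[ea ta] [eb tb]] := heq_chain h; split=> //.
  have /(ev_heq h) := (ev_edge a ea).2 (sim_refl a).
  by move/(ev_edge _ eb)/sim_sym.
case=> ea ta [s [h2 h0 h1]].
apply: (heq_trans (w' := [:: a; cst 1 y])).
  apply: heq_sym; apply: (@heq_unit _ x y [:: a] y [::]) => /=.
  by rewrite ea ta esrc_cst etgt_cst.
have := @heq_tri _ x y [::] s [::]; rewrite /= -!/(df _ s) h2 h0 h1 ta.
apply; have [_ e1 e2] := tri_ends (ex_intro _ s (And3 h2 h0 h1)).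
by rewrite e1 e2 etgt_cst.
Qed.

Lemma heq_tri_edge a b c : tri a b c -> heq (esrc a) (etgt b) [:: a; b] [:: c].
Proof.
move=> h; have [_ e1 e2] := tri_ends h; case: h => s [h2 h0 h1].
have := @heq_tri _ (esrc a) (etgt b) [::] s [::].
by rewrite /= -!/(df _ s) h2 h0 h1 e1 e2; apply.
Qed.

Lemma ev_sound x w y c : chain x w y -> ev x w c -> heq x y w [:: c].
Proof.
elim: w x c => [|e w IH] x c /=.
  move=> <- h; apply: heq_trans (_ : heq x x _ [:: cst 1 x]) _.
    apply: heq_sym; apply: (@heq_unit _ x x [::] x [::]).
    by rewrite /= esrc_cst etgt_cst.
  by apply/heq_sim; rewrite esrc_cst etgt_cst.
move=> [ex h] [u hu ht].
have [e1 e2] := ev_ends h hu.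
have ce : chain x [:: e] (etgt e) by [].
apply: (heq_trans (w' := [:: e; u])).
  exact: (heq_cat (heq_refl ce) (IH _ _ h hu)).
by have := heq_tri_edge ht; rewrite ex e2.
Qed.

Lemma heq_edge x w y : chain x w y ->
  exists c, [/\ esrc c = x, etgt c = y & heq x y w [:: c]].
Proof.
move=> h; have [c hc] := ev_ex h; have [e1 e2] := ev_ends h hc.
by exists c; split=> //; apply: ev_sound.
Qed.

Lemma heq_nil_edge x a : heq x x [:: a] [::] -> sim a (cst 1 x).
Proof.
move=> h; apply: sim_sym; have [[ea _] _] := heq_chain h.
exact: (ev_heq h ((ev_edge a ea).2 (sim_refl a))).
Qed.

Lemma heq_cst (x : X 0) : heq x x [:: cst 1 x] [::].
Proof.
apply: (@heq_unit _ x x [::] x [::]).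
by rewrite /= esrc_cst etgt_cst.
Qed.

Lemma iso_edgeP (e : X 1) : iso_edge e <-> hiso (esrc e) (etgt e) [:: e].
Proof.
split.
  case=> g [h h']; have [e1 e2 e3] := tri_ends h; have [e4 _ _] := tri_ends h'.
  rewrite etgt_cst in e3.
  split; first by [].
  exists [:: g]; split; first by rewrite /= -e1 e3.
    have := heq_tri_edge h; rewrite -e3 => k.
    exact: heq_trans k (heq_cst _).
  have := heq_tri_edge h'; rewrite -e1 => k.
  exact: heq_trans k (heq_cst _).
case=> ce [w' [cw h h']].
have [g [e1 e2 hg]] := heq_edge cw.
have k1 := heq_trans (heq_sym (heq_cat (heq_refl ce) hg)) h.
have k2 := heq_trans (heq_sym (heq_cat hg (heq_refl ce))) h'.
have [|u hu] := @tri_ex e g; first by rewrite e1.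
have [|v hv] := @tri_ex g e; first by rewrite e2.
have := heq_tri_edge hu; have := heq_tri_edge hv; rewrite e1 e2 => l2 l1.
have m1 := heq_nil_edge (heq_trans (heq_sym l1) k1).
have m2 := heq_nil_edge (heq_trans (heq_sym l2) k2).
exists g; split; first exact: tri_sim (sim_refl _) (sim_refl _) m1 hu.
rewrite e1; exact: tri_sim (sim_refl _) (sim_refl _) m2 hv.
Qed.

Lemma iso_tri a b c : tri a b c -> iso_edge a -> iso_edge b -> iso_edge c.
Proof.
move=> h /iso_edgeP ha /iso_edgeP hb; have [e1 e2 e3] := tri_ends h.
apply/iso_edgeP; rewrite e2 e3.
apply: hiso_heq (heq_tri_edge h) _.
by apply: (hiso_cat (w := [:: a]) (v := [:: b]) ha); rewrite e1.
Qed.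

Lemma iso_tril a b c : tri a b c -> iso_edge a -> iso_edge c -> iso_edge b.
Proof.
move=> h [g [h1 h2]] hc.
have [e1 e2 e3] := tri_ends h; have [e4 _ e5] := tri_ends h1.
have [f4 f5 f6] := tri_ends h2; rewrite etgt_cst in e5; rewrite etgt_cst in f6.
have k : tri g c b.
  by apply: tri_assocr h2 h _; rewrite -e4 e1; apply: tri_cstl.
apply: iso_tri k _ hc; by exists a.
Qed.

(** Bracketing the composite of [e], [g], [g'] in two ways shows that [e] and [g'] are homotopic, so
    [g] is inverse to [e] on both sides. *)
Lemma iso_edge_right (e g g' : X 1) :
  tri e g (cst 1 (esrc e)) -> tri g g' (cst 1 (esrc g)) -> iso_edge e.
Proof.
move=> h h'; have [e1 _ e3] := tri_ends h; have [e4 _ e6] := tri_ends h'.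
rewrite etgt_cst in e3; rewrite etgt_cst in e6.
have k : sim e g'.
  have k1 : tri (cst 1 (esrc e)) g' e.
    by apply: tri_assocl h h' _; rewrite -e1; apply: tri_cstr.
  apply: sim_sym; apply/sim_left; rewrite -e4 -e3; exact: k1.
exists g; split=> //.
exact: tri_sim (sim_refl _) (sim_sym k) (sim_refl _) h'.
Qed.

Lemma tri_cancel (a b b' c : X 1) :
  iso_edge a -> tri a b c -> tri a b' c -> sim b b'.
Proof.
case=> g [_ hg] h h'; have [e1 _ e3] := tri_ends hg.
rewrite etgt_cst in e3.
have [_ ec _] := tri_ends h.
have [|w hw] := @tri_ex g c; first by rewrite e1.
have ends v : tri a v c -> esrc v = esrc g by case/tri_ends=> <-.
apply: (sim_trans (b := w)).
  by apply/sim_left; rewrite (ends b h); apply: tri_assocl hg h hw.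
apply: sim_sym; apply/sim_left; rewrite (ends b' h'); exact: tri_assocl hg h' hw.
Qed.

Lemma hiso_iso_edge x y (e : X 1) :
  hiso x y [:: e] <-> [/\ esrc e = x, etgt e = y & iso_edge e].
Proof.
split=> [h|[<- <- /iso_edgeP]] //.
have [[ex ey] _] := h; split=> //.
by apply/iso_edgeP; rewrite ex ey.
Qed.

Lemma iso_sim (a b : X 1) : sim a b -> iso_edge a -> iso_edge b.
Proof. by move=> h ha; apply: iso_tri h ha (iso_edge_cst _). Qed.

End Quasi.

(** Lifting arguments yield right inverses only. By cancellation the right inverse [g] of [x] is
    again sent to invertible edges, so [H] applies to it a second time. *)
Lemma jointly_iso_edge (I : Type) (Z : sset) (W : I -> sset)
    (F : forall i, smap Z (W i)) :
  quasicat Z -> (forall i, quasicat (W i)) ->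
  (forall x : Z 1, (forall i, iso_edge (F i 1 x)) ->
     exists g, tri x g (cst 1 (esrc x))) ->
  forall x : Z 1, (forall i, iso_edge (F i 1 x)) -> iso_edge x.
Proof.
move=> qZ qW H x hx; have [g hg] := H x hx.
have [|g' hg'] := H g; last exact: (iso_edge_right qZ hg hg').
move=> i; apply: (iso_tril (qW i) (tri_map (F i) hg) (hx i)).
exact: iso_edge_map (iso_edge_cst _).
Qed.

(** * Special outer horns *)

(* With e : x -> y, the simplices Om, Th, Ps and Big below have the vertices
   xyxy, yxyx, xyxx and xyxyx.  The witnesses k1 and k2 of invertibility need
   not be coherent; Om measures the defect delta, and Big compares s' with the
   2-simplex sA for which the lifting problem can be solved. *)
Section OuterHorn.
Variables (A C : sset) (F : smap A C).
Hypotheses (hF : inner_fibration F) (hC : quasicat C).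
Let hA := quasicat_total hF hC.

Lemma outer_horn (e : A 1) (s' : C 2) :
  iso_edge e -> df 2 s' = F 1 e -> df 1 s' = cst 1 (F 0 (esrc e)) ->
  exists s : A 2, [/\ F 2 s = s', df 2 s = e & df 1 s = cst 1 (esrc e)].
Proof.
case=> h [t1 t2] s2 s1.
have [hs _ ht] := tri_ends t1; rewrite etgt_cst in ht.
have [es _ et] := tri_ends t2; rewrite etgt_cst in et.
move: t1 t2 => [k1 [a2 a0 a1]] [k2 [b2 b0 b1]].
set x := esrc e in a1 s1 ht es *; set y := esrc h in b1 hs et *.
have exE : df 1 e = x by rewrite -esrcE.
have eyE : df 0 e = y by rewrite -etgtE.
have hyE : df 1 h = y by rewrite -esrcE.
have hxE : df 0 h = x by rewrite -etgtE.
pose g' := df 0 s'.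
have gyE : df 1 g' = F 0 y by rewrite -(@df_df _ 0 0 1) // s2 -smap_df eyE.
have gxE : df 0 g' = F 0 x by rewrite -(@df_df _ 0 0 0) // s1 df_cst cst0.
have [|||Om [Om0 Om1 Om3]] := @qfill32 _ hA k2 (sg 0 e) k1.
- by rewrite df_sg // b0.
- by rewrite a0 b2.
- by rewrite a1 (@df_sg_gt _ 0 1 0) // exE cst1E.
pose delta := df 2 Om.
have de2 : df 2 delta = e by rewrite -(@df_df _ 1 2 2) // Om3.
have de0 : df 0 delta = cst 1 y by rewrite (@df_df _ 1 0 1) // Om0.
have de1 : df 1 delta = e by rewrite (@df_df _ 1 1 1) // Om1 df_sgS.
have [|||Th [Th0 Th1 Th3]] := @qfill32 _ hC s' (sg 0 g') (F 2 k2).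
- by rewrite df_sg.
- by rewrite -smap_df b0 s2.
- by rewrite -smap_df b1 (@df_sg_gt _ 0 1 0) // gyE smap_cst cst1E.
pose r' := df 2 Th.
have r2 : df 2 r' = F 1 h by rewrite -(@df_df _ 1 2 2) // Th3 -smap_df b2.
have r0 : df 0 r' = cst 1 (F 0 x) by rewrite (@df_df _ 1 0 1) // Th0.
have r1 : df 1 r' = g' by rewrite (@df_df _ 1 1 1) // Th1 df_sgS.
(* Being right inverse to [F 1 e], [g'] is homotopic to [F 1 h] by [r']; lifting this homotopy from
   [h] yields an edge [g] over [g']. *)
have [|||r [Fr q2 q0]] := @fill21 _ _ _ hF h (cst 1 x) r'.
- by rewrite hxE df_cst cst0.
- by rewrite r2.
- by rewrite r0 smap_cst.
pose g := df 1 r.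
have Fg : F 1 g = g' by rewrite smap_df Fr.
have gy : df 1 g = y by rewrite -(@df_df _ 0 1 1) // q2.
have gx : df 0 g = x by rewrite (@df_df _ 0 0 0) // q0 df_cst cst0.
have [|||Ps [Ps0 Ps1 Ps3]] := @qfill32 _ hA r (cst 2 x) k1.
- by rewrite q0 df_cst.
- by rewrite a0 q2.
- by rewrite a1 df_cst.
(* This exhibits [g] as right inverse to [e], but [F 2 sA] is only known to have the boundary of
   [s']. *)
pose sA := df 2 Ps.
have sA2 : df 2 sA = e by rewrite -(@df_df _ 1 2 2) // Ps3.
have sA0 : df 0 sA = g by rewrite (@df_df _ 1 0 1) // Ps0.
have sA1 : df 1 sA = cst 1 x by rewrite (@df_df _ 1 1 1) // Ps1 df_cst.
have [||||||Big [B0 B1 B3 B4]] := @qfill42 _ hC Th (sg 0 s') (F 3 Ps) (F 3 Om).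
- by rewrite Th0 df_sg.
- by rewrite -smap_df Ps0 Fr.
- by rewrite -smap_df Om0 Th3.
- by rewrite -smap_df Ps1 (@df_sg_gt _ 1 1 0) // s1 smap_cst sg_cst.
- by rewrite -smap_df Om1 (@df_sg_gt _ 1 2 0) // s2 smap_sg.
- by rewrite -!smap_df Om3 Ps3.
pose nu := df 2 Big.
have nu3 : df 3 nu = F 2 delta by rewrite -(@df_df _ 2 2 3) // B4 -smap_df.
have nu0 : df 0 nu = sg 0 g' by rewrite (@df_df _ 2 0 1) // B0.
have nu2 : df 2 nu = F 2 sA by rewrite -(@df_df _ 2 2 2) // B3 -smap_df.
have nu1 : df 1 nu = s' by rewrite (@df_df _ 2 1 1) // B1 df_sgS.
(* [s'] is the face of [nu] opposite to 1 and the other three faces lift, so an inner filler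
   contains a lift of [s']. *)
have [||||||z [Fz z0 z2 z3]] := @fill31 _ _ _ hF (sg 0 g) sA delta nu.
- by rewrite sA0 df_sgS.
- by rewrite de0 (@df_sg_gt _ 0 1 0) // gy cst1E.
- by rewrite de2 sA2.
- by rewrite nu0 smap_sg Fg.
- by rewrite nu2.
- by rewrite nu3.
exists (df 1 z); split.
- by rewrite smap_df Fz nu1.
- by rewrite -(@df_df _ 1 1 2) // z3.
- by rewrite -(@df_df _ 1 1 1) // z2 sA1.
Qed.

End OuterHorn.

(** * Fibres *)

Definition fib (X Y : sset) (F : smap X Y) (y : Y 0) : sset.
Proof.
refine (@SSet (fun n => {x : X n | F n x = cst n y})
  (fun m n t x => exist _ (act t (proj1_sig x)) _) _ _).
- by move=> n x; apply: sig_eq; apply: act_id.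
- by move=> l m n g f x; apply: sig_eq; apply: act_comp.
Unshelve.
by case: x => x /= hx; rewrite smap_nat hx act_cst.
Defined.

Definition fib_incl (X Y : sset) (F : smap X Y) (y : Y 0) : smap (fib F y) X :=
  @SMap (fib F y) X (fun n x => proj1_sig x) (fun _ _ _ _ => erefl).

Section Fibres.
Variables (X Y : sset) (F : smap X Y) (y : Y 0).
Hypotheses (hF : inner_fibration F) (hY : quasicat Y).
Notation Z := (fib F y).

Lemma fib_eq n (u v : Z n) : fib_incl F y n u = fib_incl F y n v -> u = v.
Proof. exact: sig_eq. Qed.

Lemma fib_lift n (x : X n) : F n x = cst n y ->
  exists u : Z n, fib_incl F y n u = x.
Proof. by move=> h; exists (exist _ x h). Qed.

Lemma fib_quasicat : quasicat Z.
Proof.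
move=> n k hk h.
have hnat m l (t : mono m l) (u : horn k l) :
    fib_incl F y m (h m (act t u)) = act t (fib_incl F y l (h l u)).
  by rewrite smap_nat.
have [|x [Fx hx]] := hF hk (h := SMap hnat) (y := cst n y).
  by move=> m t /=; rewrite act_cst; apply: (proj2_sig (h m t)).
exists (exist _ x Fx) => m t; apply: sig_eq; exact: hx.
Qed.

Lemma fib_tri (a b c : Z 1) (s : X 2) : F 2 s = cst 2 y ->
  df 2 s = fib_incl F y 1 a -> df 0 s = fib_incl F y 1 b ->
  df 1 s = fib_incl F y 1 c -> tri a b c.
Proof.
move=> /fib_lift [u <-] h2 h0 h1.
by exists u; split; apply: fib_eq; rewrite smap_df.
Qed.

(** The special outer horn is filled over the degenerate simplex on [y], so the witness stays in the
    fibre. *)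
Lemma fib_right_inverse (e : Z 1) : iso_edge (fib_incl F y 1 e) ->
  exists g : Z 1, tri e g (cst 1 (esrc e)).
Proof.
move=> he.
have Fe : F 1 (fib_incl F y 1 e) = cst 1 y := proj2_sig e.
have Fx : F 0 (esrc (fib_incl F y 1 e)) = y.
  by rewrite -smap_esrc Fe esrc_cst.
have [||s [Fs s2 s1]] := outer_horn hF hY he (s' := cst 2 y).
- by rewrite df_cst Fe.
- by rewrite df_cst Fx.
have [u us] := fib_lift Fs.
exists (df 0 u), u; split=> //; apply: fib_eq; rewrite smap_df us //.
Qed.

Lemma fib_iso_edge (e : Z 1) : iso_edge (fib_incl F y 1 e) -> iso_edge e.
Proof.
move=> he; apply: (jointly_iso_edge (F := fun _ : unit => fib_incl F y)) => //.
- exact: fib_quasicat.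
- by move=> _; apply: quasicat_total hF hY.
- by move=> x /(_ tt) /fib_right_inverse.
Qed.

End Fibres.

Lemma smap_eq (X Y : sset) (F G : smap X Y) :
  (forall n x, F n x = G n x) -> F = G.
Proof.
case: F G => [F hF] [G hG] /= h.
have e : F = G by apply: functional_extensionality_dep => n; apply/funext.
by subst G; rewrite (Prop_irrelevance hF hG).
Qed.

(** * Cellular lifting *)

Definition onto m n (t : mono m n) := forall j, exists i, t i = j.

Definition nondegenerate (U : sset) m (u : U m) : Prop :=
  forall k (t : mono m k) (v : U k), k < m -> u <> act t v.

Definition boundary (n : nat) : sset.
Proof.
refine (@SSet
  (fun m => {s : mono m n | exists i : 'I_n.+1, forall j, s j <> i})
  (fun l m t s => exist _ (mono_comp (proj1_sig s) t) _) _ _).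
- by move=> m s; apply: sig_eq; apply: mono_eq.
- by move=> j l m g f s; apply: sig_eq; apply: mono_eq.
Unshelve.
by case: s => s [i hi] /=; exists i => j; apply: hi.
Defined.

Definition boundary_incl n : smap (boundary n) (Delta n) :=
  @SMap (boundary n) (Delta n) (fun m s => proj1_sig s) (fun _ _ _ _ => erefl).

Definition horn_incl n (k : 'I_n.+1) : smap (horn k) (Delta n) :=
  @SMap (horn k) (Delta n) (fun m s => proj1_sig s) (fun _ _ _ _ => erefl).

Lemma boundary_inclP n : smono (boundary_incl n).
Proof. by move=> m a b /sig_eq. Qed.

Lemma horn_inclP n (k : 'I_n.+1) : smono (horn_incl k).
Proof. by move=> m a b /sig_eq. Qed.

(** Routing the section through a prescribed [i0] lets [act_onto_inj] recover the value of a
    degeneracy at [i0]. *)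
Lemma onto_section m n (t : mono m n) i0 : onto t ->
  exists s : mono n m, mono_comp t s = mono_id n /\ s (t i0) = i0.
Proof.
move=> ht; pose s (j : 'I_n.+1) := if j == t i0 then i0 else proj1_sig (cid (ht j)).
have hs (j : 'I_n.+1) : t (s j) = j.
  by rewrite /s; case: eqP => [->|_] //; case: (cid (ht j)).
have hm (i j : 'I_n.+1) : i <= j -> s i <= s j.
  move=> ij; case: (leqP (s i) (s j)) => // h.
  have := mono_le t (ltnW h); rewrite !hs => ji.
  have e : i = j by apply: val_inj; apply/eqP; rewrite eqn_leq ij ji.
  by rewrite e ltnn in h.
exists (Mono hm); split; last by rewrite /= /s eqxx.
by apply: mono_eq => j /=; apply: hs.
Qed.

Lemma mono_strict_id n (s : mono n n) :
  (forall i j : 'I_n.+1, i < j -> s i < s j) -> s = mono_id n.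
Proof.
move=> hs; have lo k (i : 'I_n.+1) : i = k :> nat -> i <= s i.
  elim: k i => [|k IH] i ik; first by rewrite ik.
  have hk : k < n.+1 by have := ltn_ord i; lia.
  have := IH (Ordinal hk) erefl; have := hs (Ordinal hk) i.
  by rewrite /= ik ltnSn => /(_ isT); lia.
have up k (i : 'I_n.+1) : n - i = k -> s i <= i.
  elim: k i => [|k IH] i ik.
    by have := ltn_ord i; have := ltn_ord (s i); lia.
  have hk : i.+1 < n.+1 by lia.
  have := IH (Ordinal hk); have := hs i (Ordinal hk).
  rewrite /= ltnSn => /(_ isT) h /(_ _); lia.
apply: mono_eqn => i; apply/eqP; rewrite eqn_leq.
by rewrite (up _ _ erefl) (lo _ _ erefl).
Qed.

Lemma onto_endo n (f : mono n n) : onto f -> f = mono_id n.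
Proof.
move=> hf; have [s [fs _]] := onto_section ord0 hf.
have e i : f (s i) = i by have := congr1 (fun g : mono n n => g i) fs.
have : s = mono_id n.
  apply: mono_strict_id => i j; rewrite ltnNge => h; rewrite ltnNge.
  apply: contra h => /(mono_le f); by rewrite !e.
by move=> se; rewrite -fs se; apply: mono_eq.
Qed.

Lemma not_onto m n (t : mono m n) : ~ onto t -> exists j, forall i, t i <> j.
Proof.
by move=> /asboolPn/existsp_asboolPn [j /asboolPn/forallp_asboolPn h]; exists j.
Qed.

Lemma miss_factor m n (t : mono m n.+1) (j : 'I_n.+2) : (forall i, t i <> j) ->
  t = mono_comp (face j) (mono_comp (collapse n j) t).
Proof.
move=> h; apply: mono_eqn => i; have := h i; move/eqP; rewrite -val_eqE /=.
have := ltn_ord j; have := ltn_ord (t i).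
by rewrite !inordK /bump /unbump; lia.
Qed.

Section Cellular.
Variables (U P Y : sset) (F : smap P Y) (y : smap U Y).
Hypothesis rlp : forall m (u : U m), nondegenerate u ->
  forall b : smap (boundary m) P,
  (forall k (t : boundary m k), F k (b k t) = act (proj1_sig t) (y m u)) ->
  exists p : P m, F m p = y m u /\
    forall k (t : boundary m k), b k t = act (proj1_sig t) p.

Let T := {n & (U n * P n)%type}.
Let el n u p : T := existT _ n (u, p).

(** A partial lift is stored as the graph of a function on a simplicial subset of [U], so that
    extension is inclusion and unions of chains give the bounds for Zorn's lemma. *)
Record partial_lift (A : set T) : Prop := PartialLift {
  lift_fun : forall n (u : U n) p p', A (el u p) -> A (el u p') -> p = p';
  lift_act : forall m n (t : mono m n) (u : U n) p,
    A (el u p) -> A (el (act t u) (act t p));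
  lift_over : forall n (u : U n) p, A (el u p) -> F n p = y n u }.

Lemma partial_lift_bigcup (G : set (set T)) : (G `<=` partial_lift)%classic ->
  total_on G subset -> partial_lift (\bigcup_(X in G) X)%classic.
Proof.
move=> hG tG; split.
- move=> n u p p' [A GA Ap] [B GB Bp].
  have [AB|BA] := tG _ _ GA GB.
    exact: (lift_fun (hG _ GB) (AB _ Ap) Bp).
  exact: (lift_fun (hG _ GA) Ap (BA _ Bp)).
- by move=> m n t u p [A GA Ap]; exists A => //; apply: (lift_act (hG _ GA)).
- by move=> n u p [A GA Ap]; apply: (lift_over (hG _ GA) Ap).
Qed.

Section Extend.
Variables (A : set T) (hA : partial_lift A).
Variables (n : nat) (u : U n).
Let inA m (v : U m) := exists p, A (el v p).
Hypotheses (uA : ~ inA u) (umin : forall m (v : U m), m < n -> inA v).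

Lemma inA_act m k (t : mono k m) (v : U m) : inA v -> inA (act t v).
Proof. by case=> p /(lift_act hA t) h; exists (act t p). Qed.

Lemma minimal_nondegenerate : nondegenerate u.
Proof.
move=> k t v kn e; apply: uA; rewrite e.
exact: inA_act (umin v kn).
Qed.

Lemma inA_boundary m (t : mono m n) : inA (act t u) <-> ~ onto t.
Proof.
split=> [h ot|/not_onto [j hj]].
  have [s [ts _]] := onto_section ord0 ot.
  by apply: uA; rewrite -[u]act_id -ts act_comp; apply: inA_act.
case: n u uA umin t j hj => [|n'] u' _ umin' t j hj.
  by have := hj ord0; rewrite !ord1.
by rewrite (miss_factor hj) act_comp; apply/inA_act/umin'/ltnSn.
Qed.

(* The uniqueness half of the Eilenberg-Zilber lemma, relative to the domain
   of the partial lift. *)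
Lemma act_onto_inj m (t t' : mono m n) :
  onto t -> onto t' -> act t u = act t' u -> t = t'.
Proof.
move=> ot ot' e; apply: mono_eq => i.
have [s [ts si]] := onto_section i ot.
have : act (mono_comp t' s) u = u by rewrite act_comp -e -act_comp ts act_id.
have [/onto_endo h _|h e'] := pselect (onto (mono_comp t' s)); last first.
  by case: uA; rewrite -e'; apply/inA_boundary.
by have := congr1 (fun g : mono n n => g (t i)) h; rewrite /= si.
Qed.

(** A simplex of least dimension outside the domain is nondegenerate and has its boundary inside, so
    [rlp] supplies [p]. For [t] not onto, [act t u] is in the old domain and [p] was chosen to agree
    with [A]; for [t] onto it is new, and [act_onto_inj] makes its value unambiguous. *)
Lemma partial_lift_extend : exists p : P n,
  partial_lift (fun z : T => A z \/
    exists t : mono (projT1 z) n, projT2 z = (act t u, act t p)).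
Proof.
have hb m (t : boundary n m) : exists p, A (el (act (proj1_sig t) u) p).
  apply/inA_boundary => /= ot; have [j hj] := proj2_sig t.
  by have [i] := ot j; apply: hj.
pose b m t := proj1_sig (cid (hb m t)).
have bP m t : A (el (act (proj1_sig t) u) (b m t)) by rewrite /b; case: cid.
have bnat k m (s : mono k m) (t : boundary n m) : b k (act s t) = act s (b m t).
  apply: (lift_fun hA (bP _ _)).
  by rewrite /= act_comp; apply: (lift_act hA).
have [|p [Fp hp]] := rlp minimal_nondegenerate (b := SMap bnat).
  by move=> m t /=; rewrite (lift_over hA (bP _ _)) smap_nat.
have hpA m (t : mono m n) q : A (el (act t u) q) -> q = act t p.
  move=> h; have /inA_boundary/not_onto ht : inA (act t u) by exists q.
  pose t' : boundary n m :=
    exist (fun s : mono m n => exists i, forall j, s j <> i) t ht.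
  rewrite -(hp m t'); exact: (lift_fun hA h (bP m t')).
exists p; split.
- move=> m v q q' [h|[t [ev eq]]] [h'|[t' [ev' eq']]].
  + exact: (lift_fun hA h h').
  + by rewrite eq'; apply: hpA; rewrite -ev'.
  + by rewrite eq; apply/esym/hpA; rewrite -ev.
  + rewrite eq eq'; have e : act t u = act t' u by rewrite -ev -ev'.
    have [ot|nt] := pselect (onto t); have [ot'|nt'] := pselect (onto t').
    * by rewrite (act_onto_inj ot ot' e).
    * by move/inA_boundary: nt' ot; rewrite -e => /inA_boundary.
    * by move/inA_boundary: nt ot'; rewrite e => /inA_boundary.
    * move/inA_boundary: nt' => [r hr]; rewrite -(hpA _ _ _ hr).
      by rewrite -e in hr; rewrite (hpA _ _ _ hr).
- move=> k m s v q [h|[t [-> ->]]]; first by left; apply: (lift_act hA).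
  by right; exists (mono_comp t s); rewrite /= !act_comp.
- move=> m v q [|[t [-> ->]]]; first exact: (lift_over hA).
  by rewrite !smap_nat Fp.
Qed.

End Extend.

(** Only the boundary problems over the simplices [y m u] have to be solvable, not all those for
    [F]: in the application solvability depends on the invertibility of an edge attached to [u]. *)
Theorem cellular_lift : exists f : smap U P, forall n u, F n (f n u) = y n u.
Proof.
have [A [hA maxA]] := Zorn_bigcup partial_lift_bigcup.
have tot n (u : U n) : exists p, A (el u p).
  elim/ltn_ind: n u => n IH u.
  have [//|uA] := pselect (exists p, A (el u p)).
  have [p hp] := partial_lift_extend hA uA (fun m v h => IH m h v).
  case: (maxA _ _ hp); split; first by move=> z ?; left.
  move=> sub; case: uA; exists p; apply: sub; right; exists (mono_id n).
  by rewrite /= !act_id.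
pose f n u := proj1_sig (cid (tot n u)).
have fP n u : A (el u (f n u)) by rewrite /f; case: cid.
have fnat m n (t : mono m n) (u : U n) : f m (act t u) = act t (f n u).
  exact: (lift_fun hA (fP _ _) (lift_act hA t (fP _ _))).
by exists (SMap fnat) => n u; apply: (lift_over hA).
Qed.

End Cellular.

(** * Exponentials *)

Definition sexp (V Q : sset) : sset.
Proof.
refine (@SSet (fun n => smap (sprod V (Delta n)) Q)
  (fun m n t f => @SMap (sprod V (Delta m)) Q
     (fun k va => f k (va.1, mono_comp t va.2)) _) _ _).
- by move=> n f; apply: smap_eq => k [v a] /=; congr (f k (v, _)); apply: mono_eq.
- by move=> l m n g f x; apply: smap_eq => k [v a] /=; congr (x k (v, _)); apply: mono_eq.
Unshelve.
move=> k l s [v a] /=; rewrite -smap_nat /=.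
by congr (f k (_, _)); apply: mono_eq.
Defined.

Definition sexp_restr (U V Q : sset) (i : smap U V) : smap (sexp V Q) (sexp U Q).
Proof.
refine (@SMap (sexp V Q) (sexp U Q)
  (fun n f => @SMap (sprod U (Delta n)) Q (fun k va => f k (i k va.1, va.2)) _) _).
  by move=> m n t f; apply: smap_eq => k [u a].
Unshelve.
by move=> k l s [v a] /=; rewrite -(smap_nat f) /= smap_nat.
Defined.

Definition sexp_pt (V Q : sset) (v : V 0) : smap (sexp V Q) Q.
Proof.
refine (@SMap (sexp V Q) Q (fun n f => f n (cst n v, mono_id n)) _).
move=> m n t f /=; rewrite -smap_nat /= act_cst.
by congr (f m (_, _)); apply: mono_eq.
Defined.

Definition scurry (U V Q : sset) (g : smap (sprod U V) Q) : smap U (sexp V Q).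
Proof.
refine (@SMap U (sexp V Q)
  (fun n u => @SMap (sprod V (Delta n)) Q (fun k va => g k (act va.2 u, va.1)) _) _).
  by move=> m n t u; apply: smap_eq => k [v a] /=; rewrite act_comp.
Unshelve.
by move=> k l s [v a] /=; rewrite act_comp -smap_nat.
Defined.

Definition suncurry (U V Q : sset) (f : smap U (sexp V Q)) : smap (sprod U V) Q.
Proof.
refine (@SMap (sprod U V) Q (fun k uv => f k uv.1 k (uv.2, mono_id k)) _).
move=> k l s [u v] /=; rewrite smap_nat /= -smap_nat /=.
by congr (f l u k (_, _)); apply: mono_eq.
Defined.

Definition sswap (U V Q : sset) (f : smap (sprod U V) Q) : smap (sprod V U) Q.
Proof.
refine (@SMap (sprod V U) Q (fun k vu => f k (vu.2, vu.1)) _).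
by move=> k l s [v u] /=; rewrite -smap_nat.
Defined.

Lemma sexp_actE V Q m n (t : mono m n) (f : sexp V Q n) k (v : V k) (a : mono k m) :
  (act t f : smap _ _) k (v, a) = (f : smap _ _) k (v, mono_comp t a).
Proof. by []. Qed.

Definition sempty : sset.
Proof.
by refine (@SSet (fun _ => void) (fun _ _ _ x => x) _ _).
Defined.

Definition sempty_map (X : sset) : smap sempty X.
Proof. by refine (@SMap sempty X (fun _ x => match x with end) _). Defined.

(* For the homs of an oo-cosmos this is a case of closure under Leibniz
   exponentials; for arbitrary quasi-categories it is a theorem of Joyal. *)
Definition exponentiable (Q : sset) : Prop :=
  forall (U V : sset) (i : smap U V), smono i -> inner_fibration (sexp_restr Q i).

Section Exponentiable.
Variable Q : sset.
Hypothesis hQ : exponentiable Q.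

Lemma sexp_quasicat V : quasicat (sexp V Q).
Proof.
apply: (@quasicat_total _ _ (sexp_restr Q (sempty_map V))).
  by apply: hQ => n [].
move=> n k _ h.
have hnat m l (t : mono m l) (x : sprod sempty (Delta n) l) :
  match (act t x).1 return Q m with end = act t (match x.1 return Q l with end).
  by case: x => -[].
exists (SMap hnat) => m t; apply: smap_eq => l [[]].
Qed.

(* On vertices 0, 1, 2 |-> 0, 1, 0; this is simplicial because no simplex of
   the horn contains both 1 and 2. *)
Definition horn_collapse : smap (horn (ord0 : 'I_3)) (Delta 1).
Proof.
refine (@SMap (horn (ord0 : 'I_3)) (Delta 1)
  (fun m a => @Mono m 1 (fun j => inord (proj1_sig a j == 1 :> nat)) _) _).
  by move=> m n t a; apply: mono_eq.
Unshelve.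
move=> i j ij; case: a => a [k k0 ak] /=.
have := mono_le a ij; have := ltn_ord (a i); have := ltn_ord (a j).
have := ak i; have := ak j; move: k0; move/eqP; rewrite -val_eqE /= => k0.
move=> /eqP; rewrite -val_eqE /= => hj /eqP; rewrite -val_eqE /= => hi.
have := ltn_ord k; rewrite !inordK; lia.
Defined.

Section RightInverse.
Variable U : sset.

(** Recasts a right inverse as an extension problem along the outer horn of [Delta 2]. In this form
    [U] and [Delta 2] can be exchanged by currying, as the cellwise construction requires. *)
Lemma right_inverseP (e : sexp U Q 1) (s : sexp U Q 2) :
  (forall k (v : U k) (a : horn (ord0 : 'I_3) k),
     (s : smap _ _) k (v, proj1_sig a) = (e : smap _ _) k (v, horn_collapse k a)) <->
  df 2 s = e /\ df 1 s = cst 1 (esrc e).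
Proof.
split=> [h|[h2 h1] k v a].
  have hm (i : nat) : 0 < i < 3 -> (inord i : 'I_3) <> ord0.
    by move=> hi /(congr1 val) /=; rewrite inordK; lia.
  have miss (i : nat) m (c : mono m 1) j :
      mono_comp (face (inord i)) c j <> inord i :> 'I_3.
    by move/eqP; rewrite /= eq_sym (negbTE (neq_lift _ _)).
  pose ha (i : nat) (hi : 0 < i < 3) m (c : mono m 1) : horn (ord0 : 'I_3) m :=
    exist (fun s : mono m 2 => exists2 i : 'I_3, i <> ord0 & forall j, s j <> i)
      (mono_comp (face (inord i)) c) (ex_intro2 _ _ (inord i) (hm i hi) (miss i m c)).
  split; apply: smap_eq => k [v c] /=.
    rewrite (h _ v (ha 2 isT _ c)); congr ((e : smap _ _) k (v, _)).
    apply: mono_eqn => j; have := ltn_ord (c j).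
    by rewrite /= !inordK /bump; lia.
  rewrite (h _ v (ha 1 isT _ c)); congr ((e : smap _ _) k (v, _)).
  apply: mono_eqn => j; have := ltn_ord (c j).
  by rewrite /= !inordK /bump; lia.
have [i i0 hi] := proj2_sig a.
have hv j : proj1_sig a j <> i :> nat by move=> /val_inj; apply: hi.
have hl j := ltn_ord (proj1_sig a j).
rewrite (miss_factor hi).
have -> : face i = face (inord i) by rewrite inord_val.
rewrite -sexp_actE -/(df i s).
have : i = 1 :> nat \/ i = 2 :> nat.
  have := ltn_ord i; move/eqP: i0; rewrite -val_eqE /=; lia.
case=> ei; rewrite ei ?h1 ?h2 /=.
  congr ((e : smap _ _) k (v, _)); apply: mono_eqn => j.
  have := hl j; have := hv j; rewrite ei /= !inordK //; lia.
congr ((e : smap _ _) k (v, _)); apply: mono_eqn => j.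
have := hl j; have := hv j; rewrite ei /= !inordK // /unbump; lia.
Qed.


Definition pointwise_iso (e : sexp U Q 1) : Prop :=
  forall u : U 0, iso_edge (sexp_pt Q u 1 e).

End RightInverse.

Definition pointwise_iso_detection m :=
  forall e : sexp (Delta m) Q 1, pointwise_iso e -> iso_edge e.

(** * Right inverses built cell by cell *)

Section CellwiseRightInverse.
Variable U : sset.
Hypothesis hU : forall m (u : U m), nondegenerate u -> pointwise_iso_detection m.
Variable e : sexp U Q 1.
Hypothesis he : pointwise_iso e.

(** The transpose of the extension problem in [right_inverseP]: its lifts along restriction from
    [Delta 2] to the outer horn are the witnesses of right inverses of [e]. *)
Definition horn_family : smap U (sexp (horn (ord0 : 'I_3)) Q).
Proof.
refine (@SMap U (sexp (horn (ord0 : 'I_3)) Q)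
  (fun n u => @SMap (sprod (horn (ord0 : 'I_3)) (Delta n)) Q
     (fun k ab => (e : smap _ _) k (act ab.2 u, horn_collapse k ab.1)) _) _).
  by move=> m n t u; apply: smap_eq => k [a b] /=; rewrite act_comp.
Unshelve.
move=> k l s [a b].
rewrite -smap_nat /= act_comp; congr ((e : smap _ _) k (_, _)).
exact: mono_eq.
Defined.

Definition cell_edge m (u : U m) : sexp (Delta m) Q 1.
Proof.
refine (@SMap (sprod (Delta m) (Delta 1)) Q
  (fun k tc => (e : smap _ _) k (act tc.1 u, tc.2)) _).
by move=> k l s [t c]; rewrite -smap_nat /= act_comp.
Defined.

Lemma cell_edge_pointwise m (u : U m) : pointwise_iso (cell_edge u).
Proof.
move=> t; have := he (act t u); congr iso_edge => /=.
by congr ((e : smap _ _) 1 (_, _)); rewrite /cst -act_comp.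
Qed.

(** Over a nondegenerate [m]-simplex the lifting problem, with the roles of [Delta 2] and [Delta m]
    exchanged, is a special outer horn for the restriction from [Delta m] to [boundary m]. Its edge
    [cell_edge u] is invertible by the assumed detection in dimension [m]. *)
Lemma cellwise_right_inverse : exists s : sexp U Q 2,
  df 2 s = e /\ df 1 s = cst 1 (esrc e).
Proof.
have [m u nu b hb|f hf] := @cellular_lift U (sexp (Delta 2) Q) _
  (sexp_restr Q (horn_incl ord0)) horn_family; last first.
  exists (suncurry f : sexp U Q 2); apply/right_inverseP => k v a.
  have := congr1 (fun g : sexp _ Q k => (g : smap _ _) k (a, mono_id k)) (hf k v).
  by rewrite /= act_id.
pose eb := sexp_restr Q (boundary_incl m) 1 (cell_edge u).
pose s' : sexp (boundary m) Q 2 := suncurry b.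
have [s2 s1] : df 2 s' = eb /\ df 1 s' = cst 1 (esrc eb).
  apply/right_inverseP => k t a.
  have := congr1 (fun g : sexp _ Q k => (g : smap _ _) k (a, mono_id k)) (hb k t).
  rewrite /= => ->; congr ((e : smap _ _) k (act _ u, _)).
  exact: mono_eq.
have [||s [Fs]] := outer_horn (hQ (@boundary_inclP m))
  (@sexp_quasicat (boundary m)) (hU nu (cell_edge_pointwise u)) (s' := s').
- exact: s2.
- by rewrite s1 smap_esrc.
move=> t2 t1; have /right_inverseP hs := conj t2 t1.
exists (sswap s : sexp _ Q m); split.
  by apply: smap_eq => k [a c]; apply: hs.
move=> k t; apply: smap_eq => l [a c].
have := congr1 (fun g : sexp _ Q 2 => (g : smap _ _) l (act c t, a)) Fs.
rewrite /= => ->; rewrite smap_nat /=.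
by congr ((b k t : smap _ _) l (a, _)); apply: mono_eq.
Qed.

End CellwiseRightInverse.

Hypothesis qQ : quasicat Q.

Lemma iso_of_right_inverses U :
  (forall e : sexp U Q 1, pointwise_iso e ->
     exists s : sexp U Q 2, df 2 s = e /\ df 1 s = cst 1 (esrc e)) ->
  forall e : sexp U Q 1, pointwise_iso e -> iso_edge e.
Proof.
move=> H; apply: (jointly_iso_edge (F := fun u => sexp_pt Q u)) => //.
  exact: sexp_quasicat.
by move=> e /H [s [s2 s1]]; exists (df 0 s), s.
Qed.

Lemma detection0 : pointwise_iso_detection 0.
Proof.
move=> e /(_ (mono_id 0)) he.
pose pr := @SMap (sprod Q (Delta 0)) Q (fun k x => x.1) (fun _ _ _ _ => erefl).
have -> : e = scurry pr 1 (sexp_pt Q (mono_id 0 : Delta 0 0) 1 e).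
  apply: smap_eq => k [x y] /=; rewrite -smap_nat.
  congr ((e : smap _ _) k (_, _)); last exact: mono_eq.
  by apply: mono_eq => i; rewrite [LHS]ord1 [RHS]ord1.
exact: iso_edge_map he.
Qed.

Lemma horn_nondegenerate n (k : 'I_n.+2) m (u : horn k m) :
  nondegenerate u -> m <= n.
Proof.
move=> nu; rewrite leqNgt; apply/negP => nm.
have [i ik hi] := proj2_sig u.
have mi (j : 'I_n.+1) : face i j <> i.
  by move/eqP; rewrite /= eq_sym (negbTE (neq_lift _ _)).
pose v : horn k n := exist (fun s : mono n n.+1 =>
   exists2 i : 'I_n.+2, i <> k & forall j, s j <> i) (face i)
   (ex_intro2 _ _ i ik mi).
apply: (nu n (mono_comp (collapse n i) (proj1_sig u)) v nm).
by apply: sig_eq; apply: miss_factor.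
Qed.

(** From dimension 2 on there is an inner horn, here at 1, whose nondegenerate simplices have
    smaller dimension. Over it the right inverse is built cellwise by induction, and it extends to
    the whole simplex because restriction of exponentials from [Delta 2] to its outer horn is an
    inner fibration. Dimensions 0 and 1 have no inner horn and are treated separately. *)
Lemma detection_step n :
  (forall m, m <= n.+1 -> pointwise_iso_detection m) ->
  pointwise_iso_detection n.+2.
Proof.
move=> IH; apply: iso_of_right_inverses => e he.
pose k : 'I_n.+3 := inord 1.
have hk : 0 < k < n.+2 by rewrite /k inordK.
pose eL := sexp_restr Q (horn_incl k) 1 e.
have [|u|s []] := @cellwise_right_inverse (horn k) _ eL.
- by move=> m u /horn_nondegenerate; apply: IH.
- exact: he.
move=> s2 s1; have /right_inverseP hs := conj s2 s1.
have [|x [Fx hx]] := hQ (@horn_inclP 2 ord0) hk (h := scurry s)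
  (y := horn_family e n.+2 (mono_id _)).
  move=> m t; apply: smap_eq => l [a c] /=.
  rewrite (hs l (act c t) a) /=.
  by congr ((e : smap _ _) l (_, _)); apply: mono_eq.
exists (sswap x : sexp _ Q 2); apply/right_inverseP => l v a.
have := congr1 (fun g : sexp _ Q n.+2 => (g : smap _ _) l (a, v)) Fx.
by rewrite /= => ->; congr ((e : smap _ _) l (_, _)); apply: mono_eq.
Qed.

End Exponentiable.

(** * Pointwise invertible edges *)

Section NatMono.
Variables (f : nat -> nat -> nat).
Hypothesis hf : forall i i' j j', i <= i' -> j <= j' -> f i j <= f i' j'.

Lemma nat_square_subproof k m n l (a : mono l m) (b : mono l n) (i j : 'I_l.+1) :
  i <= j -> (inord (minn k (f (a i) (b i))) : 'I_k.+1) <=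
            (inord (minn k (f (a j) (b j))) : 'I_k.+1).
Proof.
move=> ij; have := hf (mono_le a ij) (mono_le b ij).
by rewrite !inordK; lia.
Qed.

(* [minn] only makes the definition total: f is meant to be bounded by k. *)
Definition nat_square k m n : smap (sprod (Delta m) (Delta n)) (Delta k).
Proof.
refine (@SMap (sprod (Delta m) (Delta n)) (Delta k)
  (fun l ab => Mono (@nat_square_subproof k m n l ab.1 ab.2)) _).
by move=> p l s [a b]; apply: mono_eq.
Defined.

Definition square_of (Q : sset) k m n (x : Q k) : sexp (Delta m) Q n.
Proof.
refine (@SMap (sprod (Delta m) (Delta n)) Q
  (fun l ab => act (nat_square k m n l ab) x) _).
by move=> p l s ab; rewrite smap_nat -act_comp.
Defined.

End NatMono.

(** The formula [i * j.+1] sends [(0, j)] to 0 and [(1, j)] to [j.+1]. The formula [maxn j (i * n)]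
    sends [(0, j)] to [j] and, for [j <= n], [(1, j)] to the top vertex [n]. Thus one collapses the
    start of the prism and the other its end. *)
Lemma horizontal_subproof i i' j j' :
  i <= i' -> j <= j' -> i * j.+1 <= i' * j'.+1.
Proof. by move=> *; apply: leq_mul. Qed.

Lemma vertical_subproof n i i' j j' :
  i <= i' -> j <= j' -> maxn j (i * n) <= maxn j' (i' * n).
Proof. by move=> h h'; have : i * n <= i' * n by [rewrite leq_mul|lia]; lia. Qed.

Section Squares.
Variable Q : sset.

(* The maps Delta 1 x Delta n -> Q obtained from an (n+1)-simplex by collapsing
   one of the two ends of the prism to a point. *)
Definition collapse_start n (x : Q n.+1) : sexp (Delta 1) Q n :=
  square_of horizontal_subproof 1 n x.

Definition collapse_end n (x : Q n.+1) : sexp (Delta 1) Q n :=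
  square_of (@vertical_subproof n.+1) 1 n x.

Hypotheses (qQ : quasicat Q) (eQ : exponentiable Q).

Lemma ord2_cases (i : 'I_2) : i = 0 :> nat \/ i = 1 :> nat.
Proof. by have := ltn_ord i; lia. Qed.



Ltac square_eq :=
  apply: smap_eq => l; case=> a b; rewrite /= -?act_comp; congr (act _ _);
  let j := fresh "j" in let ea := fresh "ea" in let eb := fresh "eb" in
  apply: mono_eqn => j;
  have [] := ord2_cases (a j); have [] := ord2_cases (b j); move=> ea eb;
  rewrite /= !inordK ?ea ?eb /bump /unbump /=; lia.

(** If [x] has vertices a, b, c, an inverse of [df 0 x] gives a 3-simplex [z] with vertices a, b, c,
    b, and collapsing its start yields the witness of a right inverse. The new [y] satisfies the
    hypothesis on [x], so the step can be repeated. *)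
Lemma collapse_start_iso (x : Q 2) : iso_edge (df 0 x) ->
  exists y : Q 2, iso_edge (df 0 y) /\
    tri (collapse_start x) (collapse_start y)
      (cst 1 (esrc (collapse_start x))).
Proof.
case=> g gi; have [[t [t2 t0 t1]] _] := gi.
have [|||z [z0 z2 z3]] := qfill31 qQ (x0 := t) (x2 := sg 1 (df 2 x)) (x3 := x).
- by rewrite (@df_sg_lt _ 0 0 0) // t1 cst1E esrcE (@df_df _ 0 0 1).
- by rewrite t2.
- by rewrite df_sgS.
have hg : iso_edge (df 0 (df 1 z)).
  rewrite (@df_df _ 1 0 0) // z0 t0; exists (df 0 x).
  exact: inverse_edge_sym gi.
exists (df 1 z); split=> //; exists (collapse_start z); split.
- by rewrite -z3; square_eq.
- by square_eq.
- transitivity (collapse_start (sg 1 (df 2 x))); first by rewrite -z2; square_eq.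
  by square_eq.
Qed.

Lemma collapse_start_inv (x : Q 2) :
  iso_edge (df 0 x) -> iso_edge (collapse_start x).
Proof.
move=> /collapse_start_iso [y [/collapse_start_iso [w [_ hw]] hy]].
exact: (iso_edge_right (@sexp_quasicat _ eQ _) hy hw).
Qed.

(** Dual, with a 3-simplex on b, a, b, c; the result is a left inverse. *)
Lemma collapse_end_iso (x : Q 2) : iso_edge (df 2 x) ->
  exists y : Q 2, iso_edge (df 2 y) /\
    tri (collapse_end y) (collapse_end x)
      (cst 1 (esrc (collapse_end y))).
Proof.
case=> h hi; have [_ [t [t2 t0 t1]]] := hi.
have [|||z [z0 z1 z3]] := qfill32 qQ (x0 := x) (x1 := sg 0 (df 0 x)) (x3 := t).
- by rewrite df_sg.
- by rewrite t0.
- have [_ _] := tri_ends (ex_intro _ t (And3 t2 t0 t1)).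
  rewrite etgt_cst etgtE (@df_df _ 0 0 1) // => e.
  by rewrite t1 (@df_sg_gt _ 0 1 0) // -e cst1E.
have hh : iso_edge (df 2 (df 2 z)).
  rewrite -(@df_df _ 1 2 2) // z3 t2; exists (df 2 x).
  exact: inverse_edge_sym hi.
exists (df 2 z); split=> //; exists (collapse_end z); split.
- by square_eq.
- by rewrite -z0; square_eq.
- transitivity (collapse_end (sg 0 (df 0 x))); first by rewrite -z1; square_eq.
  have -> : df 0 x = df 1 (df 2 z).
    by rewrite (@df_df _ 1 1 1) // z1 df_sgS.
  by square_eq.
Qed.


Lemma collapse_end_inv (x : Q 2) :
  iso_edge (df 2 x) -> iso_edge (collapse_end x).
Proof.
move=> /collapse_end_iso [y [/collapse_end_iso [w [_ hw]] hy]].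
have qS : quasicat (sexp (Delta 1) Q) := @sexp_quasicat _ eQ _.
have iw := iso_edge_right qS hw hy.
apply: (iso_tril qS hy) (iso_edge_cst _).
exact: (iso_tril qS hw iw (iso_edge_cst _)).
Qed.

Lemma nat_line_subproof (f : nat -> nat) k n
  (hf : forall i j, i <= j -> f i <= f j) (i j : 'I_n.+1) :
  i <= j -> (inord (minn k (f i)) : 'I_k.+1) <= (inord (minn k (f j)) : 'I_k.+1).
Proof. by move/hf; rewrite !inordK; lia. Qed.

Lemma at_least_subproof c i j : i <= j -> (c <= i : nat) <= (c <= j).
Proof. lia. Qed.

Definition at_least c : mono 2 1 :=
  Mono (@nat_line_subproof _ 1 2 (at_least_subproof c)).

Lemma corner_subproof i i' j j' :
  i <= i' -> j <= j' -> (2 <= i + j : nat) <= (2 <= i' + j').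
Proof. lia. Qed.

(** Over the vertices 0, 1, 2 of [Delta 2] lie the source, the diagonal and the target of the
    square: [(i, j)] goes to the target end exactly when [2 <= i + j]. *)
Definition square_decomp (e : sexp (Delta 1) Q 1) : sexp (Delta 1) Q 2.
Proof.
refine (@SMap (sprod (Delta 1) (Delta 2)) Q
  (fun l ab => (e : smap _ _) l (ab.1, nat_square corner_subproof 1 1 2 l ab)) _).
move=> p l s [a b]; rewrite -(smap_nat e) /=.
congr ((e : smap _ _) p (_, _)); exact: mono_eq.
Defined.

(* A square is the composite of its two triangles, each seen as a square with
   one degenerate side. *)
Lemma square_tri (e : sexp (Delta 1) Q 1) :
  tri (collapse_start ((e : smap _ _) 2 (at_least 1, at_least 2)))
      (collapse_end ((e : smap _ _) 2 (at_least 2, at_least 1))) e.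
Proof.
exists (square_decomp e); split.
- apply: smap_eq => l [a b] /=; rewrite -(smap_nat e) /=.
  by congr ((e : smap _ _) l (_, _)); apply: mono_eqn => j;
   have [] := ord2_cases (a j); have [] := ord2_cases (b j); move=> ea eb;
   rewrite /= !inordK ?ea ?eb /bump /unbump /=; lia.
- apply: smap_eq => l [a b] /=; rewrite -(smap_nat e) /=.
  by congr ((e : smap _ _) l (_, _)); apply: mono_eqn => j;
   have [] := ord2_cases (a j); have [] := ord2_cases (b j); move=> ea eb;
   rewrite /= !inordK ?ea ?eb /bump /unbump /=; lia.
- apply: smap_eq => l [a b] /=.
  by congr ((e : smap _ _) l (_, _)); apply: mono_eqn => j;
   have [] := ord2_cases (a j); have [] := ord2_cases (b j); move=> ea eb;
   rewrite /= !inordK ?ea ?eb /bump /unbump /=; lia.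
Qed.

Lemma detection1 : pointwise_iso_detection Q 1.
Proof.
move=> e he; apply: (iso_tri (@sexp_quasicat _ eQ _) (square_tri e)).
  apply: collapse_start_inv; rewrite /df -(smap_nat e).
  have := he (mono_const 0 ord_max); congr iso_edge => /=.
  by congr ((e : smap _ _) 1 (_, _)); apply: mono_eqn => j;
    have [ej|ej] := ord2_cases j; rewrite /= !inordK ?ej /bump //=; lia.
apply: collapse_end_inv; rewrite /df -(smap_nat e).
have := he (mono_const 0 ord0); congr iso_edge => /=.
by congr ((e : smap _ _) 1 (_, _)); apply: mono_eqn => j;
    have [ej|ej] := ord2_cases j; rewrite /= !inordK ?ej /bump //=; lia.
Qed.

Lemma pointwise_iso_edge U (e : sexp U Q 1) : pointwise_iso e -> iso_edge e.
Proof.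
have det n : pointwise_iso_detection Q n.
  elim/ltn_ind: n => -[|[|n]] IH.
  - exact: detection0.
  - exact: detection1.
  - exact: detection_step.
apply: (iso_of_right_inverses eQ qQ) => f hf.
by apply: cellwise_right_inverse.
Qed.

End Squares.

(** * Limits *)

Lemma dependent_choice (T : nat -> Type) (P : forall n, T n -> Prop)
    (R : forall n, T n -> T n.+1 -> Prop) :
  (exists x, P 0 x) -> (forall n x, P n x -> exists y, P n.+1 y /\ R n x y) ->
  exists f : forall n, T n, (forall n, P n (f n)) /\ forall n, R n (f n) (f n.+1).
Proof.
move=> /cid [x0 p0] step.
pose S n := {x : T n | P n x}.
pose next n (s : S n) : S n.+1 :=
  let w := cid (step n (proj1_sig s) (proj2_sig s)) in
  exist _ (proj1_sig w) (proj1 (proj2_sig w)).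
pose f n : S n := nat_rect S (exist _ x0 p0) next n.
exists (fun n => proj1_sig (f n)); split=> n; first exact: proj2_sig.
by rewrite /= /next; case: cid => y [].
Qed.

Lemma post_comp (C : scat) (X A B E : C) n (g : arr B E) (f : arr A B)
    (x : hom X A n) : post X g n (post X f n x) = post X (comp g f) n x.
Proof. by rewrite /= cst_comp comp_assoc. Qed.

Lemma pre_comp (C : scat) (A B D E : C) n (g : arr B D) (f : arr A B)
    (x : hom D E n) : pre E f n (pre E g n x) = pre E (comp g f) n x.
Proof. by rewrite /= cst_comp comp_assoc. Qed.

Lemma post_pre (C : scat) (A B D E : C) n (g : arr D E) (f : arr A B)
    (x : hom B D n) : post A g n (pre D f n x) = pre E f n (post B g n x).
Proof. by rewrite /= comp_assoc. Qed.

Lemma post_id (C : scat) (A B : C) n (x : hom A B n) : post A (idv B) n x = x.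
Proof. exact: comp_idl. Qed.

Lemma pre_id (C : scat) (A B : C) n (x : hom A B n) : pre B (idv A) n x = x.
Proof. exact: comp_idr. Qed.

Lemma act_vertex (X : sset) n (t : mono n 0) (x : X 0) : act t x = cst n x.
Proof. by congr (act _ _); apply: mono_eq => i; rewrite [LHS]ord1 [RHS]ord1. Qed.

Section Limits.
Variables (C : scat) (U : sset) (Q : graph) (D : diagram Q C).
Implicit Types c : cone U D.

Lemma limit_ext c : is_limit c -> forall (X : C) n (f f' : hom X (apex c) n),
  (forall j m (u : U m) (t : mono m n),
     comp (leg c j m u) (act t f) = comp (leg c j m u) (act t f')) -> f = f'.
Proof.
move=> hc X n f f' h.
have hnat j k m (s : mono k m) (ut : sprod U (Delta n) m) :
    comp (leg c j k (act s ut).1) (act (act s ut).2 f) =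
    act s (comp (leg c j m ut.1) (act ut.2 f)).
  by rewrite comp_nat -smap_nat -act_comp.
have [|g [_ gu]] := hc X n (fun j => SMap (hnat j)).
  by move=> a m v /=; rewrite comp_assoc leg_nat.
by rewrite -(gu f) // -(gu f') // => j m u t; rewrite -h.
Qed.

Lemma limit_arr c : is_limit c -> forall (X : C) (psi : forall j, smap U (hom X (dob D j))),
  (forall (a : link Q) m (u : U m),
     comp (cst m (darr D a)) (psi (dom a) m u) = psi (cod a) m u) ->
  exists f : arr X (apex c),
    forall j m (u : U m), comp (leg c j m u) (cst m f) = psi j m u.
Proof.
move=> hc X psi hpsi.
have hnat j k m (s : mono k m) (ut : sprod U (Delta 0) m) :
  psi j k (act s ut).1 = act s (psi j m ut.1) by rewrite -smap_nat.
have [|f [hf _]] := hc X 0 (fun j => SMap (hnat j)).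
  by move=> a m v; apply: hpsi.
exists f => j m u.
exact: (hf j m u (mono_const m ord0)).
Qed.

Lemma limit_ext0 c : is_limit c -> forall (X : C) (f f' : arr X (apex c)),
  (forall j m (u : U m),
     comp (leg c j m u) (cst m f) = comp (leg c j m u) (cst m f')) -> f = f'.
Proof.
by move=> hc X f f' h; apply: (limit_ext hc) => j m u t; rewrite !act_vertex.
Qed.

Lemma limit_comparison c c' : is_limit c -> is_limit c' ->
  exists2 f : arr (apex c) (apex c'), is_iso f &
    forall j m (u : U m), comp (leg c' j m u) (cst m f) = leg c j m u.
Proof.
move=> hc hc'.
have [f hf] := limit_arr hc' (@leg_nat _ _ _ _ c).
have [g hg] := limit_arr hc (@leg_nat _ _ _ _ c').
exists f => //; exists g; split.
  apply: (limit_ext0 hc) => j m u.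
  by rewrite cst_comp comp_assoc hg hf comp_idr.
apply: (limit_ext0 hc') => j m u.
by rewrite cst_comp comp_assoc hf hg comp_idr.
Qed.

Lemma limit_of_iso c c' (f : arr (apex c) (apex c')) :
  is_limit c' -> is_iso f ->
  (forall j m (u : U m), comp (leg c' j m u) (cst m f) = leg c j m u) ->
  is_limit c.
Proof.
move=> hc' [g [gf fg]] hf X n phi hphi.
have [h [hh hu]] := hc' X n phi hphi.
exists (comp (cst n g) h); split.
  move=> j m u t; rewrite -hf comp_nat act_cst comp_assoc -(comp_assoc _ (cst m f)).
  by rewrite -cst_comp fg comp_idr hh.
move=> h' hh'; rewrite (hu (comp (cst n f) h')).
  by rewrite comp_assoc -cst_comp gf comp_idl.
by move=> j m u t; rewrite comp_nat act_cst comp_assoc hf hh'.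
Qed.

End Limits.

Section ConicalLimits.
Variables (C : scat) (Q : graph) (D : diagram Q C).

Lemma leg_spoint (c : cone spoint D) j m u : leg c j m u = cst m (proj c j tt).
Proof. by rewrite /cst /proj -smap_nat; case: u. Qed.

Definition conical_cone (A : C) (p : forall j, arr A (dob D j))
    (hp : forall a, comp (darr D a) (p (dom a)) = p (cod a)) : cone spoint D.
Proof.
refine (@Cone spoint Q C D A
  (fun j => @SMap spoint (hom A (dob D j)) (fun n _ => cst n (p j)) _) _).
by move=> a n u /=; rewrite -hp cst_comp.
Unshelve.
by move=> m n t u; rewrite act_cst.
Defined.

Lemma proj_conical_cone A p hp j : proj (@conical_cone A p hp) j tt = p j.
Proof. exact: cst0. Qed.

Lemma conical_limitP (c : cone spoint D) : is_limit c <->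
  forall (X : C) n (x : forall j, hom X (dob D j) n),
    (forall a, post X (darr D a) n (x (dom a)) = x (cod a)) ->
    exists! f : hom X (apex c) n, forall j, post X (proj c j tt) n f = x j.
Proof.
split=> hc X n x hx.
  have hnat j k m (s : mono k m) (ut : sprod spoint (Delta n) m) :
    act (act s ut).2 (x j) = act s (act ut.2 (x j)) by rewrite -act_comp.
  have [|f [hf fu]] := hc X n (fun j => SMap (hnat j)).
    by move=> a m v; rewrite /= -hx /= comp_nat act_cst.
  exists f; split=> [j|f' hf'].
    by have := hf j n tt (mono_id n); rewrite leg_spoint /= !act_id.
  apply: fu => j m u t.
  by rewrite leg_spoint /= -hf' comp_nat act_cst.
have [|f [hf fu]] := hc X n (fun j => x j n (tt, mono_id n)).
  by move=> a; apply: hx.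
have xE j m (u : spoint m) (t : mono m n) :
    x j m (u, t) = act t (x j n (tt, mono_id n)).
  by rewrite -smap_nat /=; congr (x j m (_, _)); [case: u | apply: mono_eq].
exists f; split=> [j m u t|f' hf'].
  by rewrite leg_spoint xE -hf /= comp_nat act_cst.
by apply: fu => j; rewrite -hf' leg_spoint act_id.
Qed.

Lemma conical_ext (c : cone spoint D) : is_limit c ->
  forall (X : C) n (f f' : hom X (apex c) n),
  (forall j, post X (proj c j tt) n f = post X (proj c j tt) n f') -> f = f'.
Proof.
move=> hc X n f f' h; apply: (limit_ext hc) => j m u t; rewrite leg_spoint.
by have := congr1 (act t) (h j); rewrite /= !comp_nat act_cst.
Qed.

Lemma conical_ex (c : cone spoint D) : is_limit c ->
  forall (X : C) n (x : forall j, hom X (dob D j) n),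
    (forall a, post X (darr D a) n (x (dom a)) = x (cod a)) ->
    exists f : hom X (apex c) n, forall j, post X (proj c j tt) n f = x j.
Proof. by move=> /conical_limitP hc X n x /hc [f [hf _]]; exists f. Qed.

Lemma conical_proj (c : cone spoint D) (a : link Q) :
  comp (darr D a) (proj c (dom a) tt) = proj c (cod a) tt.
Proof. by have := leg_nat c a (tt : spoint 0); rewrite cst0. Qed.

End ConicalLimits.

Section Pullbacks.
Variables (C : scat) (D : diagram cospan C).

Lemma pullback_limitP (c : cone spoint D) : is_limit c <->
  forall (X : C) n (x : hom X (dob D (Some true)) n) (y : hom X (dob D (Some false)) n),
    post X (darr D true) n x = post X (darr D false) n y ->
    exists! f : hom X (apex c) n,
      post X (proj c (Some true) tt) n f = x /\
      post X (proj c (Some false) tt) n f = y.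
Proof.
rewrite conical_limitP; split=> hc X n.
  move=> x y hxy.
  have [|f [hf fu]] := hc X n (fun j => match j return hom X (dob D j) n with
    | Some true => x | Some false => y | None => post X (darr D true) n x end).
    by case.
  exists f; split; first by split; [apply: (hf (Some true)) | apply: (hf (Some false))].
  move=> f' [h1 h2]; apply: fu => -[[]|] //.
  by rewrite -h1 post_comp (conical_proj c true).
move=> x hx; have [|f [[h1 h2] fu]] := hc X n (x (Some true)) (x (Some false)).
  by rewrite (hx true) (hx false).
exists f; split=> [[[]|]|f' hf'] //; last by apply: fu; split.
transitivity (post X (darr D true) n (x (Some true))); last exact: (hx true).
by rewrite -h1 post_comp (conical_proj c true).
Qed.

Section Cone.
Variables (W : C) (a : arr W (dob D (Some true))) (b : arr W (dob D (Some false))).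
Hypothesis hab : comp (darr D true) a = comp (darr D false) b.

Definition pullback_leg (j : node cospan) : arr W (dob D j) :=
  match j with
  | Some true => a | Some false => b | None => comp (darr D true) a end.

Lemma pullback_leg_nat (i : link cospan) :
  comp (darr D i) (pullback_leg (dom i)) = pullback_leg (cod i).
Proof. by case: i => //=; rewrite hab. Qed.

Definition pullback_cone : cone spoint D := conical_cone pullback_leg_nat.

Lemma pullback_coneP :
  (forall (X : C) n (x : hom X (dob D (Some true)) n) (y : hom X (dob D (Some false)) n),
    post X (darr D true) n x = post X (darr D false) n y ->
    exists! f : hom X W n, post X a n f = x /\ post X b n f = y) ->
  is_limit pullback_cone.
Proof.
by move=> h; apply/pullback_limitP => X n x y hxy; rewrite !proj_conical_cone; apply: h.
Qed.

End Cone.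

Lemma pullback_arr (c : cone spoint D) : is_limit c ->
  forall (W : C) (a : arr W (dob D (Some true))) (b : arr W (dob D (Some false))),
  comp (darr D true) a = comp (darr D false) b ->
  exists g : arr W (apex c),
    comp (proj c (Some true) tt) g = a /\ comp (proj c (Some false) tt) g = b.
Proof.
move=> /pullback_limitP hc W a b hab; have [|g [[ga gb] _]] := hc W 0 a b.
  by rewrite !post0.
by exists g; rewrite -!post0.
Qed.

Lemma pullback_ext (c : cone spoint D) : is_limit c ->
  forall (X : C) n (f f' : hom X (apex c) n),
  post X (proj c (Some true) tt) n f = post X (proj c (Some true) tt) n f' ->
  post X (proj c (Some false) tt) n f = post X (proj c (Some false) tt) n f' ->
  f = f'.
Proof.
move=> hc X n f f' h1 h2; apply: (conical_ext hc) => -[[]|] //.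
by rewrite -(conical_proj c true) -!post_comp h1.
Qed.

Lemma pullback_ex (c : cone spoint D) : is_limit c ->
  forall (X : C) n (x : hom X (dob D (Some true)) n) (y : hom X (dob D (Some false)) n),
  post X (darr D true) n x = post X (darr D false) n y ->
  exists f : hom X (apex c) n, post X (proj c (Some true) tt) n f = x /\
      post X (proj c (Some false) tt) n f = y.
Proof.
by move=> /pullback_limitP hc X n x y hxy; have [f [hf _]] := hc X n x y hxy; exists f.
Qed.

End Pullbacks.

(** * Powers in an oo-cosmos *)

Definition terminal (C : scat) (T : C) : Prop :=
  forall X n, exists! f : hom X T n, True.

Lemma terminal_ex (C : scat) (T X : C) n : terminal T -> exists f : hom X T n, True.
Proof. by move=> /(_ X n) [f _]; exists f. Qed.

Lemma terminal_uniq (C : scat) (T X : C) n (f g : hom X T n) : terminal T -> f = g.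
Proof. by move=> /(_ X n) [h [_ hu]]; rewrite -(hu f) // -(hu g). Qed.

Section Powers.
Variables (C : scat) (A : C) (V : sset).
Variable c : cone V (family (fun _ : unit => A)).
Hypothesis hc : is_limit c.

Lemma power_ext X n (f f' : hom X (apex c) n) :
  (forall m (v : V m) (t : mono m n),
    comp (leg c tt m v) (act t f) = comp (leg c tt m v) (act t f')) -> f = f'.
Proof. by move=> h; apply: (limit_ext hc) => -[] m v t; apply: h. Qed.

Lemma power_ex X n (phi : smap (sprod V (Delta n)) (hom X A)) :
  exists f : hom X (apex c) n, forall m (v : V m) (t : mono m n),
    comp (leg c tt m v) (act t f) = phi m (v, t).
Proof.
have [|f [hf _]] := hc (X := X) (phi := fun _ => phi); first by case.
by exists f => m v t; rewrite (hf tt).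
Qed.

Lemma power_arr X (psi : smap V (hom X A)) : exists f : arr X (apex c),
  forall m (v : V m), comp (leg c tt m v) (cst m f) = psi m v.
Proof.
have [|f hf] := limit_arr hc (X := X) (psi := fun _ => psi); first by case.
by exists f => m v; rewrite (hf tt).
Qed.

Lemma terminal_power : terminal A -> terminal (apex c).
Proof.
move=> tA X n.
have h m : exists f : hom X A m, True by apply: terminal_ex.
have hnat l m (t : mono l m) (w : sprod V (Delta n) m) :
    proj1_sig (cid (h l)) = act t (proj1_sig (cid (h m))).
  exact: terminal_uniq.
have [f _] := power_ex (SMap hnat).
exists f; split=> // f' _; apply: power_ext => m v t; exact: terminal_uniq.
Qed.

Definition power_hom X : smap (hom X (apex c)) (sexp V (hom X A)).
Proof.
refine (@SMap (hom X (apex c)) (sexp V (hom X A))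
  (fun n f => @SMap (sprod V (Delta n)) (hom X A)
    (fun k vt => comp (leg c tt k vt.1) (act vt.2 f)) _) _).
  by move=> m n t f; apply: smap_eq => k [v a] /=; rewrite act_comp.
Unshelve.
by move=> k l s [v a] /=; rewrite comp_nat -smap_nat -act_comp.
Defined.

Lemma power_hom_inj X : smono (power_hom X).
Proof.
move=> n f f' e; apply: power_ext => m v t.
exact: (congr1 (fun g : sexp V (hom X A) n => (g : smap _ _) m (v, t)) e).
Qed.

Lemma power_hom_surj X n (g : sexp V (hom X A) n) :
  exists f, power_hom X n f = g.
Proof.
have [f hf] := power_ex g; exists f; apply: smap_eq => k [v t]; exact: hf.
Qed.

Lemma power_hom_pt X n (f : hom X (apex c) n) (v : V 0) :
  sexp_pt (hom X A) v n (power_hom X n f) = post X (proj c tt v) n f.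
Proof. by rewrite /= act_id smap_cst. Qed.

End Powers.

Lemma power_terminal_of_empty (C : scat) (A : C) (c : cone sempty (family (fun _ : unit => A))) :
  is_limit c -> terminal (apex c).
Proof.
move=> hc X n.
have hnat l m (t : mono l m) (w : sprod sempty (Delta n) m) :
    match (act t w).1 return hom X A l with end =
    act t (match w.1 return hom X A m with end).
  by case: w => -[].
have [f _] := power_ex hc (SMap hnat).
by exists f; split=> // f' _; apply: (power_ext hc) => m [].
Qed.

Section Cosmos.
Variable K : cosmos.
Implicit Types A B E X : K.

Let cK := cosmosP K.

Lemma hom_quasicat A B : quasicat (hom A B).
Proof. exact: cosmos_hom cK A B. Qed.

Lemma post_inner X A B (f : arr A B) : isofib f -> inner_fibration (post X f).
Proof. by move=> /(isof_hom cK X) []. Qed.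

Lemma power_limit (V : sset) A : exists c : cone V (family (fun _ : unit => A)), is_limit c.
Proof. exact: (cosmos_lim cK (cosm_power _ _ _)). Qed.

Lemma terminal_limit : exists c : cone spoint (family (fun i : void => match i return K with end)),
  is_limit c.
Proof. exact: (cosmos_lim cK (cosm_product _ _)). Qed.

Lemma limit_terminal (c : cone spoint (family (fun i : void => match i return K with end))) :
  is_limit c -> terminal (apex c).
Proof.
move=> hc X n.
have [|f _] := @conical_ex _ _ _ _ hc X n (fun j : void => match j with end).
  by case.
by exists f; split=> // f' _; apply: (conical_ext hc) => -[].
Qed.

Lemma isofib_to_terminal : exists2 T : K, terminal T & forall A (f : arr A T), isofib f.
Proof.
have [c hc] := terminal_limit.
exists (apex c); first exact: limit_terminal hc.
move=> A f; exact: (isof_terminal cK hc).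
Qed.

(** The Leibniz exponential of [i] with the map from [A] to a terminal object: powers of a terminal
    object are terminal, so the pullback in [isof_leibniz] can be taken to be [A^U]. *)
Lemma power_restr_isofib (U V : sset) (i : smap U V) A
    (aU : cone U (family (fun _ : unit => A)))
    (aV : cone V (family (fun _ : unit => A))) (g : arr (apex aV) (apex aU)) :
  smono i -> is_limit aU -> is_limit aV ->
  (forall n (u : U n), comp (leg aU tt n u) (cst n g) = leg aV tt n (i n u)) ->
  isofib g.
Proof.
move=> hi haU haV hg.
have [T tT isT] := isofib_to_terminal.
have [f _] := terminal_ex A 0 tT.
have [bU hbU] := power_limit U T; have [bV hbV] := power_limit V T.
have tU := terminal_power hbU tT; have tV := terminal_power hbV tT.
have [fU _] := terminal_ex (apex aU) 0 tU.
have [Bi _] := terminal_ex (apex bV) 0 tU.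
have [q _] := terminal_ex (apex aU) 0 tV.

have hP : comp fU (idv (apex aU)) = comp Bi q by apply: terminal_uniq.
pose P := @pullback_cone _ (cospan_diagram fU Bi) _ (idv (apex aU)) q hP.
have limP : is_limit P.
  apply: pullback_coneP => X n x y _; exists x; split.
    by split; [apply: post_id | apply: terminal_uniq tV].
  by move=> x' [<- _]; rewrite post_id.
have PE : proj P (Some true) tt = idv (apex aU) by rewrite proj_conical_cone.
have terminal_eq X n (x y : hom X T n) : x = y by apply: terminal_uniq tT.
apply: (isof_leibniz cK (P := P) (fU := fU) (g := g) hi (isT _ f) haU haV hbU hbV limP) => //.
by move=> n u; rewrite PE comp_id0l.
Qed.

(** The Leibniz exponential of the empty inclusion with [f]: powers by [sempty] are terminal, so the
    pullback can be taken to be [B^V]. *)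
Lemma power_isofib (V : sset) A B (f : arr A B)
    (aV : cone V (family (fun _ : unit => A)))
    (bV : cone V (family (fun _ : unit => B))) (g : arr (apex aV) (apex bV)) :
  isofib f -> is_limit aV -> is_limit bV ->
  (forall n (v : V n),
    comp (leg bV tt n v) (cst n g) = comp (cst n f) (leg aV tt n v)) ->
  isofib g.
Proof.
move=> hf haV hbV hg.
have [aU haU] := power_limit sempty A; have [bU hbU] := power_limit sempty B.
have tA := power_terminal_of_empty haU; have tB := power_terminal_of_empty hbU.
have [fU _] := terminal_ex (apex aU) 0 tB.
have [Bi _] := terminal_ex (apex bV) 0 tB.
have [q _] := terminal_ex (apex bV) 0 tA.
have hP : comp fU q = comp Bi (idv (apex bV)) by apply: terminal_uniq.
pose P := @pullback_cone _ (cospan_diagram fU Bi) _ q (idv (apex bV)) hP.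
have limP : is_limit P.
  apply: pullback_coneP => X n x y _; exists y; split.
    by split; [apply: terminal_uniq tA | apply: post_id].
  by move=> x' [_ <-]; rewrite post_id.
have PE : proj P (Some false) tt = idv (apex bV) by rewrite proj_conical_cone.
have smono0 : smono (sempty_map V) by move=> n [].
apply: (isof_leibniz cK (P := P) (fU := fU) (g := g) smono0 hf haU haV hbU hbV limP);
  try by move=> n [].
by move=> n v; rewrite PE comp_id0l.
Qed.

(** [power_hom] identifies [sexp_restr] with post-composition by the isofibration between powers, so
    the lifting problem is transported there and back. *)
Lemma hom_exponentiable X A : exponentiable (hom X A).
Proof.
move=> U V i hi n k hk h y hy.
have [aU haU] := power_limit U A; have [aV haV] := power_limit V A.
have inat m l (t : mono m l) (u : U l) :
    leg aV tt m (i m (act t u)) = act t (leg aV tt l (i l u)).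
  by rewrite !smap_nat.
have [g hg] := power_arr haU (SMap inat : smap U (hom (apex aV) A)).
have ig := power_restr_isofib hi haU haV hg.
have gE m (f : hom X (apex aV) m) :
    power_hom aU X m (post X g m f) = sexp_restr (hom X A) i m (power_hom aV X m f).
  apply: smap_eq => l [u t] /=.
  by rewrite comp_nat act_cst comp_assoc hg.
pose hl m (t : horn k m) := proj1_sig (cid (power_hom_surj haV (h m t))).
have hlE m t : power_hom aV X m (hl m t) = h m t by rewrite /hl; case: cid.
have hlnat m l (s : mono m l) (t : horn k l) : hl m (act s t) = act s (hl l t).
  by apply: (power_hom_inj haV); rewrite smap_nat !hlE smap_nat.
have [y' y'E] := power_hom_surj haU y.
have [|x [xE hx]] := @post_inner X _ _ _ ig _ _ hk (SMap hlnat) y'.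
  move=> m t; apply: (power_hom_inj haU).
  rewrite gE (hlE m t : power_hom aV X m (SMap hlnat m t) = h m t) hy.
  by rewrite smap_nat y'E.
exists (power_hom aV X n x); split; first by rewrite -gE xE.
by move=> m t; rewrite -smap_nat -hx; rewrite -hlE.
Qed.

End Cosmos.

(** * Invertible edges in limits *)

Section LimitIso.
Variable K : cosmos.

Lemma conical_right_inverse (Q : graph) (D : diagram Q K) (c : cone spoint D)
    (X : K) (x : hom X (apex c) 1) (s : forall j, hom X (dob D j) 2) :
  is_limit c ->
  (forall a, post X (darr D a) 2 (s (dom a)) = s (cod a)) ->
  (forall j, df 2 (s j) = post X (proj c j tt) 1 x) ->
  (forall j, df 1 (s j) = cst 1 (esrc (post X (proj c j tt) 1 x))) ->
  exists g, tri x g (cst 1 (esrc x)).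
Proof.
move=> hc hs s2 s1; have [f hf] := conical_ex hc hs.
exists (df 0 f), f; split=> //; apply: (conical_ext hc) => j.
  by rewrite smap_df hf s2.
by rewrite smap_df hf s1 smap_cst smap_esrc.
Qed.

Lemma right_inverse_choice (X A : K) (x : hom X A 1) : iso_edge x ->
  {s : hom X A 2 | df 2 s = x /\ df 1 s = cst 1 (esrc x)}.
Proof.
by move=> h; apply: cid; case: h => g [[s [s2 s0 s1]] _]; exists s.
Qed.

Theorem limit_iso_edge (U : sset) (Q : graph) (D : diagram Q K) (c : cone U D) :
  cosmological (@isofib K) U D -> is_limit c ->
  forall (X : K) (x : hom X (apex c) 1),
  (forall j (u : U 0), iso_edge (post X (proj c j u) 1 x)) -> iso_edge x.
Proof.
move=> hD hc X x hx.
apply: (jointly_iso_edge (F := fun ju : node Q * U 0 => post X (proj c ju.1 ju.2))).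
- exact: hom_quasicat.
- by move=> i; apply: hom_quasicat.
- move=> {hx}x hx; have {}hx j u : iso_edge (post X (proj c j u) 1 x) := hx (j, u).
  case: hD c hc x hx => [I D' c hc x hx|D' h c hc x hx|D' h c hc x hx|V A c hc x hx].
  + pose s j := right_inverse_choice (hx j tt).
    apply: (conical_right_inverse (s := fun j => proj1_sig (s j)) hc).
    * by case.
    * by move=> j; have [? _] := proj2_sig (s j).
    * by move=> j; have [_ ?] := proj2_sig (s j).
  + have [sF [F2 F1]] := right_inverse_choice (hx (Some false) tt).
    have hT := hx (Some true) tt.
    have nT := conical_proj c true; have nF := conical_proj c false.
    pose sN := post X (darr D' false) 2 sF.
    (* The right inverse at the free corner is pushed to [None] and lifted through the isofibration,
       so the three components agree strictly. *)
    have [||sT [TN T2 T1]] := outer_horn (@post_inner K X _ _ _ h) (@hom_quasicat K _ _) hT (s' := sN).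
    * by rewrite -smap_df F2 !post_comp nT nF.
    * by rewrite -smap_df F1 smap_cst -!smap_esrc !post_comp nT nF.
    apply: (conical_right_inverse (s := fun j : node cospan =>
      match j return hom X (dob D' j) 2 with
        Some true => sT | Some false => sF | None => sN end) hc).
    * by case.
    * by case=> [[]|] //; rewrite -smap_df F2 post_comp nF.
    * by case=> [[]|] //; rewrite -smap_df F1 smap_cst -!smap_esrc post_comp nF.
  + have [|n y [y2 y1]|s [sP sR]] := @dependent_choice (fun n => simplex (hom X (dob D' n)) 2)
      (fun n s => df 2 s = post X (proj c n tt) 1 x /\
                  df 1 s = cst 1 (esrc (post X (proj c n tt) 1 x)))
      (fun n s s' => post X (darr D' n) 2 s' = s).
    * by have [s hs] := right_inverse_choice (hx 0 tt); exists s.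
    * have nn := conical_proj c n.
      have [||s [sy s2 s1]] := outer_horn (@post_inner K X _ _ _ (h n)) (@hom_quasicat K _ _)
         (hx n.+1 tt) (s' := y).
      - by rewrite y2 post_comp nn.
      - by rewrite y1 -smap_esrc post_comp nn.
      by exists s.
    * apply: (@conical_right_inverse tower D' c X x s hc sR) => j.
        by have [] := sP j.
      by have [] := sP j.
  + have hp : pointwise_iso (power_hom c X 1 x).
      by move=> v; rewrite power_hom_pt; apply: hx.
    have [g [[s [s2 s0 s1]] _]] := pointwise_iso_edge (@hom_quasicat K _ _) (@hom_exponentiable K X A) hp.
    have [f fs] := power_hom_surj hc s.
    exists (df 0 f), f; split=> //; apply: (power_hom_inj hc).
      by rewrite smap_df fs s2.
    by rewrite smap_df fs s1 smap_cst smap_esrc.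
- by move=> [j u]; apply: hx.
Qed.

End LimitIso.

(** * Strict ralis *)

Lemma df_comp (C : scat) (A B E : C) n i (g : hom B E n.+1) (f : hom A B n.+1) :
  df i (comp g f) = comp (df i g) (df i f).
Proof. exact: comp_nat. Qed.

Lemma post_comp_hom (C : scat) (X A B E : C) n (p : arr B E)
    (g : hom A B n) (f : hom X A n) :
  post X p n (comp g f) = comp (post A p n g) f.
Proof. exact: comp_assoc. Qed.

Section Naturality.
Variables (C : scat) (X E E' : C) (al : hom E E' 1) (e : hom X E 1).

(** The halves of the naturality square of the 2-cell [al] at [e], which share the diagonal
    [comp al e]. *)
Definition lower_triangle : hom X E' 2 := comp (sg 1 al) (sg 0 e).
Definition upper_triangle : hom X E' 2 := comp (sg 0 al) (sg 1 e).

Lemma lower_triangleP :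
  [/\ df 2 lower_triangle = pre E' (esrc e) 1 al,
      df 0 lower_triangle = post X (etgt al) 1 e &
      df 1 lower_triangle = comp al e].
Proof.
rewrite /lower_triangle !df_comp !df_sgS // !df_sg //.
rewrite (@df_sg_gt _ 0 1 0) // (@df_sg_lt _ 0 0 0) //.
by rewrite esrcE etgtE /= !cst1E.
Qed.

Lemma upper_triangleP :
  [/\ df 2 upper_triangle = post X (esrc al) 1 e,
      df 0 upper_triangle = pre E' (etgt e) 1 al &
      df 1 upper_triangle = comp al e].
Proof.
rewrite /upper_triangle !df_comp !df_sgS // !df_sg //.
rewrite (@df_sg_gt _ 0 1 0) // (@df_sg_lt _ 0 0 0) //.
by rewrite esrcE etgtE /= !cst1E.
Qed.

Lemma lower_tri :
  tri (pre E' (esrc e) 1 al) (post X (etgt al) 1 e) (comp al e).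
Proof. by exists lower_triangle; apply: lower_triangleP. Qed.

Lemma upper_tri :
  tri (post X (esrc al) 1 e) (pre E' (etgt e) 1 al) (comp al e).
Proof. by exists upper_triangle; apply: upper_triangleP. Qed.

End Naturality.

(* The triangle identities are automatic: by naturality of eps against itself,
   the invertible edge eps l is idempotent. *)
Record strict_rali (C : scat) (E B : C) (p : arr E B) (l : arr B E)
    (eps : hom E E 1) : Prop := StrictRali {
  strict_section : comp p l = idv B;
  strict_src : esrc eps = comp l p;
  strict_tgt : etgt eps = idv E;
  strict_over : post E p 1 eps = cst 1 p;
  strict_iso : iso_edge (pre E l 1 eps) }.

Definition eps_iso (C : scat) (X E : C) (eps : hom E E 1) (x : arr X E) : Prop :=
  iso_edge (pre E x 1 eps).

Lemma eps_iso_pre (C : scat) (X Y E : C) (eps : hom E E 1) (x : arr X E)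
    (f : arr Y X) : eps_iso eps x -> eps_iso eps (comp x f).
Proof. by rewrite /eps_iso -pre_comp; apply: iso_edge_map. Qed.

Section StrictRali.
Variables (K : cosmos) (E B : K) (p : arr E B) (l : arr B E) (eps : hom E E 1).
Hypotheses (hp : isofib p) (hl : strict_rali p l eps).

Section Over.
Variables (X : K) (beta : arr X B).
Notation Z := (fib (post X p) beta).
Notation incl := (fib_incl (post X p) beta).
Let qZ : quasicat Z := @fib_quasicat _ _ _ beta (@post_inner K X _ _ _ hp).
Let iP := @post_inner K X _ _ _ hp.
Let qX : quasicat (hom X E) := @hom_quasicat K X E.
Let qB : quasicat (hom X B) := @hom_quasicat K X B.

Lemma eps_src (x : arr X E) : comp p x = beta -> esrc (pre E x 1 eps) = comp l beta.
Proof. by move=> <-; rewrite smap_esrc (strict_src hl) pre0 comp_assoc. Qed.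

Lemma eps_tgt (x : arr X E) : etgt (pre E x 1 eps) = x.
Proof. by rewrite smap_etgt (strict_tgt hl) pre0 comp_id0l. Qed.

Lemma eps_over (x : arr X E) : comp p x = beta ->
  post X p 1 (pre E x 1 eps) = cst 1 beta.
Proof. by move=> <-; rewrite post_pre (strict_over hl) smap_cst pre0. Qed.

Lemma over_src (e : hom X E 1) : post X p 1 e = cst 1 beta -> comp p (esrc e) = beta.
Proof. by move=> h; rewrite -post0 -smap_esrc h esrc_cst. Qed.

Lemma over_tgt (e : hom X E 1) : post X p 1 e = cst 1 beta -> comp p (etgt e) = beta.
Proof. by move=> h; rewrite -post0 -smap_etgt h etgt_cst. Qed.

(** In the naturality square of [eps] at [e] the side [l p e] is degenerate, because [e] lies over a
    constant, so a triangle remains. It lies in the fibre because [eps] lies strictly over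
    [cst 1 p]. *)
Lemma eps_natural (e ex ey : Z 1) :
  incl 1 ex = pre E (esrc (incl 1 e)) 1 eps ->
  incl 1 ey = pre E (etgt (incl 1 e)) 1 eps -> tri ex e ey.
Proof.
move=> hx hy; set e0 := incl 1 e in hx hy.
have he : post X p 1 e0 = cst 1 beta := proj2_sig e.
have [t2 t0 t1] := lower_triangleP eps e0.
have [u2 u0 u1] := upper_triangleP eps e0.
have ot : post X p 2 (lower_triangle eps e0) = cst 2 beta.
  rewrite /lower_triangle post_comp_hom smap_sg (strict_over hl) sg_cst.
  by rewrite -[LHS]/(post X p 2 _) smap_sg he sg_cst.
have ou : post X p 2 (upper_triangle eps e0) = cst 2 beta.
  rewrite /upper_triangle post_comp_hom smap_sg (strict_over hl) sg_cst.
  by rewrite -[LHS]/(post X p 2 _) smap_sg he sg_cst.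
have oD : post X p 1 (comp eps e0) = cst 1 beta by rewrite -t1 smap_df ot df_cst.
have [D hD] := fib_lift oD.
have tD : tri ex e D.
  apply: (fib_tri ot); rewrite ?t2 ?t0 ?t1 ?hx ?hD //.
  by rewrite (strict_tgt hl) post_id.
have oc : post X p 1 (cst 1 (comp l beta) : hom X E 1) = cst 1 beta.
  by rewrite smap_cst post0 comp_assoc (strict_section hl) comp_id0l.
have [c hc] := fib_lift oc.
have tD' : tri c ey D.
  apply: (fib_tri ou); rewrite ?u2 ?u0 ?u1 ?hy ?hD ?hc //.
  by rewrite (strict_src hl) -post_comp he smap_cst post0.
have cE : c = cst 1 (esrc ey).
  apply: fib_eq; rewrite hc smap_cst -smap_esrc hy eps_src //.
  exact: over_tgt he.
have h : sim D ey by apply: sim_sym => //; apply/sim_left => //; rewrite -cE.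
exact: (tri_sim qZ (sim_refl _) (sim_refl _) h tD).
Qed.

Lemma fib_eps (x : arr X E) : comp p x = beta ->
  exists ex : Z 1, incl 1 ex = pre E x 1 eps.
Proof. by move=> /eps_over /fib_lift. Qed.

Lemma eps_tri (e : hom X E 1) : post X p 1 e = cst 1 beta ->
  tri (pre E (esrc e) 1 eps) e (pre E (etgt e) 1 eps).
Proof.
move=> he; have [ex hx] := fib_eps (over_src he); have [ey hy] := fib_eps (over_tgt he).
have [u hu] := fib_lift he.
rewrite -hx -hy -hu; apply: tri_map.
by apply: eps_natural; rewrite hu.
Qed.

Lemma eps_iso_edge (e : hom X E 1) : post X p 1 e = cst 1 beta ->
  eps_iso eps (esrc e) -> eps_iso eps (etgt e) -> iso_edge e.
Proof. by move=> /eps_tri h hx hy; apply: iso_tril h hx hy. Qed.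

Lemma eps_iso_tgt (e : hom X E 1) : post X p 1 e = cst 1 beta ->
  iso_edge e -> eps_iso eps (esrc e) -> eps_iso eps (etgt e).
Proof. by move=> /eps_tri h he hx; apply: iso_tri h hx he. Qed.

(** Uniqueness half of initiality: both edges, preceded by the invertible counit at the source,
    compose to the counit at the target. *)
Lemma over_uniq (e e' : Z 1) : eps_iso eps (incl 0 (esrc e)) ->
  esrc e = esrc e' -> etgt e = etgt e' -> sim e e'.
Proof.
move=> hm hs ht; have he : post X p 1 (incl 1 e) = cst 1 beta := proj2_sig e.
have [ex hx] := fib_eps (over_src he); have [ey hy] := fib_eps (over_tgt he).
have ix : iso_edge ex.
  by apply: (fib_iso_edge iP qB); rewrite hx smap_esrc.
apply: (tri_cancel qZ ix); first exact: eps_natural hx hy.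
by apply: eps_natural; rewrite ?hx ?hy ?smap_esrc ?smap_etgt ?hs ?ht.
Qed.

(** Existence half of initiality: the inverse of the counit at [m] followed by the counit at [y],
    composed in the fibre. *)
Lemma over_edge (m y : arr X E) : comp p m = beta -> comp p y = beta ->
  eps_iso eps m -> exists e : hom X E 1,
    [/\ esrc e = m, etgt e = y & post X p 1 e = cst 1 beta].
Proof.
move=> hm hy im; have [em hem] := fib_eps hm; have [ey hey] := fib_eps hy.
have [|g [g1 g2]] := fib_iso_edge iP qB (e := em); first by rewrite hem.
have [e1 _ e3] := tri_ends g1; have [e4 _ e6] := tri_ends g2.
rewrite etgt_cst in e3; rewrite etgt_cst in e6.
have [|w hw] := @tri_ex _ qZ g ey.
  apply: fib_eq; rewrite -e3 -!smap_esrc hem hey.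
  by rewrite !eps_src.
have [_ s1 s2] := tri_ends hw.
exists (incl 1 w); split; last exact: (proj2_sig w).
  by rewrite smap_esrc s1 -e1 -smap_etgt hem eps_tgt.
by rewrite smap_etgt s2 -smap_etgt hey eps_tgt.
Qed.

End Over.

Lemma strict_hadjunction : hadjunction p l [::] [:: eps].
Proof.
have hs := strict_section hl; split=> //=.
- by rewrite (strict_src hl) (strict_tgt hl).
- have ol : post B p 1 (pre E l 1 eps) = cst 1 (idv B) by apply: eps_over.
  have := eps_tri ol; rewrite (eps_src hs) (eps_tgt l) comp_id0r => h.
  have qE : quasicat (hom B E) := @hom_quasicat K B E.
  have := tri_cancel qE (strict_iso hl) h (tri_cstr _); rewrite eps_tgt => k.
  apply: heq_trans (heq_cst _); apply/heq_sim => //; split=> //.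
    by rewrite (eps_src hs) comp_id0r.
  exact: eps_tgt.
- by have := strict_over hl; rewrite /= => ->; apply: heq_cst.
Qed.

Lemma strict_is_rali : is_rali p.
Proof.
exists l, [::], [:: eps]; split; first exact: strict_hadjunction.
split; first by rewrite (strict_section hl).
by exists [::]; rewrite /= (strict_section hl); split=> //; apply: heq_refl.
Qed.

End StrictRali.

(** * Strictification of rali-isofibrations *)

Section Strictify.
Variables (K : cosmos) (E B : K) (p : arr E B).
Hypothesis hp : isofib p.
Let qh (X Y : K) : quasicat (hom X Y) := @hom_quasicat K X Y.

(** Lifting the inverse of the unit along [p] moves [l0] to an isomorphic strict section. The
    transported counit lies over the identity up to a homotopy, by a triangle identity, and lifting
    that homotopy corrects it. *)
Theorem rali_strict : is_rali p -> exists l eps, strict_rali p l eps.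
Proof.
case=> l0 [eta [epsw [[_ cw tl tr] ieta]]].
have [h [hs ht hh]] := heq_edge (@qh _ _) ieta.1.
have {ieta} ih : iso_edge h.
  by have /hiso_iso_edge [] // := hiso_heq hh ieta.
have [g ig] := ih; have [g1 g2] := ig.
have [gs _ gt] := tri_ends g1; rewrite etgt_cst hs in gt.
have [eps0 [es et he]] := heq_edge (@qh _ _) cw.
have igw : hiso (esrc g) (etgt g) [:: g].
  by apply/(iso_edgeP (@qh _ _)); exists h.
(* [g] runs from [p l0] to the identity, so the target [l] of its lift [e'] satisfies [p l = id]. *)
have [|e' [e1 e2 /(iso_edgeP (@qh _ _))]] := (isof_hom (cosmosP K) B hp).2 l0 g _ igw.
  by rewrite post0 -gs.
case=> k ik; have [k1 k2] := ik.
have [ks _ kt] := tri_ends k1; rewrite etgt_cst e1 in kt.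
set l := etgt e' in ks.
have pl : comp p l = idv B by rewrite -post0 -smap_etgt e2 gt.
have ke : esrc k = l by rewrite -ks.
have pk : sim (post B p 1 k) h.
  have := tri_map (post B p) k1; rewrite e2 e1 smap_cst post0 => m1.
  apply: (tri_cancel (@qh _ _) (a := g)) m1 _; first by exists h.
  by rewrite -ht gs.
(* [eps1] is the composite [l p => l0 p => id], the old counit transported along [k]. *)
have [|eps1 heps1] := @tri_ex _ (@qh _ _) (pre E p 1 k) eps0.
  by rewrite smap_etgt -kt pre0 es.
have [_ s1 t1] := tri_ends heps1.
have pe1 : sim (post E p 1 eps1) (cst 1 p).
  have t := tri_map (post E p) heps1; rewrite post_pre in t.
  have pk' : sim (pre B p 1 (post B p 1 k)) (pre B p 1 h).
    by have := tri_map (pre B p) pk; rewrite smap_cst -smap_etgt.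
  have {}t := tri_sim (@qh _ _) pk' (sim_refl _) (sim_refl _) t.
  have := heq_tri_edge t.
  rewrite smap_esrc hs pre0 comp_id0l smap_etgt et post0 comp_id0r => w1.
  apply: (heq_nil_edge (@qh _ _)); apply: heq_trans (heq_sym w1) _.
  apply: heq_trans _ tr.
  have m1 := heq_map (pre B p) hh; rewrite !pre0 comp_id0l in m1.
  have m2 := heq_map (post E p) he; rewrite !post0 comp_id0r comp_assoc in m2.
  exact: heq_cat (heq_sym m1) (heq_sym m2).
have [y [y2 y0 y1]] := pe1.
(* The homotopy [y] from the image of [eps1] to [cst 1 p] is lifted with source [eps1]; its target
   [eps] lies over [cst 1 p] exactly. *)
have [|||z [Fz z2 z0]] := fill21 (@post_inner K E _ _ _ hp)
  (a := eps1) (b := cst 1 (idv E)) (y := y).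
- by rewrite -etgtE t1 et df_cst cst0.
- by [].
- by rewrite y0 smap_cst smap_etgt t1 et.
pose eps := df 1 z.
have s11 : sim eps1 eps by exists z; rewrite z2 z0 t1 et.
have [seps teps] := sim_ends s11.
exists l, eps; split=> //.
- by rewrite -seps s1 smap_esrc pre0 ke.
- by rewrite -teps t1 et.
- by rewrite smap_df Fz y1.
have s2 : sim (pre E l 1 eps1) (pre E l 1 eps).
  by have := tri_map (pre E l) s11; rewrite smap_cst -smap_etgt.
apply: (iso_sim (@qh _ _) s2).
have ik' : iso_edge k by exists e'; apply: inverse_edge_sym.
have ie' : iso_edge e' by exists k.
have tk := tri_map (pre E l) heps1; rewrite pre_comp pl pre_id in tk.
apply: (iso_tri (@qh _ _) tk ik').
have i0 : iso_edge (pre E l0 1 eps0).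
  have ihl : iso_edge (post B l0 1 h) by apply: iso_edge_map.
  have [|c hc] := @tri_ex _ (@qh _ _) (post B l0 1 h) (pre E l0 1 eps0).
    by rewrite smap_etgt smap_esrc ht es post0 pre0 comp_assoc.
  apply: (iso_tril (@qh _ _) hc ihl).
  have := heq_tri_edge hc.
  rewrite smap_esrc hs post0 comp_id0r smap_etgt et pre0 comp_id0l => w1.
  suff w2 : heq l0 l0 [:: post B l0 1 h; pre E l0 1 eps0] [::].
    have := heq_nil_edge (@qh _ _) (heq_trans (heq_sym w1) w2) => /(sim_sym (@qh _ _)) w3.
    exact: (iso_sim (@qh _ _) w3 (iso_edge_cst _)).
  apply: heq_trans _ tl.
  have m1 := heq_map (post B l0) hh; rewrite !post0 comp_id0r comp_assoc in m1.
  have m2 := heq_map (pre E l0) he; rewrite !pre0 comp_id0l in m2.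
  exact: heq_cat (heq_sym m1) (heq_sym m2).
(* Naturality of [eps0] at [e'] carries invertibility from [eps0 l0] to [eps0 l]. *)
have n1 := lower_tri eps0 e'; have n2 := upper_tri eps0 e'.
rewrite e1 et post_id in n1; rewrite es in n2.
apply: (iso_tril (@qh _ _) n2); first exact: iso_edge_map.
exact: (iso_tri (@qh _ _) n1).
Qed.

End Strictify.

(** * Morphisms of ralis tested on strict data *)

Section RaliMorphism.
Variables (K : cosmos) (p q : isof_scat K) (f : arr p q).
Variables (lp : arr (base p) (tot p)) (epsp : hom (tot p) (tot p) 1).
Variables (lq : arr (base q) (tot q)) (epsq : hom (tot q) (tot q) 1).
Hypotheses (hp : strict_rali (isof_arr p) lp epsp) (hq : strict_rali (isof_arr q) lq epsq).

Let ap := strict_hadjunction (isof_arrP p) hp.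
Let aq := strict_hadjunction (isof_arrP q) hq.

(** [is_rali_mor] quantifies over all adjunction data. Pasting on both sides with mates of identity
    squares, which are invertible, reduces it to the strict data, where the unit is the empty string
    and the mate a single edge. *)
Theorem rali_morP : is_rali_mor f <-> eps_iso epsq (comp (mor_tot f) lp).
Proof.
have sq := mor_sq f.
have mE : mate (isof_arr q) (mor_tot f) (mor_base f) lp lq [::] [:: epsq] =
    [:: pre (tot q) (comp (mor_tot f) lp) 1 epsq] by [].
split=> [h|h l1 eta1 eps1 l2 eta2 eps2 a1 a2].
  have := h _ _ _ _ _ _ ap aq; rewrite mE.
  by case/(hiso_iso_edge (@hom_quasicat K _ _)).
have m0 : hiso (comp lq (mor_base f)) (comp (mor_tot f) lp)
    (mate (isof_arr q) (mor_tot f) (mor_base f) lp lq [::] [:: epsq]).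
  rewrite mE; apply/(hiso_iso_edge (@hom_quasicat K _ _)); split=> //.
    rewrite smap_esrc (strict_src hq) pre0 -!comp_assoc [comp (isof_arr q) _]comp_assoc sq.
    by rewrite -comp_assoc (strict_section hp) comp_id0r.
  by rewrite smap_etgt (strict_tgt hq) pre0 comp_id0l.
have sqi : comp (isof_arr q) (idv _) = comp (idv _) (isof_arr q).
  by rewrite comp_id0l comp_id0r.
have spi : comp (isof_arr p) (idv _) = comp (idv _) (isof_arr p).
  by rewrite comp_id0l comp_id0r.
have m1 := mate_comp_iso sq sqi ap aq a2 m0 (mate_id_iso aq a2).
rewrite !comp_id0l in m1.
have m2 := mate_comp_iso spi sq a1 ap a2 (mate_id_iso a1 ap) m1.
by rewrite !comp_id0r in m2.
Qed.

End RaliMorphism.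

(** * Lifting initial 0-arrows and edges out of them *)

Section RelativeLifting.
Variables (K : cosmos) (E1 B1 E0 B0 : K) (p1 : arr E1 B1) (p0 : arr E0 B0).
Variables (e : arr E1 E0) (b : arr B1 B0).
Variables (l1 : arr B1 E1) (eps1 : hom E1 E1 1) (l0 : arr B0 E0) (eps0 : hom E0 E0 1).
Hypotheses (hp1 : isofib p1) (hp0 : isofib p0).
Hypothesis sq : comp p0 e = comp b p1.
Hypothesis rel : forall (P : cone spoint (cospan_diagram p0 b)) (g : arr E1 (apex P)),
  is_limit P -> comp (proj P (Some true) tt) g = e ->
  comp (proj P (Some false) tt) g = p1 -> isofib g.
Hypotheses (h1 : strict_rali p1 l1 eps1) (h0 : strict_rali p0 l0 eps0).
Hypothesis mor : eps_iso eps0 (comp e l1).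
Let qh (X Y : K) : quasicat (hom X Y) := @hom_quasicat K X Y.

(** [e] carries the invertible counit at [m] to an invertible edge in a fibre of [p0]. Its source
    [e l1 p1 m] is initial by [mor], and initiality passes along it. *)
Lemma eps_iso_mor (X : K) (m : arr X E1) : eps_iso eps1 m -> eps_iso eps0 (comp e m).
Proof.
move=> im; have mo := eps_over h1 (erefl (comp p1 m)).
have eo : post X p0 1 (post X e 1 (pre E1 m 1 eps1)) = cst 1 (comp b (comp p1 m)).
  by rewrite post_comp sq -post_comp mo smap_cst post0.
have := eps_iso_tgt hp0 h0 eo (iso_edge_map (post X e) im).
rewrite smap_etgt (eps_tgt h1) post0; apply.
rewrite smap_esrc (eps_src h1 (erefl _)) post0 comp_assoc.
exact: eps_iso_pre.
Qed.

Let rel_pullback : exists (P : cone spoint (cospan_diagram p0 b)) (k : arr E1 (apex P)),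
  [/\ is_limit P, isofib k, comp (proj P (Some true) tt) k = e &
      comp (proj P (Some false) tt) k = p1].
Proof.
have [P hP] := cosmos_lim (cosmosP K) (@cosm_pullback _ _ (cospan_diagram p0 b) hp0).
have [k [k1 k2]] := pullback_arr hP (a := e) (b := p1) sq.
by exists P, k; split=> //; apply: (rel hP).
Qed.

(** Both [m0] and [e l1 beta] are initial over [b beta], so an invertible edge joins them. Paired
    with the constant edge on [beta] it lies in the pullback [P]; its lift from [l1 beta] along
    [E1 -> P] has the desired target. *)
Lemma lift_vertex (X : K) (m0 : arr X E0) (beta : arr X B1) :
  comp p0 m0 = comp b beta -> eps_iso eps0 m0 ->
  exists m1 : arr X E1,
    [/\ comp e m1 = m0, comp p1 m1 = beta & eps_iso eps1 m1].
Proof.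
move=> m0o im0; have [P [k [hP ik kt kf]]] := rel_pullback.
pose x := comp e (comp l1 beta).
have xo : comp p0 x = comp b beta.
  rewrite /x comp_assoc sq -comp_assoc [comp p1 _]comp_assoc.
  by rewrite (strict_section h1) comp_id0l.
have ix : eps_iso eps0 x by rewrite /x comp_assoc; apply: eps_iso_pre.
have [w [ws wt wo]] := over_edge hp0 h0 xo m0o ix.
have iw : iso_edge w by apply: (eps_iso_edge hp0 h0 wo); rewrite ?ws ?wt.
have [|om [omt omf]] := pullback_ex hP (x := w) (y := cst 1 beta).
  by rewrite [LHS]wo smap_cst post0.
have iom : iso_edge om.
  apply: (limit_iso_edge (@cosm_pullback _ _ (cospan_diagram p0 b) hp0) hP) => j [].
  case: j => [[]|]; first by rewrite omt.
    by rewrite omf; apply: iso_edge_cst.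
  have <- := conical_proj P true.
  by rewrite -post_comp; apply: iso_edge_map; rewrite omt.
have [||al [as_ ao /(iso_edgeP (@qh _ _)) ia]] :=
  (isof_hom (cosmosP K) X ik).2 (comp l1 beta) om.
- rewrite post0; apply: (pullback_ext hP).
    by rewrite -smap_esrc omt ws post0 comp_assoc kt.
  rewrite -smap_esrc omf esrc_cst post0 comp_assoc kf comp_assoc.
  by rewrite (strict_section h1) comp_id0l.
- exact/(iso_edgeP (@qh _ _)).
have ae : post X e 1 al = w by rewrite -kt -post_comp ao.
have ap : post X p1 1 al = cst 1 beta by rewrite -kf -post_comp ao.
exists (etgt al); split.
- by rewrite -post0 -smap_etgt ae.
- exact: over_tgt ap.
- apply: (eps_iso_tgt hp1 h1 ap ia); rewrite as_; apply: eps_iso_pre.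
  exact: strict_iso h1.
Qed.

(** An edge [w] in the fibre from [m1] to [y1] has an image homotopic to [g0], by initiality. This
    homotopy is a 2-simplex of the pullback, and lifting it along [E1 -> P] replaces [w] by an edge
    over [g0] exactly. *)
Lemma lift_edge (X : K) (m1 y1 : arr X E1) (g0 : hom X E0 1) :
  comp p1 m1 = comp p1 y1 -> eps_iso eps1 m1 ->
  esrc g0 = comp e m1 -> etgt g0 = comp e y1 ->
  post X p0 1 g0 = cst 1 (comp b (comp p1 y1)) ->
  exists g1 : hom X E1 1,
    [/\ esrc g1 = m1, etgt g1 = y1, post X e 1 g1 = g0 &
        post X p1 1 g1 = cst 1 (comp p1 y1)].
Proof.
move=> my im gs gt go; have [P [k [hP ik kt kf]]] := rel_pullback.
have [w [ws wt wo]] := over_edge hp1 h1 my erefl im.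
have weo : post X p0 1 (post X e 1 w) = cst 1 (comp b (comp p1 y1)).
  by rewrite post_comp sq -post_comp wo smap_cst post0.
have [u hu] := fib_lift weo; have [v hv] := fib_lift go.
have uv : sim u v.
  apply: (over_uniq hp0 h0).
  - by rewrite -smap_esrc hu smap_esrc ws post0; apply: eps_iso_mor.
  - by apply: fib_eq; rewrite -!smap_esrc hu hv smap_esrc ws gs post0.
  - by apply: fib_eq; rewrite -!smap_etgt hu hv smap_etgt wt gt post0.
have [s0 [s2 s00 s1]] := uv.
pose s := fib_incl (post X p0) (comp b (comp p1 y1)) 2 s0.
have so : post X p0 2 s = cst 2 (comp b (comp p1 y1)) := proj2_sig s0.
have [|om [omt omf]] := pullback_ex hP (x := s) (y := cst 2 (comp p1 y1)).
  by rewrite [LHS]so smap_cst post0.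
have [|||z [Fz z2 z0]] := fill21 (@post_inner K X _ _ _ ik) (a := w) (b := cst 1 y1) (y := om).
- by rewrite -etgtE wt df_cst cst0.
- apply: (pullback_ext hP).
    by rewrite post_comp kt smap_df omt /s -smap_df s2 hu.
  by rewrite post_comp kf wo smap_df omf df_cst.
- apply: (pullback_ext hP).
    transitivity (cst 1 (comp e y1)); first by rewrite post_comp kt smap_cst post0.
    by rewrite smap_df omt /s -smap_df s00 smap_cst -smap_etgt hu smap_etgt wt post0.
  by rewrite post_comp kf smap_cst post0 smap_df omf df_cst.
exists (df 1 z); have [_ zs zt] := tri_ends (ex_intro _ z (And3 z2 z0 erefl)).
split.
- by rewrite zs ws.
- by rewrite zt etgt_cst.
- by rewrite -kt -post_comp smap_df Fz smap_df omt /s -smap_df s1 hv.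
- by rewrite -[in LHS]kf -post_comp smap_df Fz smap_df omf df_cst.
Qed.

End RelativeLifting.

(** * Limits of isofibrations *)

Section PointwiseDiagrams.
Variables (K : cosmos) (Q : graph) (D : diagram Q (isof_scat K)).

Definition tot_diagram : diagram Q K :=
  @Diagram Q K (fun j => tot (dob D j)) (fun a => mor_tot (darr D a)).

Definition base_diagram : diagram Q K :=
  @Diagram Q K (fun j => base (dob D j)) (fun a => mor_base (darr D a)).

End PointwiseDiagrams.

(* A discrete diagram differs from a family only by its empty function on
   links, but not definitionally. *)
Section Recast.
Variables (C : scat) (U : sset) (I : small) (A : I -> C).
Variable d : forall a : link (discrete I), arr (A (dom a)) (A (cod a)).
Notation D := (@Diagram (discrete I) C A d).

Lemma discrete_diagram_eq : D = family A.
Proof. by congr Diagram; apply: functional_extensionality_dep => -[]. Qed.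

Definition recast_cone (c : cone U D) : cone U (family A) :=
  @Cone U _ _ (family A) (apex c) (fun j => leg c j) (fun a : void => match a with end).

Lemma recast_limit (c : cone U D) : is_limit c -> is_limit (recast_cone c).
Proof. by move=> hc X n phi _; apply: hc; case. Qed.

End Recast.

Lemma tot_cosmological (K : cosmos) U Q (D : diagram Q (isof_scat K)) :
  cosmological (@isof_isofib K) U D -> cosmological (@isofib K) U (tot_diagram D).
Proof.
case=> [I D'|D' h|D' h|V A].
- exact: cosm_product.
- by apply: cosm_pullback; case: h.
- by apply: cosm_tower => n; case: (h n).
- by rewrite /tot_diagram discrete_diagram_eq; apply: cosm_power.
Qed.

Lemma base_cosmological (K : cosmos) U Q (D : diagram Q (isof_scat K)) :
  cosmological (@isof_isofib K) U D -> cosmological (@isofib K) U (base_diagram D).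
Proof.
case=> [I D'|D' h|D' h|V A].
- exact: cosm_product.
- by apply: cosm_pullback; case: h.
- by apply: cosm_tower => n; case: (h n).
- by rewrite /base_diagram discrete_diagram_eq; apply: cosm_power.
Qed.

Section RelativePullback.
Variables (K : cosmos) (E1 B1 E0 B0 : K) (p1 : arr E1 B1) (p0 : arr E0 B0).
Variables (e : arr E1 E0) (b : arr B1 B0).
Hypothesis hp0 : isofib p0.
Hypothesis sq : comp p0 e = comp b p1.
Hypothesis rel : forall (P : cone spoint (cospan_diagram p0 b)) (g : arr E1 (apex P)),
  is_limit P -> comp (proj P (Some true) tt) g = e ->
  comp (proj P (Some false) tt) g = p1 -> isofib g.

(** The universal property makes [N'] the pullback of the comparison [E1 -> P] along [N -> P], so
    [t] is a pulled back isofibration. *)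
Lemma relative_pullback_isofib (N N' : K) (a : arr N E0) (beta : arr N B1)
    (s : arr N' E1) (t : arr N' N) :
  comp p0 a = comp b beta -> comp e s = comp a t -> comp p1 s = comp beta t ->
  (forall X n (x : hom X E1 n) (y : hom X N n),
    post X e n x = post X a n y -> post X p1 n x = post X beta n y ->
    exists! z : hom X N' n, post X s n z = x /\ post X t n z = y) ->
  isofib t.
Proof.
move=> ha hes hps univ.
have [P hP] := cosmos_lim (cosmosP K) (@cosm_pullback _ _ (cospan_diagram p0 b) hp0).
have [k [k1 k2]] := pullback_arr hP (a := e) (b := p1) sq.
have [h [h1 h2]] := pullback_arr hP (a := a) (b := beta) ha.
have ik := rel hP k1 k2.
have hst : comp k s = comp h t.
  rewrite -!post0; apply: (pullback_ext hP);
    by rewrite !post_comp !post0 ?k1 ?k2 ?h1 ?h2 ?hes ?hps.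
pose c := @pullback_cone _ (cospan_diagram k h) _ s t hst.
have hc : is_limit c.
  apply: pullback_coneP => X n x y hxy; apply: univ.
    by rewrite -k1 -h1 -!post_comp; congr (post _ _ _ _).
  by rewrite -k2 -h2 -!post_comp; congr (post _ _ _ _).
have := isof_pullback (cosmosP K) (D := cospan_diagram k h) ik hc.
by rewrite proj_conical_cone.
Qed.

End RelativePullback.

Section LimitIsofibration.
Variables (K : cosmos) (U : sset) (Q : graph) (D : diagram Q (isof_scat K)).
Variables (cE : cone U (tot_diagram D)) (cB : cone U (base_diagram D)).
Hypotheses (hE : is_limit cE) (hB : is_limit cB).

Definition over_cones (p : arr (apex cE) (apex cB)) : Prop :=
  forall j m (u : U m), comp (leg cB j m u) (cst m p) =
    comp (cst m (isof_arr (dob D j))) (leg cE j m u).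

Lemma over_cones_ex : exists p, over_cones p.
Proof.
have hnat j k m (s : mono k m) (u : U m) :
    comp (cst k (isof_arr (dob D j))) (leg cE j k (act s u)) =
    act s (comp (cst m (isof_arr (dob D j))) (leg cE j m u)).
  by rewrite smap_nat comp_nat act_cst.
have [|p hp] := limit_arr hB (psi := fun j => SMap (hnat j)); last by exists p.
move=> a m u /=; rewrite comp_assoc -cst_comp -[comp (mor_base _) _]mor_sq.
by rewrite cst_comp -comp_assoc -[comp _ (leg cE (dom a) m u)]/(comp (cst m (darr (tot_diagram D) a)) (leg cE (dom a) m u)) leg_nat.
Qed.

Lemma over_cones_proj p : over_cones p -> forall j u,
  comp (proj cB j u) p = comp (isof_arr (dob D j)) (proj cE j u).
Proof. by move=> h j u; have := h j 0 u; rewrite !cst0. Qed.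

End LimitIsofibration.

Section PullbackIsofibration.
Variables (K : cosmos) (D : diagram cospan (isof_scat K)).
Hypothesis hD : isof_isofib (darr D true).
Variables (cE : cone spoint (tot_diagram D)) (cB : cone spoint (base_diagram D)).
Hypotheses (hE : is_limit cE) (hB : is_limit cB).
Variable p : arr (apex cE) (apex cB).
Hypothesis hp : over_cones p.

(** [p] factors through the base change [N] of the isofibration at the free corner. The second
    factor is an isofibration as a base change, the first as a pullback of the relative comparison
    at the link [true]. *)
Lemma pullback_isofibration : isofib p.
Proof.
pose pT := isof_arr (dob D (Some true)); pose pF := isof_arr (dob D (Some false)).
pose pN := isof_arr (dob D None).
pose bT := proj cB (Some true) tt; pose bF := proj cB (Some false) tt.
pose eT := proj cE (Some true) tt; pose eF := proj cE (Some false) tt.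
pose dT := mor_base (darr D true); pose dF := mor_base (darr D false).
pose uT := mor_tot (darr D true); pose uF := mor_tot (darr D false).
have sT : comp pN uT = comp dT pT := mor_sq (darr D true).
have sF : comp pN uF = comp dF pF := mor_sq (darr D false).
have iF : isofib pF := isof_arrP _.
have [N hN] := cosmos_lim (cosmosP K) (@cosm_pullback _ _ (cospan_diagram pF bF) iF).
pose nu := proj N (Some true) tt; pose nB := proj N (Some false) tt.
have nuB : comp pF nu = comp bF nB.
  exact: etrans (conical_proj N true) (esym (conical_proj N false)).
have inB : isofib nB by apply: (isof_pullback (cosmosP K) (D := cospan_diagram pF bF) iF hN).
have bTF : comp dT bT = comp dF bF.
  exact: etrans (conical_proj cB true) (esym (conical_proj cB false)).
have eTF : comp uT eT = comp uF eF.
  exact: etrans (conical_proj cE true) (esym (conical_proj cE false)).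
have pT' : comp bT p = comp pT eT := over_cones_proj hp (Some true) tt.
have pF' : comp bF p = comp pF eF := over_cones_proj hp (Some false) tt.
have [t [t1 t2]] := pullback_arr hN (a := eF) (b := p) (esym pF').
have {}t1 : comp nu t = eF := t1.
have {}t2 : comp nB t = p := t2.
suff it : isofib t by rewrite -t2; apply: (isof_comp (cosmosP K)).
have [_ _ rel] := hD.
apply: (relative_pullback_isofib (isof_arrP (dob D None)) sT rel
  (a := comp uF nu) (beta := comp bT nB) (s := eT)).
- by rewrite comp_assoc sF -comp_assoc nuB comp_assoc -bTF -comp_assoc.
- by rewrite eTF -comp_assoc t1.
- by rewrite -comp_assoc t2 pT'.
move=> X n x y h1 h2.
have [|z [zT zF]] := pullback_ex hE (x := x) (y := post X nu n y).
  by rewrite post_comp; apply: h1.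
have {}zT : post X eT n z = x := zT.
have {}zF : post X eF n z = post X nu n y := zF.
exists z; split; last first.
  move=> z' [z1 z2]; apply: (pullback_ext hE); first by rewrite [LHS]zT -z1.
  by rewrite [LHS]zF -z2 post_comp t1.
split=> //; apply: (pullback_ext hN).
  by rewrite -[RHS]zF [LHS]post_comp t1.
rewrite [LHS]post_comp t2; apply: (pullback_ext hB).
  by rewrite [LHS]post_comp pT' -post_comp zT [RHS]post_comp h2.
by rewrite [LHS]post_comp pF' -post_comp zF [RHS]post_comp -nuB post_comp.
Qed.

End PullbackIsofibration.

Section TowerIsofibration.
Variables (K : cosmos) (D : diagram tower (isof_scat K)).
Hypothesis hD : forall n : nat, isof_isofib (darr D n).
Variables (cE : cone spoint (tot_diagram D)) (cB : cone spoint (base_diagram D)).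
Hypotheses (hE : is_limit cE) (hB : is_limit cB).
Variable p : arr (apex cE) (apex cB).
Hypothesis hp : over_cones p.

(** [N n] is the base change of the [n]-th isofibration to the limit of the bases. By the relative
    comparisons these form a tower of isofibrations with limit [apex cE]; composing its last
    projection with [N 0 -> apex cB] gives [p]. *)
Lemma tower_isofibration : isofib p.
Proof.
pose q (n : nat) : arr _ _ := isof_arr (dob D n).
pose b (n : nat) : arr _ _ := proj cB n tt.
pose e (n : nat) : arr _ _ := proj cE n tt.
pose d (n : nat) : arr _ _ := mor_base (darr D n).
pose u (n : nat) : arr _ _ := mor_tot (darr D n).
have s n : comp (q n) (u n) = comp (d n) (q n.+1) := mor_sq (darr D n).
have bS n : comp (d n) (b n.+1) = b n := conical_proj cB n.
have eS n : comp (u n) (e n.+1) = e n := conical_proj cE n.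
have pe n : comp (b n) p = comp (q n) (e n) := over_cones_proj hp n tt.
have iq n : isofib (q n) := isof_arrP _.
have NP n := cid (cosmos_lim (cosmosP K) (@cosm_pullback _ _ (cospan_diagram (q n) (b n)) (iq n))).
pose N n := proj1_sig (NP n); have hN n : is_limit (N n) := proj2_sig (NP n).
pose nu n := proj (N n) (Some true) tt; pose nB n := proj (N n) (Some false) tt.
have nuB n : comp (q n) (nu n) = comp (b n) (nB n).
  exact: etrans (conical_proj (N n) true) (esym (conical_proj (N n) false)).
have inB : isofib (nB 0).
  exact: (isof_pullback (cosmosP K) (D := cospan_diagram (q 0) (b 0)) (iq 0) (hN 0)).
have tauP n : exists g : arr (apex (N n.+1)) (apex (N n)),
    comp (nu n) g = comp (u n) (nu n.+1) /\ comp (nB n) g = nB n.+1.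
  apply: (pullback_arr (hN n)).
  by rewrite /= comp_assoc s -comp_assoc nuB comp_assoc bS.
pose tau n := proj1_sig (cid (tauP n)).
have tau1 n : comp (nu n) (tau n) = comp (u n) (nu n.+1).
  by rewrite /tau; case: cid => ? [].
have tau2 n : comp (nB n) (tau n) = nB n.+1 by rewrite /tau; case: cid => ? [].
have itau n : isofib (tau n).
  have [_ _ rel] := hD n.
  apply: (relative_pullback_isofib (iq n) (s n) rel (a := nu n)
    (beta := comp (b n.+1) (nB n)) (s := nu n.+1)) => //.
  - by rewrite nuB comp_assoc bS.
  - by rewrite -comp_assoc tau2 nuB.
  move=> X k x y h1 h2.
  have [|z [z1 z2]] := pullback_ex (hN n.+1) (x := x) (y := post X (nB n) k y).
    by rewrite [LHS]h2 [RHS]post_comp.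
  have {}z1 : post X (nu n.+1) k z = x := z1.
  have {}z2 : post X (nB n.+1) k z = post X (nB n) k y := z2.
  exists z; split.
    split=> //; apply: (pullback_ext (hN n)).
      by rewrite [LHS]post_comp tau1 -post_comp z1.
    by rewrite [LHS]post_comp tau2.
  move=> z' [y1 y2]; apply: (pullback_ext (hN n.+1)); first by rewrite [LHS]z1 -y1.
  by rewrite [LHS]z2 -y2 post_comp tau2.
have tP n : exists g : arr (apex cE) (apex (N n)), comp (nu n) g = e n /\ comp (nB n) g = p.
  exact: (pullback_arr (hN n) (esym (pe n))).
pose t n := proj1_sig (cid (tP n)).
have t1 n : comp (nu n) (t n) = e n by rewrite /t; case: cid => ? [].
have t2 n : comp (nB n) (t n) = p by rewrite /t; case: cid => ? [].
have tS n : comp (tau n) (t n.+1) = t n.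
  rewrite -!post0; apply: (pullback_ext (hN n)); rewrite !post_comp !post0.
    by rewrite -/(nu n) tau1 t1 -comp_assoc t1 eS.
  by rewrite -/(nB n) tau2 !t2.
pose T : diagram tower K := @Diagram tower K (fun n => apex (N n)) tau.
pose c : cone spoint T := @conical_cone K tower T (apex cE) t tS.
have hc : is_limit c.
  apply/conical_limitP => X k y hy.
  have wE n : post X (nB n) k (y n) = post X (nB 0) k (y 0).
    by elim: n => // n IH; rewrite -tau2 -post_comp (hy n).
  have [n|z hz] := @conical_ex _ _ _ _ hE X k (fun n => post X (nu n) k (y n)).
    by rewrite [LHS]post_comp -tau1 -post_comp (hy n).
  have {}hz n : post X (e n) k z = post X (nu n) k (y n) := hz n.
  have pz : post X p k z = post X (nB 0) k (y 0).
    apply: (conical_ext hB) => n.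
    by rewrite [LHS]post_comp -/(b n) pe -post_comp hz post_comp nuB -post_comp wE.
  exists z; split=> [n|z' hz'].
    rewrite proj_conical_cone; apply: (pullback_ext (hN n)).
      by rewrite [LHS]post_comp t1 hz.
    by rewrite [LHS]post_comp t2 pz [RHS]wE.
  apply: (conical_ext hE) => n; rewrite [LHS]hz -(hz' n) proj_conical_cone.
  by rewrite post_comp t1.
have := isof_tower (cosmosP K) (D := T) itau hc; rewrite proj_conical_cone => it.
rewrite -(t2 0); exact: (isof_comp (cosmosP K)).
Qed.

End TowerIsofibration.

Theorem limit_isofibration (K : cosmos) (U : sset) (Q : graph)
    (D : diagram Q (isof_scat K))
    (cE : cone U (tot_diagram D)) (cB : cone U (base_diagram D))
    (p : arr (apex cE) (apex cB)) :
  cosmological (@isof_isofib K) U D -> is_limit cE -> is_limit cB ->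
  over_cones p -> isofib p.
Proof.
move=> hD; case: hD cE cB p => [I D' cE cB p hE hB hp|D' h|D' h|V A cE cB p hE hB hp].
- apply: (isof_product (cosmosP K) (recast_limit hE) (recast_limit hB)
    (f := fun i => isof_arr (dob D' i))) => i; first exact: isof_arrP.
  exact: over_cones_proj hp i tt.
- move=> cE cB p hE hB hp; exact: (pullback_isofibration h hE hB hp).
- move=> cE cB p hE hB hp; exact: (tower_isofibration h hE hB hp).
- apply: (power_isofib (isof_arrP A) (recast_limit hE) (recast_limit hB)) => n v.
  exact: (hp tt).
Qed.

(** * Limits of ralis *)

(* Invertibility of the counit on the section is left out, as it is detected by
   the projections of the limit. *)
Definition limit_section (K : cosmos) (U : sset) (Q : graph)
    (D : diagram Q (isof_scat K))
    (ep : forall j, hom (tot (dob D j)) (tot (dob D j)) 1)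
    (cE : cone U (tot_diagram D)) (cB : cone U (base_diagram D))
    (p : arr (apex cE) (apex cB)) : Prop :=
  exists (l : arr (apex cB) (apex cE)) (eps : hom (apex cE) (apex cE) 1),
    [/\ comp p l = idv _, esrc eps = comp l p, etgt eps = idv _,
        post _ p 1 eps = cst 1 p &
        forall j (u : U 0), eps_iso (ep j) (comp (proj cE j u) l)].

Section Conical.
Variables (K : cosmos) (Q : graph) (D : diagram Q (isof_scat K)).
Variable l : forall j, arr (base (dob D j)) (tot (dob D j)).
Variable ep : forall j, hom (tot (dob D j)) (tot (dob D j)) 1.
Variables (cE : cone spoint (tot_diagram D)) (cB : cone spoint (base_diagram D)).
Hypotheses (hE : is_limit cE) (hB : is_limit cB).
Variable p : arr (apex cE) (apex cB).
Hypothesis hp : over_cones p.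
Notation eps_isos m := (forall j, eps_iso (ep j) (comp (proj cE j tt) m)).

Lemma conical_vertex (X : K) (beta : arr X (apex cB))
    (m : forall j, arr X (tot (dob D j))) :
  (forall a, comp (mor_tot (darr D a)) (m (dom a)) = m (cod a)) ->
  (forall j, comp (isof_arr (dob D j)) (m j) = comp (proj cB j tt) beta) ->
  exists f : arr X (apex cE), comp p f = beta /\ forall j, comp (proj cE j tt) f = m j.
Proof.
move=> hm ho.
have [a|f hf] := @conical_ex _ _ _ _ hE X 0 m; first by rewrite post0; apply: hm.
have {}hf j : comp (proj cE j tt) f = m j by rewrite -post0.
exists f; split=> //; rewrite -post0; apply: (conical_ext hB) => j.
by rewrite !post0 comp_assoc (over_cones_proj hp) -comp_assoc hf ho.
Qed.

Lemma conical_edge (X : K) (m y : arr X (apex cE))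
    (g : forall j, hom X (tot (dob D j)) 1) :
  (forall a, post X (mor_tot (darr D a)) 1 (g (dom a)) = g (cod a)) ->
  (forall j, esrc (g j) = comp (proj cE j tt) m) ->
  (forall j, etgt (g j) = comp (proj cE j tt) y) ->
  (forall j, post X (isof_arr (dob D j)) 1 (g j) =
     cst 1 (comp (isof_arr (dob D j)) (comp (proj cE j tt) y))) ->
  exists f : hom X (apex cE) 1,
    [/\ esrc f = m, etgt f = y & post X p 1 f = cst 1 (comp p y)].
Proof.
move=> hg gs gt go.
have [a|f hf] := @conical_ex _ _ _ _ hE X 1 g; first exact: hg.
exists f; split.
- by apply: (conical_ext hE) => j; rewrite -smap_esrc hf gs post0.
- by apply: (conical_ext hE) => j; rewrite -smap_etgt hf gt post0.
apply: (conical_ext hB) => j.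
rewrite post_comp (over_cones_proj hp) -post_comp hf go.
by rewrite smap_cst post0 !comp_assoc (over_cones_proj hp).
Qed.

(** Only generic cases are used: lifting [idv (apex cB)] gives the section [m], and an edge from
    [comp m p] to the identity is the counit. *)
Lemma conical_section :
  (forall (X : K) (beta : arr X (apex cB)),
     exists m, comp p m = beta /\ eps_isos m) ->
  (forall (X : K) (m y : arr X (apex cE)), comp p m = comp p y -> eps_isos m ->
     exists f : hom X (apex cE) 1,
       [/\ esrc f = m, etgt f = y & post X p 1 f = cst 1 (comp p y)]) ->
  limit_section ep p.
Proof.
move=> V G; have [m [hm im]] := V _ (idv (apex cB)).
have [||f [fs ft fo]] := G _ (comp m p) (idv (apex cE)).
- by rewrite comp_assoc hm comp_id0l comp_id0r.
- by move=> j; rewrite comp_assoc; apply: eps_iso_pre.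
exists m, f; split=> //; last by move=> j [].
by rewrite fo comp_id0r.
Qed.

Hypothesis hl : forall j, strict_rali (isof_arr (dob D j)) (l j) (ep j).
Hypothesis hm : forall a, eps_iso (ep (cod a)) (comp (mor_tot (darr D a)) (l (dom a))).

Lemma own_section j (X : K) (beta : arr X (base (dob D j))) :
  comp (isof_arr (dob D j)) (comp (l j) beta) = beta /\
  eps_iso (ep j) (comp (l j) beta).
Proof.
split; first by rewrite comp_assoc (strict_section (hl j)) comp_id0l.
by apply: eps_iso_pre; apply: (strict_iso (hl j)).
Qed.

Lemma own_edge j (X : K) (m y : arr X (apex cE)) : comp p m = comp p y -> eps_isos m ->
  exists f : hom X (tot (dob D j)) 1, [/\ esrc f = comp (proj cE j tt) m,
    etgt f = comp (proj cE j tt) y & post X (isof_arr (dob D j)) 1 f =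
      cst 1 (comp (isof_arr (dob D j)) (comp (proj cE j tt) y))].
Proof.
move=> my im; apply: (over_edge (isof_arrP _) (hl j)) => //.
by rewrite !comp_assoc -(over_cones_proj hp) -!comp_assoc my.
Qed.

End Conical.

Section Cases.
Variable K : cosmos.

Lemma product_section (I : small) (D : diagram (discrete I) (isof_scat K)) l ep
    (cE : cone spoint (tot_diagram D)) (cB : cone spoint (base_diagram D))
    (p : arr (apex cE) (apex cB)) :
  is_limit cE -> is_limit cB -> over_cones p ->
  (forall j, strict_rali (isof_arr (dob D j)) (l j) (ep j)) ->
  limit_section ep p.
Proof.
move=> hE hB hp hl; apply: (conical_section) => X => [beta|m y my im].
  have [||m [mo mj]] := conical_vertex hE hB hp (beta := beta)
    (m := fun j => comp (l j) (comp (proj cB j tt) beta)).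
  - by case.
  - by move=> j; case: (own_section hl (comp (proj cB j tt) beta)).
  exists m; split=> // j; rewrite mj.
  by case: (own_section hl (comp (proj cB j tt) beta)).
pose g j := cid (own_edge hp hl j my im).
apply: (conical_edge hE hB hp (g := fun j => proj1_sig (g j))).
- by case.
- by move=> j; case: (proj2_sig (g j)).
- by move=> j; case: (proj2_sig (g j)).
- by move=> j; case: (proj2_sig (g j)).
Qed.

Lemma pullback_section (D : diagram cospan (isof_scat K)) l ep
    (cE : cone spoint (tot_diagram D)) (cB : cone spoint (base_diagram D))
    (p : arr (apex cE) (apex cB)) :
  isof_isofib (darr D true) ->
  is_limit cE -> is_limit cB -> over_cones p ->
  (forall j, strict_rali (isof_arr (dob D j)) (l j) (ep j)) ->
  (forall a, eps_iso (ep (cod a)) (comp (mor_tot (darr D a)) (l (dom a)))) ->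
  limit_section ep p.
Proof.
move=> hD hE hB hp hl hm; have [_ _ rel] := hD.
have sT := mor_sq (darr D true); have sF := mor_sq (darr D false).
apply: conical_section => X => [beta|m y my im].
  have [Fo iF] := own_section hl (j := Some false) (comp (proj cB (Some false) tt) beta).
  set mF := comp (l (Some false)) _ in Fo iF.
  (* At [None] the image of the section over the free corner replaces the one given by [l None], to
     which it is only isomorphic; the corner [true] is then lifted over it. *)
  pose mN := comp (mor_tot (darr D false)) mF.
  have iN : eps_iso (ep None) mN.
    exact: (eps_iso_mor (isof_arrP _) sF (hl (Some false)) (hl None) (hm false)).
  have No : comp (isof_arr (dob D None)) mN = comp (proj cB None tt) beta.
    rewrite /mN comp_assoc sF -comp_assoc Fo comp_assoc.
    by congr comp; apply: (conical_proj cB false).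
  have [|//|mT [TN To iT]] := lift_vertex (isof_arrP _) (isof_arrP _) sT rel
    (hl (Some true)) (hl None) (hm true) (m0 := mN)
    (beta := comp (proj cB (Some true) tt) beta).
    by rewrite No comp_assoc; congr comp; rewrite -(conical_proj cB true).
  have [||m [mo mj]] := conical_vertex hE hB hp (beta := beta)
    (m := fun j : node cospan => match j return arr X (tot (dob D j)) with
      | Some true => mT | Some false => mF | None => mN end).
  - by case.
  - by case=> [[]|].
  by exists m; split=> // -[[]|]; rewrite mj.
have [gF [Fs Ft Fo]] := own_edge hp hl (Some false) my im.
pose gN := post X (mor_tot (darr D false)) 1 gF.
have eN z : comp (proj cE None tt) z = comp (mor_tot (darr D false)) (comp (proj cE (Some false) tt) z).
  by rewrite comp_assoc; congr comp; rewrite -(conical_proj cE false).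
have eN' z : comp (proj cE None tt) z = comp (mor_tot (darr D true)) (comp (proj cE (Some true) tt) z).
  by rewrite comp_assoc; congr comp; rewrite -(conical_proj cE true).
have Ns : esrc gN = comp (proj cE None tt) m by rewrite smap_esrc Fs post0 eN.
have Nt : etgt gN = comp (proj cE None tt) y by rewrite smap_etgt Ft post0 eN.
have No : post X (isof_arr (dob D None)) 1 gN =
    cst 1 (comp (isof_arr (dob D None)) (comp (proj cE None tt) y)).
  by rewrite post_comp sF -post_comp Fo smap_cst post0 eN comp_assoc -sF -comp_assoc.
have [||||gT [Ts Tt TN To]] := lift_edge (isof_arrP _) (isof_arrP _) sT rel
    (hl (Some true)) (hl None) (hm true) (m1 := comp (proj cE (Some true) tt) m)
    (y1 := comp (proj cE (Some true) tt) y) (g0 := gN) _ (im (Some true)).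
- by rewrite !comp_assoc -(over_cones_proj hp) -!comp_assoc my.
- by rewrite Ns eN'.
- by rewrite Nt eN'.
- by rewrite No eN' [in RHS]comp_assoc -sT -comp_assoc.
apply: (conical_edge hE hB hp
  (g := fun j : node cospan => match j return hom X (tot (dob D j)) 1 with
      | Some true => gT | Some false => gF | None => gN end)).
- by case.
- by case=> [[]|].
- by case=> [[]|].
- by case=> [[]|].
Qed.

Lemma tower_section (D : diagram tower (isof_scat K)) l ep
    (cE : cone spoint (tot_diagram D)) (cB : cone spoint (base_diagram D))
    (p : arr (apex cE) (apex cB)) :
  (forall n : nat, isof_isofib (darr D n)) ->
  is_limit cE -> is_limit cB -> over_cones p ->
  (forall j, strict_rali (isof_arr (dob D j)) (l j) (ep j)) ->
  (forall a, eps_iso (ep (cod a)) (comp (mor_tot (darr D a)) (l (dom a)))) ->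
  limit_section ep p.
Proof.
move=> hD hE hB hp hl hm.
have s (n : nat) : comp (isof_arr (dob D n)) (mor_tot (darr D n)) =
   comp (mor_base (darr D n)) (isof_arr (dob D n.+1)) := mor_sq (darr D n).
apply: conical_section => X => [beta|m y my im].
  have [||mm [mP mR]] := @dependent_choice (fun n : nat => arr X (tot (dob D n)))
    (fun n m => comp (isof_arr (dob D n)) m = comp (proj cB n tt) beta /\
                eps_iso (ep n) m)
    (fun n m m' => comp (mor_tot (darr D n)) m' = m).
  - by have h := own_section hl (j := 0) (comp (proj cB 0 tt) beta); eexists; apply: h.
  - move=> n x [xo ix]; have [_ _ rel] := hD n.
    have [||m' [h1 h2 h3]] := lift_vertex (isof_arrP _) (isof_arrP _) (s n) rel
      (hl n.+1) (hl n) (hm n) (m0 := x) (beta := comp (proj cB n.+1 tt) beta) => //.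
      by rewrite xo comp_assoc; congr comp; rewrite -(conical_proj cB n).
    by exists m'.
  have [j|m [mo mj]] := conical_vertex hE hB hp (beta := beta) (m := mm) mR.
    by case: (mP j).
  by exists m; split=> // j; rewrite mj; case: (mP j).
have eS (n : nat) z : comp (proj cE n tt) z =
    comp (mor_tot (darr D n)) (comp (proj cE n.+1 tt) z).
  by rewrite comp_assoc; congr comp; rewrite -(conical_proj cE n).
have [||g [gP gR]] := @dependent_choice (fun n : nat => simplex (hom X (tot (dob D n))) 1)
    (fun n f => [/\ esrc f = comp (proj cE n tt) m, etgt f = comp (proj cE n tt) y &
      post X (isof_arr (dob D n)) 1 f =
      cst 1 (comp (isof_arr (dob D n)) (comp (proj cE n tt) y))])
    (fun n f f' => post X (mor_tot (darr D n)) 1 f' = f).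
- exact: (own_edge hp hl 0 my im).
- move=> n f [fs ft fo]; have [_ _ rel] := hD n.
  have [||||g [gs gt gN go]] := lift_edge (isof_arrP _) (isof_arrP _) (s n) rel
    (hl n.+1) (hl n) (hm n) (m1 := comp (proj cE n.+1 tt) m)
    (y1 := comp (proj cE n.+1 tt) y) (g0 := f) _ (im n.+1).
  + by rewrite !comp_assoc -(over_cones_proj hp) -!comp_assoc my.
  + by rewrite fs eS.
  + by rewrite ft eS.
  + by rewrite fo eS [in RHS]comp_assoc -s -comp_assoc.
  by exists g.
apply: (conical_edge hE hB hp (g := g)).
- exact: gR.
- by move=> j; case: (gP j).
- by move=> j; case: (gP j).
- by move=> j; case: (gP j).
Qed.


(** There are no links, hence nothing to lift: by the enriched universal property [l0] and [eps0]
    act through the legs, and the equations hold legwise. *)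
Lemma power_section (V : sset) (A : isof_scat K) l0 eps0
    (cE : cone V (tot_diagram (family (fun _ : unit => A))))
    (cB : cone V (base_diagram (family (fun _ : unit => A))))
    (p : arr (apex cE) (apex cB)) :
  is_limit cE -> is_limit cB -> over_cones p ->
  strict_rali (isof_arr A) l0 eps0 ->
  @limit_section K V _ (family (fun _ : unit => A)) (fun _ => eps0) cE cB p.
Proof.
move=> hE hB hp hl; pose q := isof_arr A.
pose lE m (v : V m) : hom (apex cE) (tot A) m := leg cE tt m v.
pose lB m (v : V m) : hom (apex cB) (base A) m := leg cB tt m v.
have pE m (v : V m) : comp (lB m v) (cst m p) = comp (cst m q) (lE m v) := hp tt m v.
have extE X n (f f' : hom X (apex cE) n) :
    (forall m (v : V m) (t : mono m n), comp (lE m v) (act t f) = comp (lE m v) (act t f')) ->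
    f = f' by move=> h; apply: (limit_ext hE) => -[] m v t; apply: h.
have extB X n (f f' : hom X (apex cB) n) :
    (forall m (v : V m) (t : mono m n), comp (lB m v) (act t f) = comp (lB m v) (act t f')) ->
    f = f' by move=> h; apply: (limit_ext hB) => -[] m v t; apply: h.
have lnat m n (t : mono m n) (v : V n) :
    comp (cst m l0) (lB m (act t v)) = act t (comp (cst n l0) (lB n v)).
  by rewrite comp_nat act_cst /lB smap_nat.
have [|l hlE] := limit_arr hE (psi := fun _ : unit => SMap lnat); first by case.
have {}hlE m (v : V m) : comp (lE m v) (cst m l) = comp (cst m l0) (lB m v) := hlE tt m v.
have enat m n (t : mono m n) (vs : sprod V (Delta 1) n) :
    comp (act (act t vs).2 eps0) (lE m (act t vs).1) =
    act t (comp (act vs.2 eps0) (lE n vs.1)).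
  by rewrite comp_nat -act_comp /lE -smap_nat.
have [|eps [heps _]] := hE (apex cE) 1 (fun _ : unit => SMap enat); first by case.
have {}heps m (v : V m) (t : mono m 1) :
    comp (lE m v) (act t eps) = comp (act t eps0) (lE m v) := heps tt m v t.
have qE0 n : comp (cst n q) (cst n l0) = cst n (idv _).
  by rewrite -cst_comp (strict_section hl).
have pl : comp p l = idv _.
  apply: extB => m v t; rewrite !act_vertex cst_comp comp_assoc pE -comp_assoc hlE.
  by rewrite comp_assoc qE0 comp_idl comp_idr.
exists l, eps; split=> //.
- apply: extE => m v t.
  rewrite [act t (comp l p)]act_vertex cst_comp comp_assoc hlE -comp_assoc pE.
  rewrite /esrc /vtx -act_comp heps act_comp -/(vtx ord0 eps0) -/(esrc eps0).
  by rewrite (strict_src hl) act_vertex cst_comp comp_assoc.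
- apply: extE => m v t; rewrite [act t (idv _)]act_vertex comp_idr.
  rewrite /etgt /vtx -act_comp heps act_comp -/(vtx ord_max eps0) -/(etgt eps0).
  by rewrite (strict_tgt hl) act_vertex comp_idl.
- apply: extB => m v t; rewrite /= comp_nat !act_cst comp_assoc pE -comp_assoc heps.
  rewrite comp_assoc -(act_cst t q) -comp_nat.
  have -> : comp (cst 1 q) eps0 = cst 1 q := strict_over hl.
  by rewrite act_cst.
case=> v; have -> : comp (proj cE tt v) l = comp l0 (proj cB tt v).
  by have := hlE 0 v; rewrite !cst0.
by apply: eps_iso_pre; apply: (strict_iso hl).
Qed.

End Cases.

Section LimitRali.
Variables (K : cosmos) (U : sset) (Q : graph) (D : diagram Q (isof_scat K)).
Hypothesis hD : cosmological (@isof_isofib K) U D.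
Variable l : forall j, arr (base (dob D j)) (tot (dob D j)).
Variable ep : forall j, hom (tot (dob D j)) (tot (dob D j)) 1.
Hypothesis hl : forall j, strict_rali (isof_arr (dob D j)) (l j) (ep j).
Hypothesis hm : forall a, eps_iso (ep (cod a)) (comp (mor_tot (darr D a)) (l (dom a))).
Variables (cE : cone U (tot_diagram D)) (cB : cone U (base_diagram D)).
Hypotheses (hE : is_limit cE) (hB : is_limit cB).
Variable p : arr (apex cE) (apex cB).
Hypothesis hp : over_cones p.

Lemma limit_section_ex : limit_section ep p.
Proof.
move: l ep hl hm cE cB hE hB p hp.
case: hD => [I D' l' ep' hl' _ cE' cB' hE' hB' p' hp'|D' h l' ep' hl' hm' cE' cB' hE' hB' p' hp'
  |D' h l' ep' hl' hm' cE' cB' hE' hB' p' hp'|V A l' ep' hl' _ cE' cB' hE' hB' p' hp'].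
- exact: (product_section hE' hB' hp' hl').
- exact: (pullback_section h hE' hB' hp' hl' hm').
- exact: (tower_section h hE' hB' hp' hl' hm').
- have [l0 [eps0 [h1 h2 h3 h4 h5]]] := power_section hE' hB' hp' (hl' tt).
  by exists l0, eps0; split=> // -[].
Qed.

Theorem limit_strict_rali : exists l' eps', strict_rali p l' eps' /\
  forall j (u : U 0), eps_iso (ep j) (comp (proj cE j u) l').
Proof.
have [l' [eps [pl es et eo im]]] := limit_section_ex.
exists l', eps; split=> //; split=> //.
(* The component at [j] and [u] is an edge in a fibre from an initial 0-arrow to itself, hence
   invertible. *)
apply: (limit_iso_edge (tot_cosmological hD) hE) => j u.
have ls : esrc (pre (apex cE) l' 1 eps) = l'.
  by rewrite smap_esrc es pre0 -comp_assoc pl comp_id0r.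
have lt : etgt (pre (apex cE) l' 1 eps) = l' by rewrite smap_etgt et pre0 comp_id0l.
apply: (eps_iso_edge (isof_arrP _) (hl j) (beta := proj cB j u)).
- rewrite post_comp -(over_cones_proj hp) -post_comp post_pre eo.
  by rewrite !smap_cst pre0 post0 pl comp_id0r.
- by rewrite smap_esrc ls post0.
- by rewrite smap_etgt lt post0.
Qed.

(** Projected to [j], the counit at [m] joins two initial 0-arrows of one fibre, so its components
    are invertible and [limit_iso_edge] applies. *)
Lemma limit_eps_iso l' eps' : strict_rali p l' eps' ->
  (forall j (u : U 0), eps_iso (ep j) (comp (proj cE j u) l')) ->
  forall (X : K) (m : arr X (apex cE)),
  (forall j (u : U 0), eps_iso (ep j) (comp (proj cE j u) m)) -> eps_iso eps' m.
Proof.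
move=> h' im' X m im.
apply: (limit_iso_edge (tot_cosmological hD) hE) => j u.
apply: (eps_iso_edge (isof_arrP _) (hl j) (beta := comp (proj cB j u) (comp p m))).
- rewrite post_comp -(over_cones_proj hp) -post_comp (eps_over h' erefl).
  by rewrite smap_cst post0.
- by rewrite smap_esrc (eps_src h' erefl) post0 comp_assoc; apply: eps_iso_pre.
- by rewrite smap_etgt (eps_tgt h') post0.
Qed.

End LimitRali.

(** * Limits in tight parts *)

Lemma vtx0 (X : sset) (i : 'I_1) (x : X 0) : vtx i x = x.
Proof. by rewrite /vtx act_vertex cst0. Qed.

Section TightLimits.
Variables (L : escat) (U : sset) (Q : graph) (D : diagram Q (tight_part L)).

Lemma tight_arrow (A B : tight_part L) (f : arr A B) :
  @tight L A B (proj1_sig f).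
Proof. by have := proj2_sig f ord0; rewrite vtx0. Qed.

(** The tight homs are full simplicial subsets: the simplex supplied by the loose limit is tight
    once its vertices are, and these are tested on the projections. *)
Lemma limit_of_loose_limit (c : cone U D) :
  is_limit (map_cone (tight_incl L) c) ->
  (forall (X : loose L) (f : arr X (apex (map_cone (tight_incl L) c))),
    (forall j (u : U 0), tight (comp (proj (map_cone (tight_incl L) c) j u) f)) ->
    tight f) ->
  is_limit c.
Proof.
move=> hc ht X n phi hphi.
have hnat j k m (s : mono k m) (v : sprod U (Delta n) m) :
    proj1_sig (phi j k (act s v)) = act s (proj1_sig (phi j m v)).
  by rewrite smap_nat.
have [|f [hf fu]] := hc X n (fun j => SMap (hnat j)).
  by move=> a m v; apply: (congr1 (@proj1_sig _ _) (hphi a m v)).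
have tf i : tight (vtx i f).
  apply: ht => j u; have h := hf j 0 u (mono_const 0 i).
  rewrite [comp _ _]h; exact: tight_arrow.
exists (exist _ f tf); split=> [j m u t|f' hf'].
  by apply: sig_eq; apply: hf.
apply: sig_eq; apply: fu => j m u t.
exact: (congr1 (@proj1_sig _ _) (hf' j m u t)).
Qed.

End TightLimits.

Lemma tight_functor_limit (L L' : escat) (F : efunctor L L') (U : sset) (Q : graph)
    (D : diagram Q (tight_part L)) (c : cone U D) :
  is_limit (map_cone F (map_cone (tight_incl L) c)) ->
  is_limit (map_cone (tight_incl L') (map_cone (tight_functor F) c)).
Proof. by move=> hc X n phi hphi; apply: (hc X n phi hphi). Qed.

Section Transfer.
Variables (C C' : scat) (F : sfunctor C C') (U : sset) (Q : graph) (D : diagram Q C).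

Lemma map_is_iso (A B : C) (f : arr A B) : is_iso f -> is_iso (fhom F 0 f).
Proof.
by case=> g [gf fg]; exists (fhom F 0 g); rewrite -!fhom_comp gf fg !fhom_id.
Qed.

Lemma map_limit_of_iso (c c' : cone U D) (f : arr (apex c) (apex c')) :
  is_limit (map_cone F c') -> is_iso f ->
  (forall j m (u : U m), comp (leg c' j m u) (cst m f) = leg c j m u) ->
  is_limit (map_cone F c).
Proof.
move=> hc' hf hl.
apply: (limit_of_iso (c := map_cone F c) (c' := map_cone F c') hc' (map_is_iso hf)) => j m u.
by rewrite /= -smap_cst -fhom_comp hl.
Qed.

End Transfer.

Lemma map_map_limit_of_iso (C C' C'' : scat) (G : sfunctor C' C'') (F : sfunctor C C')
    (U : sset) (Q : graph) (D : diagram Q C) (c c' : cone U D)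
    (f : arr (apex c) (apex c')) :
  is_limit (map_cone G (map_cone F c')) -> is_iso f ->
  (forall j m (u : U m), comp (leg c' j m u) (cst m f) = leg c j m u) ->
  is_limit (map_cone G (map_cone F c)).
Proof.
move=> hc' hf hl; apply: (@map_limit_of_iso _ _ G _ _ _ (map_cone F c) (map_cone F c') (fhom F 0 f) hc'
  (map_is_iso F hf)) => j m u.
by rewrite /= -smap_cst -fhom_comp hl.
Qed.

Section PointwiseCone.
Variables (K : cosmos) (U : sset) (Q : graph) (D : diagram Q (isof_scat K)).
Variables (cE : cone U (tot_diagram D)) (cB : cone U (base_diagram D)).
Variable p : arr (apex cE) (apex cB).
Hypotheses (hp : over_cones p) (ip : isofib p).

Definition pointwise_cone : cone U D.
Proof.
refine (@Cone U Q _ D (@IsofObj K (apex cE) (apex cB) p ip)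
  (fun j => @SMap U (@hom (isof_scat K) (IsofObj ip) (dob D j))
    (fun n u => exist _ (leg cE j n u, leg cB j n u) _) _) _).
  by move=> a n u; apply: sig_eq; congr pair;
    [apply: (leg_nat cE) | apply: (leg_nat cB)].
Unshelve.
- exact/esym/hp.
- by move=> m n t u; apply: sig_eq; rewrite /= !smap_nat.
Defined.

Lemma pointwise_limit : is_limit cE -> is_limit cB -> is_limit pointwise_cone.
Proof.
move=> hE hB X n phi hphi.
have n1 j k m (s : mono k m) (v : sprod U (Delta n) m) :
    (proj1_sig (phi j k (act s v))).1 = act s (proj1_sig (phi j m v)).1.
  by rewrite smap_nat.
have n2 j k m (s : mono k m) (v : sprod U (Delta n) m) :
    (proj1_sig (phi j k (act s v))).2 = act s (proj1_sig (phi j m v)).2.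
  by rewrite smap_nat.
have [|f [hf fu]] := hE (tot X) n (fun j => SMap (n1 j)).
  by move=> a m v; apply: (congr1 (fun z => (proj1_sig z).1) (hphi a m v)).
have [|g [hg gu]] := hB (base X) n (fun j => SMap (n2 j)).
  by move=> a m v; apply: (congr1 (fun z => (proj1_sig z).2) (hphi a m v)).
have sq : comp (cst n p) f = comp g (cst n (isof_arr X)).
  apply: (limit_ext hB) => j m u t.
  rewrite !comp_nat !act_cst !comp_assoc hp hg -comp_assoc hf.
  exact: (proj2_sig (phi j m (u, t))).
exists (exist _ (f, g) sq); split=> [j m u t|[[f' g'] sq'] h'].
  apply: sig_eq; rewrite /=.
  by have := hf j m u t; have := hg j m u t; rewrite /= => -> ->; case: (proj1_sig _).
apply: sig_eq => /=; congr pair.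
  by apply: fu => j m u t; apply: (congr1 (fun z => (proj1_sig z).1) (h' j m u t)).
by apply: gu => j m u t; apply: (congr1 (fun z => (proj1_sig z).2) (h' j m u t)).
Qed.

End PointwiseCone.

(** * Tight limits of ralis *)

Section RaliLimit.
Variables (K : cosmos) (U : sset) (Q : graph) (D : diagram Q (tight_part (Rali K))).
Hypothesis hD : cosmological (@Rali_isofib K) U D.

Definition isof_diagram : diagram Q (isof_scat K) :=
  map_diagram (Rali_incl K) (map_diagram (tight_incl (Rali K)) D).

Lemma isof_cosmological : cosmological (@isof_isofib K) U isof_diagram.
Proof.
rewrite /isof_diagram; case: hD => [I D'|D' h|D' h|V A].
- exact: cosm_product.
- by apply: cosm_pullback; apply: h.
- by apply: cosm_tower; apply: h.
- by rewrite /map_diagram discrete_diagram_eq; apply: cosm_power.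
Qed.

Theorem rali_limit_ex : exists c : cone U D,
  is_limit (map_cone (Rali_incl K) (map_cone (tight_incl (Rali K)) c)) /\
  is_tight_limit c.
Proof.
pose D' := isof_diagram; have hD' := isof_cosmological; rewrite -/D' in hD'.
have ex j := cid (rali_strict (isof_arrP (dob D' j)) (rali_isofP (dob D j))).
pose l j := proj1_sig (ex j).
have ex2 j := cid (proj2_sig (ex j)).
pose ep j := proj1_sig (ex2 j).
have hl j : strict_rali (isof_arr (dob D' j)) (l j) (ep j) := proj2_sig (ex2 j).
have hm a : eps_iso (ep (cod a)) (comp (mor_tot (darr D' a)) (l (dom a))).
  exact: (rali_morP (darr D' a) (hl (dom a)) (hl (cod a))).1 (tight_arrow (darr D a)).
have [cE hE] := cosmos_lim (cosmosP K) (tot_cosmological hD').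
have [cB hB] := cosmos_lim (cosmosP K) (base_cosmological hD').
have [p hp] := over_cones_ex cE hB.
have ip := limit_isofibration hD' hE hB hp.
have [l' [eps' [hl' im']]] := limit_strict_rali hD' hl hm hE hB hp.
pose L : rali_obj K := @RaliObj K (IsofObj ip) (strict_is_rali ip hl').
pose c' := pointwise_cone hp ip.
have hc' : is_limit c' by apply: pointwise_limit.
have projt j (u : U 0) : is_rali_mor (proj c' j u).
  exact: (rali_morP (proj c' j u) hl' (hl j)).2 (im' j u).
(* The vertices of a leg are the projections at the vertices of [u]. *)
have legt j n (u : U n) i : is_rali_mor (vtx i (leg c' j n u)).
  by rewrite /vtx -smap_nat; apply: projt.
pose lg j n (u : U n) : @hom (tight_part (Rali K)) L (dob D j) n :=
  exist _ (leg c' j n u) (legt j n u).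
have lgnat j m n (t : mono m n) (u : U n) : lg j m (act t u) = act t (lg j n u).
  by apply: sig_eq; apply: (smap_nat (leg c' j)).
have lgD a n (u : U n) : comp (cst n (darr D a)) (lg (dom a) n u) = lg (cod a) n u.
  by apply: sig_eq; apply: (leg_nat c').
pose c : cone U D := @Cone U Q _ D L (fun j => SMap (lgnat j)) lgD.
(* Strict data turn tightness of [f] into initiality of the image of a section of [X], which
   [limit_eps_iso] detects on the projections. *)
have refl (X : rali_obj K) (f : @hom (rali_scat K) X L 0) :
    (forall j (u : U 0), is_rali_mor (@comp (isof_scat K) _ _ _ _ (proj c' j u) f)) -> is_rali_mor f.
  move=> h; have [lX [eX hX]] := rali_strict (isof_arrP X) (rali_isofP X).
  apply: (rali_morP (p := rali_isof X) (q := rali_isof L) f hX hl').2.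
  apply: (limit_eps_iso hD' hl hE hp hl' im') => j u.
  rewrite comp_assoc; exact: (rali_morP _ hX (hl j)).1 (h j u).
have loose : is_limit (map_cone (tight_incl (Rali K)) c).
  by move=> X n phi hphi; apply: (hc' (rali_isof X) n phi hphi).
exists c; split; first by move=> X n phi hphi; apply: (hc' X n phi hphi).
split; [|exact: loose|].
  by apply: (limit_of_loose_limit loose) => X f h; apply: refl h.
move=> X f; split=> [tf j u|h]; last exact: refl h.
exact: (@is_rali_mor_comp K X L (dob D j) (proj c' j u) f (projt j u) tf).
Qed.

End RaliLimit.

(** Two limit cones differ by an isomorphism of the tight part. Both it and its inverse are tight,
    so the clauses pass from one cone to the other. *)
Lemma tight_limit_transfer (L : escat) (U : sset) (Q : graph)
    (D : diagram Q (tight_part L)) (c c0 : cone U D) :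
  is_limit c -> is_tight_limit c0 -> is_tight_limit c.
Proof.
move=> hc [hc0 ll rr].
have [f If hf] := limit_comparison hc hc0; have [g [gf fg]] := If.
split=> //; first exact: (map_limit_of_iso ll If hf).
move=> X h; split=> [th j u|th].
  by apply: tight_comp th; apply: (tight_arrow (leg c j 0 u)).
have -> : h = comp (proj1_sig g) (comp (proj1_sig f) h).
  rewrite comp_assoc; have /(congr1 (@proj1_sig _ _)) /= -> := gf.
  by rewrite comp_id0l.
apply: tight_comp; first exact: (tight_arrow g).
apply/rr => j u; have := th j u; congr tight.
rewrite comp_assoc; congr comp.
have h0 := hf j 0 u; rewrite cst0 in h0.
exact: (congr1 (@proj1_sig _ _) (esym h0)).
Qed.

Theorem proposition4p2p1 (K : cosmos) :
  tight_cosmological_limits_exist (@Rali_isofib K) /\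
  preserves_tight_cosmological_limits (@Rali_isofib K) (Rali_incl K).
Proof.
split=> U Q D.
  move=> hD; have [c0 [_ h0]] := rali_limit_ex hD.
  split; first by exists c0; case: h0.
  by move=> c hc; apply: tight_limit_transfer hc h0.
move=> c hD [hc _ _]; have [c0 [h1 [h0 _ _]]] := rali_limit_ex hD.
have [f If hf] := limit_comparison hc h0.
have lim := map_map_limit_of_iso h1 If hf.
have lim' := tight_functor_limit lim.
(* In the chordate target every 0-arrow is tight, so the limit in the loose part yields the other
   two clauses. *)
split; [|exact: lim'|].
  by apply: (limit_of_loose_limit lim').
by [].
Qed.
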